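(* Let $m$ be a prime, and let $p$ be a prime that splits completely in $\mathbb Z[\epsilon_m,\frac1{mn}]$, so that a prime $\mathfrak p$ above $p$ has residue field $k(\mathfrak p)=\mathbb F_p$. Let $1\le a_1,\dots,a_d<m$ be integers with $a_1+\cdots+a_d\not\equiv0\bmod m$, let $\alpha_1,\dots,\alpha_{d-2}$ be distinct elements of $k(\mathfrak p)\setminus\{0,1\}$, put $$f=x^{a_1}(x-1)^{a_2}(x-\alpha_1)^{a_3}\cdots(x-\alpha_{d-2})^{a_d},$$ and let $Y_{\mathfrak p}$ be the proper smooth model over $k(\mathfrak p)$ of the plane curve $y^m=f(x)$. Assume that $$\Big[\Big\langle\frac{t a_1}{m}\Big\rangle+\cdots+\Big\langle\frac{t a_d}{m}\Big\rangle\Big]\neq 0\quad\text{for each } t,\ 1\le t\le m-1.$$ Then the following are equivalent: (i) $Y_{\mathfrak p}$ has $p$-rank $0$; (ii) for all $l,j$ with $1\le l\le d-2$ and $1\le j\le m-1$, $$\sum_{\substack{q(x)\\ \deg q(x)=l}}\big[f(\mathrm{div}(q(x)))\big]^{j(p-1)/m}=0;$$ (iii) for all $l,j$ with $1\le l\le d-2$ and $1\le j\le m-1$, $$\sum_{\substack{q(x)\\ \deg q(x)=l}}\big[q(0)^{a_1}q(1)^{a_2}q(\alpha_1)^{a_3}\cdots q(\alpha_{d-2})^{a_d}\big]^{j(p-1)/m}=0.$$ Here the sums are over all monic polynomials $q(x)\in\mathbb F_p[x]$ of degree $l$, and the equalities are in $k(\mathfrak p)=\mathbb F_p$.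
   Context: $\epsilon_m$ is a primitive $m$-th root of unity and $n$ is the product of the rational primes whose primes of $\mathbb Z[\epsilon_m]$ have residue field with fewer than $d$ elements; $p$ splits completely in $\mathbb Z[\epsilon_m,\frac1{mn}]$ means $p\nmid mn$ and $p\equiv1\bmod m$. $[\,\cdot\,]$ is the integer part and $\langle\frac ab\rangle=\frac ab-[\frac ab]$. For a monic polynomial $q(x)$, $f(\mathrm{div}(q(x)))$ means $f$ evaluated on the divisor of zeros of $q$ in the affine line, i.e. $\prod_\beta f(\beta)$ over the roots $\beta$ of $q$ in an algebraic closure, counted with multiplicity. A proper smooth geometrically irreducible curve $W$ over a finite field of characteristic $p$ has $p$-rank $0$ if multiplication by $p$ on $\mathrm{Pic}^0_W$ has $\mathrm{Ker}[p](\mathbb F)=\{0\}$, with $\mathbb F$ an algebraic closure of $\mathbb F_p$. *)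

(* Defs.v *)
From HB Require Import structures.
From mathcomp Require Import all_boot all_order all_algebra all_field.
From mathcomp Require Import boolp.
From mathcomp.multinomials Require Import freeg.

Set Implicit Arguments.
Unset Strict Implicit.
Unset Printing Implicit Defensive.

Import Order.TTheory GRing.Theory Num.Theory.
Local Open Scope ring_scope.

Definition in_Zadj (eps u : algC) : Prop :=
  exists q : {poly int}, u = (map_poly (intr : int -> algC) q).[eps].

(* F is the residue field of a prime of Z[eps] above l: there is a surjective
   ring morphism Z[eps] -> F (its kernel is the prime), and F has
   characteristic l.  Only the values of phi on Z[eps] matter. *)
Definition is_residue_field (eps : algC) (l : nat) (F : finFieldType) : Prop :=
  l \in [pchar F] /\
  exists phi : algC -> F,
    [/\ phi 1 = 1,
        forall u v, in_Zadj eps u -> in_Zadj eps v -> phi (u - v) = phi u - phi v,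
        forall u v, in_Zadj eps u -> in_Zadj eps v -> phi (u * v) = phi u * phi v
      & forall w : F, exists2 u, in_Zadj eps u & phi u = w].

(* The product of the rational primes l whose primes of Z[eps] have residue
   field with fewer than d elements.  Such a residue field contains F_l, so the
   range l < d is no restriction; as Z[eps] is Galois over Z, the residue fields
   of all the primes above l have the same cardinality. *)
Definition small_residue_prod (eps : algC) (d : nat) : nat :=
  (\prod_(l < d | prime l &&
     `[< exists F : finFieldType, is_residue_field eps l F /\ (#|F| < d)%N >])
     l)%N.

Definition splits_completely (m : nat) (eps : algC) (d p : nat) : Prop :=
  ~~ (p %| m * small_residue_prod eps d)%N /\ (p = 1 %[mod m])%N.

(* A smooth proper curve over K is represented by its function field L / K; its
   closed points are the discrete valuations of L trivial on K, and its base
   field K being algebraically closed, they all have degree 1. *)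

(* L is the fraction field of K[X, Y] / (h), with x and y the classes of X and Y.
   In {poly {poly K}} the outer variable is Y and the inner one is X. *)
Definition is_function_field (K L : fieldType) (iota : {rmorphism K -> L})
    (h : {poly {poly K}}) (x y : L) : Prop :=
  let ev (g : {poly {poly K}}) : L :=
    (map_poly (map_poly iota) g).[y%:P].[x] in
  (forall g, ev g = 0 <-> exists q, g = q * h) /\
  (forall u : L, exists g1 g2, ev g2 != 0 /\ u = ev g1 / ev g2).

(* Normalised discrete valuations of L trivial on K.  The value at 0, which
   should be +oo, is set to 0 (by place_const, as 0 = iota 0), so that distinct
   places are distinct functions. *)
Record place (K L : fieldType) (iota : {rmorphism K -> L}) := Place {
  place_ord :> L -> int;
  place_mul : forall u v, u != 0 -> v != 0 ->
    place_ord (u * v) = place_ord u + place_ord v;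
  place_add : forall u v, u != 0 -> v != 0 -> u + v != 0 ->
    Num.min (place_ord u) (place_ord v) <= place_ord (u + v);
  place_const : forall c : K, place_ord (iota c) = 0;
  place_unif : exists2 t, t != 0 & place_ord t = 1
}.

HB.instance Definition _ (K L : fieldType) (iota : {rmorphism K -> L}) :=
  gen_eqMixin (place iota).
HB.instance Definition _ (K L : fieldType) (iota : {rmorphism K -> L}) :=
  gen_choiceMixin (place iota).

Definition principal (K L : fieldType) (iota : {rmorphism K -> L})
    (D : {freeg (place iota) / int}) : Prop :=
  exists2 u : L, u != 0 & forall P : place iota, coeff P D = P u.

(* Multiplication by p on Pic^0 (K) = {divisors of degree 0} / {principal
   divisors} has trivial kernel. *)
Definition p_rank0 (K : closedFieldType) (L : fieldType)
    (iota : {rmorphism K -> L}) (p : nat) : Prop :=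
  forall D : {freeg (place iota) / int},
    deg D = 0 -> principal (D *+ p) -> principal D.

Definition branch_pt (k : fieldType) (alpha : seq k) (i : nat) : k :=
  nth 0 [:: 0, 1 & alpha] i.

Definition curve_poly (k : fieldType) (d : nat) (a : 'I_d -> nat)
    (alpha : seq k) : {poly k} :=
  \prod_(i < d) ('X - (branch_pt alpha i)%:P) ^+ a i.

Definition fracpart (r : rat) : rat := r - (Num.floor r)%:~R.

(* f evaluated on the divisor of zeros of q: the product, in K, of the f(b) over
   the roots b in K of the monic polynomial q, with multiplicity *)
Definition eval_div (k : fieldType) (K : closedFieldType)
    (iota : {rmorphism k -> K}) (f q : {poly k}) : K :=
  \prod_(b <- sval (closed_field_poly_normal (map_poly iota q)))
     (map_poly iota f).[b].

(* Main.v *)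
Require Import Defs.
From HB Require Import structures.
From mathcomp Require Import all_boot all_order all_algebra all_field.
From mathcomp Require Import boolp.
From mathcomp.multinomials Require Import freeg.
From mathcomp Require Import zify ring.

Set Implicit Arguments.
Unset Strict Implicit.
Unset Printing Implicit Defensive.

Import Order.TTheory GRing.Theory Num.Theory.
Local Open Scope ring_scope.

(** Let K = Fbar, let c_i be the branch points, z_j = y^j / prod (x - c_i)^[j a_i / m],
    so that z_j^m = f_j := prod (x - c_i)^(j a_i mod m), and s_j = [deg f_j / m].  The
    regular differentials are the sums of h_j / z_j dx with h_j in K[x], deg h_j < s_j.

    As m | p - 1, z_j^p = z_j F_j with F_j = f_j^((p-1)/m); hence x is a p-basis of L,
    and D = d/dx acts on h_j / z_j = (1/z_j)^p h_j F_j through polynomials only.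
    If p times a divisor is div u, then du/u is 0 or a nonzero regular differential fixed
    by the Cartier operator, i.e. D^(p-1) eta = - eta^p (Jacobson's formula).  Conversely
    a fixed eta = h / z_j has an integral u, whose divisor is divisible by p; if the
    rotation rho : y |-> zeta y made div (rho u / u) / p principal, then rho u / u would be
    a p-th power up to a constant and rho would fix eta, which is absurd.  So the p-rank
    is 0 iff for no j there is a nonzero fixed h_j, i.e. iff all the Hasse-Witt matrices
    H_j (whose entries are coefficients of F_j and lie in F_p) are nilpotent.

    The traces are - tr H_j^n = N_n := sum over x in F_(p^n) of prod_(i < n) F_j (x^(p^i)),
    and N_n and the sums S_l of (ii) or (iii) over monic q of degree l are tied by Newton's
    identities l S_l = sum_(1 <= n <= l) N_n S_(l-n).  The hypothesis on integer parts gives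
    s_j <= d - 2 < p, so that H_j is nilpotent iff S_l = 0 for 1 <= l <= d - 2. *)

(** * Nilpotent matrices and traces *)

(** A place is just a valuation of L, so neither Riemann-Roch nor the degree of a principal divisor
    nor a Jacobian is at hand. The primality of m makes up for this: each c_i, and infinity because
    m does not divide the sum of the a_i, lies under a single place, of index m, at which the terms
    of a sum of G_j(x) z_j have orders distinct mod m and cannot cancel. Constants, functions
    regular away from infinity and regular differentials are made explicit in this way. Likewise m <
    p makes the ramification tame: at a place over b the terms w^p (x - b)^i, i < p, have orders
    distinct mod p, and this ties the divisor of u to the orders of du/u.

    The integral u of a fixed eta has divisor p E, but it is not evident that E has degree 0. The
    difference between E and its image under rho has degree 0 for a trivial reason; this is why the
    rotation enters. *)

Lemma mxtrace_idempotent (F : fieldType) (n : nat) (e : 'M[F]_n) :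
  e *m e = e -> \tr e = (\rank e)%:R.
Proof.
have /row_fullP[B BC] := col_base_full e; have /row_freeP[C RC] := row_base_free e.
have := mulmx_base e; move: (col_base e) (row_base e) BC RC.
move: (\rank e) B C => r B C U V BU VC <- idUV.
have VU : V *m U = 1%:M.
  have := congr1 (fun M => B *m M *m C) idUV.
  by rewrite !mulmxA BU mul1mx -!mulmxA VC mulmx1.
by rewrite mxtrace_mulC VU mxtrace1.
Qed.

(** Pigeonhole on the powers of [u]. The injection [h] keeps the ring structure of [R] apart from
    the finite structure of [T]. *)
Lemma expr_periodic (R : pzRingType) (T : finType) (h : R -> T) (u : R) :
  injective h ->
  exists a N : nat, [/\ (0 < a)%N, (0 < N)%N & forall i, (a <= i)%N -> u ^+ (i + N) = u ^+ i].
Proof.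
move=> injh; pose g (i : 'I_#|T|.+1) := h (u ^+ i.+1).
have : ~~ injectiveb g.
  by apply/negP => /injectiveP /leq_card; rewrite card_ord ltnn.
case/injectivePn => i [j nij /injh eij].
wlog lij : i j nij eij / (i < j)%N => [hw|].
  case: (ltngtP i j) => [|lji|/val_inj e]; first exact: hw eij.
    by apply: (hw j i) => //; rewrite eq_sym.
  by rewrite e eqxx in nij.
exists i.+1, (j - i)%N; split=> //; first by rewrite subn_gt0.
move=> k lik; rewrite -(subnK lik) -addnA addSn subnKC ?(ltnW lij) //.
by rewrite !exprD eij.
Qed.

(* A power of A is idempotent, and its trace is its rank, which is less than p. *)
Lemma nilpotent_of_trace (F : finFieldType) (p s : nat) (A : 'M[F]_s) :
  p \in [pchar F] -> (s < p)%N -> (forall n, (0 < n)%N -> \tr (A ^+ n) = 0) ->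
  exists n, A ^+ n = 0.
Proof.
move=> pF ltsp trA; have [a [N [a0 N0 per]]] := expr_periodic A (@inj_id 'M[F]_s).
have perk k i : (a <= i)%N -> A ^+ (i + k * N) = A ^+ i.
  elim: k i => [|k IH] i ai; first by rewrite mul0n addn0.
  by rewrite mulSn addnA IH ?per // (leq_trans ai) // leq_addr.
exists (a * N)%N; set e := A ^+ _.
have ee : e *m e = e.
  rewrite -[_ *m _]/(e * e) -exprD perk // leq_pmulr //.
have := mxtrace_idempotent ee; rewrite trA ?muln_gt0 ?a0 // => /esym/eqP.
rewrite -(dvdn_pcharf pF) => dv; apply/eqP; rewrite -mxrank_eq0.
by case: posnP => // r0; have := dvdn_leq r0 dv; rewrite leqNgt (leq_ltn_trans (rank_leq_row _)).
Qed.

(** Over polynomials, [X^r = X^r - B^r] is a multiple of [X - B]. Taking determinants, the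
    characteristic polynomial divides a power of [X]; it is therefore itself a power of [X], and its
    trace coefficient vanishes. *)
Lemma trace_of_nilpotent (F : fieldType) (s : nat) (A : 'M[F]_s) (r n : nat) :
  A ^+ r = 0 -> (0 < n)%N -> \tr (A ^+ n) = 0.
Proof.
move=> Ar n0; have {}Ar : (A ^+ n) ^+ r = 0.
  by rewrite -exprM mulnC exprM Ar expr0n; case: n n0.
move: (A ^+ n) Ar => {n0}B; case: s A B => [|s] A B Br.
  by rewrite [B]flatmx0 mxtrace0.
have : char_poly B %| ('X - 0%:P) ^+ (r * s.+1).
  have cB : comm_mx ('X%:M : 'M[{poly F}]_s.+1) (map_mx polyC B) by exact: comm_scalar_mx.
  have := subrXX_comm r cB.
  rewrite -!rmorphXn /= Br map_mx0 subr0 => /(congr1 determinant).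
  rewrite det_mulmx det_scalar -exprM subr0 => ->.
  exact: dvdp_mulr.
case/dvdp_exp_XsubCP => k [_]; rewrite subr0 => /eqp_eq.
rewrite lead_coefXn (monicP (char_poly_monic _)) !scale1r => cX.
have := size_char_poly B; rewrite cX size_polyXn => -[ks].
have := char_poly_trace B isT; rewrite cX ks coefXn /= ltn_eqF // => /eqP.
by rewrite eq_sym oppr_eq0 => /eqP.
Qed.

Lemma frobenius_roots (K : closedFieldType) (p n : nat) :
  p \in [pchar K] -> (0 < n)%N ->
  exists rs : seq K, [/\ uniq rs, size rs = (p ^ n)%N,
    forall c, (c \in rs) = (c ^+ (p ^ n) == c) &
    'X^(p ^ n) - 'X = \prod_(c <- rs) ('X - c%:P)].
Proof.
move=> pK n0; have p_pr := pcharf_prime pK.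
have pn1 : (1 < p ^ n)%N by rewrite -(exp1n n) ltn_exp2r ?prime_gt1.
pose q : {poly K} := 'X^(p ^ n) - 'X.
have szq : size q = (p ^ n).+1.
  by rewrite size_polyDl size_polyXn // size_polyN size_polyX ltnS.
have mq : q \is monic.
  by rewrite monicE lead_coefDl ?lead_coefXn // size_polyN size_polyX size_polyXn ltnS.
have [rs qE] := closed_field_poly_normal q; rewrite (monicP mq) scale1r in qE.
exists rs; split.
- rewrite -separable_prod_XsubC -qE separable_poly.unlock derivB derivX derivXn.
  suff -> : 'X^((p ^ n).-1) *+ (p ^ n) = 0 :> {poly K}.
    by rewrite sub0r -scaleN1r coprimepZr ?coprimep1 // oppr_eq0 oner_eq0.
  rewrite -mulr_natr natrX -polyC_natr (pcharf0 pK) polyC0 expr0n.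
  by case: n n0 {pn1 q szq mq qE} => //= n _; rewrite mulr0.
- by move/eqP: szq; rewrite qE size_prod_XsubC eqSS => /eqP.
- by move=> c; rewrite -root_prod_XsubC -qE rootE !hornerE subr_eq0.
- exact: qE.
Qed.

(** The columns [w n] of the [H^(a+n)] run through a cycle of length [N], and Frobenius fixes their
    entries. In the sum of the [c^(p^(N-1-n)) w n], with [c] in F_(p^N), raising the coefficients to
    the power [p] has the same effect as moving [w n] to [w n.+1], which is what [H] does. *)
Lemma frobenius_fixed_vector (k : finFieldType) (K : closedFieldType)
    (iota : {rmorphism k -> K}) (p s : nat) (H : 'M[k]_s) :
  p \in [pchar K] -> (forall c : k, c ^+ p = c) -> (forall n, H ^+ n != 0) ->
  exists2 v : 'cV[K]_s, v != 0 & forall i, v i 0 ^+ p = (map_mx iota H *m v) i 0.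
Proof.
move=> pK fixk Hnil; have p_pr := pcharf_prime pK.
have [a [N [a0 N0 per]]] := expr_periodic H (@inj_id 'M[k]_s).
have /matrix0Pn [i0 [j Hij]] := Hnil a.
pose w n := col j (H ^+ (a + n)).
have Hw n : H *m w n = w n.+1.
  by rewrite /w !colE mulmxA addnS exprS.
have wN : w N = w 0%N by rewrite /w per ?addn0.
have [rs [urs szrs memrs _]] := frobenius_roots pK N0.
(* [G.[c]] is the entry [i0] of the vector built from [c]. The degree of [G] is [p^(N-1)], too small
   for [G] to vanish on all of F_(p^N). *)
pose G : {poly K} := \sum_(n < N) (iota (w n i0 0))%:P * 'X^(p ^ (N.-1 - n)).
have GN0 : G`_(p ^ N.-1) != 0.
  rewrite coef_sum (bigD1 (Ordinal N0)) //= subn0 coefCM coefXn eqxx mulr1 big1 ?addr0.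
    by rewrite fmorph_eq0 mxE addn0.
  move=> n; rewrite -val_eqE /= => nn0; rewrite coefCM coefXn eqn_exp2l ?prime_gt1 //.
  by rewrite (_ : (_ == _) = false) ?mulr0 //; have := ltn_ord n; lia.
have szG : (size G <= (p ^ N.-1).+1)%N.
  apply: leq_trans (size_sum _ _ _) _; apply/bigmax_leqP => n _; rewrite mul_polyC.
  apply: leq_trans (size_scale_leq _ _) _; rewrite size_polyXn ltnS leq_pexp2l ?prime_gt0 //.
  exact: leq_subr.
have [c crs Gc] : exists2 c, c \in rs & G.[c] != 0.
  apply/hasP; rewrite -[has _ _]negbK; apply/negP => /hasPn h.
  have nzG : G != 0 by apply: contraNneq GN0 => ->; rewrite coef0.
  have allG : all (root G) rs by apply/allP => c /h /negPn.
  have := leq_trans (max_poly_roots nzG allG urs) szG.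
  by rewrite szrs ltnS leq_exp2l ?prime_gt1 // leqNgt prednK // leqnn.
pose v : 'cV[K]_s := \sum_(n < N) c ^+ (p ^ (N.-1 - n)) *: map_mx iota (w n).
exists v.
  apply: contraNneq Gc => v0; apply/eqP; transitivity (v i0 0); last by rewrite v0 mxE.
  rewrite horner_sum summxE; apply: eq_bigr => n _.
  by rewrite !mxE !hornerE mulrC.
move=> i; rewrite mulmx_sumr !summxE -(pFrobenius_autE pK) rmorph_sum /=.
rewrite (eq_bigr (fun n : 'I_N => c ^+ (p ^ (N.-1 - n).+1) * iota (w n i 0))); last first.
  move=> n _; rewrite !mxE rmorphM /= !pFrobenius_autE -exprM -expnSr.
  by rewrite -rmorphXn fixk.
rewrite [RHS](eq_bigr (fun n : 'I_N => c ^+ (p ^ (N.-1 - n)) * iota (w n.+1 i 0))); last first.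
  by move=> n _; rewrite -scalemxAr mxE -map_mxM Hw [in LHS]mxE.
move: crs; rewrite memrs => /eqP cN.
case: N N0 wN cN {per rs urs szrs memrs G GN0 szG Gc v} => // N _ wN cN.
rewrite big_ord_recl big_ord_recr /= subn0 cN wN addrC subnn expr1; congr (_ + _).
by apply: eq_bigr => n _; rewrite /bump /= add1n subnSK.
Qed.

Lemma big_nat_multiples (V : nmodType) (G : nat -> V) (Q B : nat) :
  (0 < Q)%N -> (forall i, ~~ (Q %| i)%N -> G i = 0) ->
  \sum_(0 <= i < B * Q) G i = \sum_(0 <= k < B) G (k * Q)%N.
Proof.
move=> Q0 G0; elim: B => [|B IH]; first by rewrite mul0n !big_geq.
rewrite [RHS]big_nat_recr //= -IH mulSn addnC (big_cat_nat (n := B * Q)) //= ?leq_addr //.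
have lt : (B * Q < B * Q + Q)%N by rewrite -{1}[(B * Q)%N]addn0 ltn_add2l.
congr (_ + _); rewrite (big_ltn lt) big_nat_cond big1 ?addr0 //.
move=> i; rewrite andbT => /andP[li ui]; apply: G0; apply/negP => /dvdnP[k ik].
move: li ui; rewrite ik ltn_mul2r Q0 /= -mulSnr ltn_mul2r Q0 /= => lk.
by rewrite ltnS leqNgt lk.
Qed.

(** * Power sums and the Hasse-Witt matrix *)

Section PowerSums.
Variables (K : closedFieldType) (p n : nat) (rs : seq K).
Hypotheses (pK : p \in [pchar K]) (n0 : (0 < n)%N).
Hypotheses (urs : uniq rs) (szrs : size rs = (p ^ n)%N).
Hypothesis memrs : forall c, (c \in rs) = (c ^+ (p ^ n) == c).

Let p_pr : prime p := pcharf_prime pK.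
Let pn1 : (1 < p ^ n)%N.
Proof. by rewrite -(exp1n n) ltn_exp2r ?prime_gt1. Qed.

Let unit_rs c : c \in rs -> c != 0 -> c ^+ (p ^ n - 1) = 1.
Proof.
rewrite memrs => /eqP cq c0; apply: (mulfI c0).
by rewrite -exprS subn1 prednK ?cq ?mulr1 // ltnW.
Qed.

(** Unless [p^n - 1] divides [k], multiplication by some [g] with [g^k != 1] permutes the nonzero
    elements and forces the sum to be 0. The case [k = 0] is apart: there [0^0 = 1] completes the
    sum to [p^n = 0]. *)
Lemma frobenius_power_sum (k : nat) :
  \sum_(c <- rs) c ^+ k = - ((0 < k)%N && (p ^ n - 1 %| k)%N)%:R.
Proof.
have z_rs : 0 \in rs by rewrite memrs expr0n -leqn0 leqNgt ltnW.
case: posnP => [->|k0] /=.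
  rewrite (eq_bigr (fun=> 1)) // big_const_seq count_predT iter_addr_0 szrs.
  by rewrite natrX (pcharf0 pK) expr0n oppr0; case: n n0.
rewrite (perm_big _ (perm_to_rem z_rs)) big_cons /= expr0n gtn_eqF // add0r.
have szrem : size (rem 0 rs) = (p ^ n - 1)%N by rewrite size_rem // szrs subn1.
have mem_rem c : (c \in rem 0 rs) = (c != 0) && (c \in rs) by rewrite mem_rem_uniq // inE.
have q0 : (0 < p ^ n - 1)%N by rewrite subn_gt0.
have [/dvdnP[e ->]|ndv] := boolP (_ %| k)%N.
  rewrite (eq_big_seq (fun=> 1)) => [|c].
    rewrite big_const_seq count_predT iter_addr_0 szrem natrB ?natrX ?(pcharf0 pK) ?expr0n.
      by rewrite gtn_eqF // sub0r.
    exact: ltnW.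
  by rewrite mem_rem => /andP[c0 /unit_rs cq]; rewrite mulnC exprM cq ?expr1n.
(* Otherwise [X^r - 1], with [r] the remainder of [k], would have [p^n - 1 > r] roots. *)
have [g] : exists2 g, g \in rem 0 rs & g ^+ k != 1.
  apply/hasP; rewrite -[has _ _]negbK; apply/negP => /hasPn h.
  pose r := (k %% (p ^ n - 1))%N.
  have r0 : (0 < r)%N by rewrite lt0n.
  pose P : {poly K} := 'X^r - 1.
  have szP : size P = r.+1.
    by rewrite size_polyDl size_polyXn // size_polyN size_poly1.
  have P0 : P != 0 by rewrite -size_poly_eq0 szP.
  have allP : all (root P) (rem 0 rs).
    apply/allP => c cin; rewrite rootE !hornerE subr_eq0.
    move: (cin) (h c cin); rewrite mem_rem negbK => /andP[c0 /unit_rs cq].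
    by rewrite {1}(divn_eq k (p ^ n - 1)) exprD mulnC exprM cq // expr1n mul1r.
  have := max_poly_roots P0 allP (rem_uniq 0 urs).
  by rewrite szrem szP ltnS leqNgt ltn_mod q0.
rewrite mem_rem => /andP[gn0 grs] gk.
have pg : perm_eq [seq g * c | c <- rem 0 rs] (rem 0 rs).
  have um : uniq [seq g * c | c <- rem 0 rs].
    by rewrite map_inj_uniq ?rem_uniq //; apply: mulfI.
  apply: uniq_perm => //; first exact: rem_uniq.
  apply: (uniq_min_size um _ _).2; last by rewrite size_map.
  move=> ? /mapP[c]; rewrite !mem_rem => /andP[c0 cr] ->.
  by rewrite mulf_neq0 //= memrs exprMn; move: grs cr; rewrite !memrs => /eqP-> /eqP->.
rewrite oppr0; apply/eqP; rewrite -(inj_eq (mulfI (_ : g ^+ k - 1 != 0))) ?subr_eq0 // mulr0.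
rewrite mulrBl mul1r subr_eq0 -{2}(perm_big _ pg) big_map mulr_sumr; apply/eqP.
by apply: eq_bigr => c _; rewrite exprMn.
Qed.

Lemma frobenius_poly_sum (P : {poly K}) (B : nat) :
  (size P <= B.+1 * (p ^ n - 1))%N ->
  \sum_(c <- rs) P.[c] = - \sum_(k < B) P`_(k.+1 * (p ^ n - 1)).
Proof.
move=> szP; under eq_bigr => c _ do rewrite (horner_coef_wide c szP).
rewrite exchange_big /=.
under eq_bigr => i _ do rewrite -mulr_sumr frobenius_power_sum.
rewrite -(big_mkord xpredT (fun i => P`_i * - ((0 < i)%N && (p ^ n - 1 %| i)%N)%:R)).
rewrite big_nat_multiples ?subn_gt0 // => [|i /negPf->]; last by rewrite andbF oppr0 mulr0.
rewrite big_mkord big_ord_recl /= mul0n oppr0 mulr0 add0r -sumrN.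
apply: eq_bigr => i _; rewrite /bump /= add1n muln_gt0 subn_gt0 pn1 /= dvdn_mull //.
by rewrite mulrN mulr1.
Qed.

End PowerSums.

Section CartierMatrix.
Variables (R : comNzRingType) (p s : nat) (F : {poly R}).
Hypotheses (sp : (s < p)%N) (szF : (size F <= s.+1 * (p - 1))%N).

(** Column [i] holds the coefficients of [x^i F] at the exponents [k p + p - 1], which are those
    that survive [D^(p-1)]. Rows and columns count from 0, whence the successors. *)
Definition hasse_witt : 'M[R]_s := \matrix_(k, i) F`_(k.+1 * p - i.+1).

(** When [F] has coefficients in F_p, the value at [x] in F_(p^n) is the norm of [F.[x]] to F_p. *)
Definition frobenius_norm (n : nat) : {poly R} := \prod_(i < n) (F \Po 'X^(p ^ i)).

Let p0 : (0 < p)%N. Proof. by case: p sp. Qed.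

Lemma coef_comp_Xn_mul (G : {poly R}) (N M : nat) :
  (N < M * p)%N -> (forall u, (u < M)%N -> (u * p <= N)%N) ->
  ((G \Po 'X^p) * F)`_N = \sum_(0 <= u < M) G`_u * F`_(N - u * p).
Proof.
move=> NM uN; pose T t := (G \Po 'X^p)`_t * F`_(N - t) *+ (t <= N)%N.
rewrite coefM -(big_mkord xpredT (fun t => (G \Po 'X^p)`_t * F`_(N - t))).
transitivity (\sum_(0 <= t < M * p) T t).
  rewrite [RHS](big_cat_nat (n := N.+1)) //= [X in _ + X]big_nat_cond [X in _ + X]big1 ?addr0.
    by apply: eq_big_nat => t; rewrite /T ltnS => /andP[_ ->].
  by move=> t /andP[/andP[Nt _] _]; rewrite /T leqNgt Nt.
rewrite big_nat_multiples //; last first.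
  by move=> t nt; rewrite /T coef_comp_poly_Xn // (negPf nt) mul0r mul0rn.
apply: eq_big_nat => u /andP[_ uM]; rewrite /T uN // mulr1n coef_comp_poly_Xn //.
by rewrite dvdn_mull // mulnK.
Qed.

Lemma frobenius_normS n : frobenius_norm n.+1 = (frobenius_norm n \Po 'X^p) * F.
Proof.
rewrite /frobenius_norm big_ord_recl /= expn0 expr1 comp_polyXr mulrC; congr (_ * _).
rewrite rmorph_prod /=; apply: eq_bigr => i _; rewrite -comp_polyA comp_Xn_poly -exprM.
by rewrite /bump /= add1n expnS.
Qed.

(** By induction from [frobenius_normS]: a coefficient of a product with a polynomial in [X^p] is a
    sum over [u], and setting [u = M - r.+1] turns it into the sum over [r] of a matrix product. *)
Lemma hasse_witt_expr (n : nat) (k i : 'I_s) :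
  (hasse_witt ^+ n.+1) k i = (frobenius_norm n.+1)`_(k.+1 * p ^ n.+1 - i.+1).
Proof.
elim: n k i => [|n IH] k i.
  by rewrite expr1 mxE expn1 frobenius_normS /frobenius_norm big_ord0 rmorph1 mul1r.
rewrite exprSr mxE frobenius_normS.
set M := (k.+1 * p ^ n.+1)%N.
have sM : (s < M)%N.
  apply: leq_trans sp _; rewrite /M expnS mulnCA leq_pmulr //.
  by rewrite muln_gt0 expn_gt0 p0.
have ME : (k.+1 * p ^ n.+2 = M * p)%N by rewrite /M expnSr mulnA.
have M0 : (0 < M)%N by apply: leq_trans sM.
have is_ := ltn_ord i.
have idx r : (r < M)%N -> (M * p - i.+1 - (M - r.+1) * p = r.+1 * p - i.+1)%N.
  move=> rM; rewrite mulnBl; have : (r.+1 * p <= M * p)%N by rewrite leq_mul2r rM orbT.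
  have : (p <= r.+1 * p)%N by rewrite leq_pmull.
  lia.
rewrite (@coef_comp_Xn_mul _ _ M); last 2 first.
- by rewrite ME -subn_gt0 subKn // (leq_trans _ (leq_pmull p M0)) // ltnW // (leq_ltn_trans is_).
- move=> u uM; rewrite ME; apply: leq_trans (_ : M.-1 * p <= _)%N.
    by rewrite leq_mul2r -ltnS prednK // uM orbT.
  rewrite -subn1 mulnBl mul1n leq_sub2l //; lia.
rewrite big_nat_rev /= add0n (big_cat_nat (n := s)) //= ?(ltnW sM) //.
(* For [r >= s] the index lies beyond the degree of [F]; the bound on [size F] is made for this. *)
rewrite [X in _ = _ + X]big_nat_cond [X in _ = _ + X]big1 ?addr0; last first.
  move=> r /andP[/andP[sr rM] _]; rewrite [nth 0 F _]nth_default ?mulr0 //.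
  apply: leq_trans szF _; rewrite ME idx // mulnBr muln1.
  have : (s.+1 * p <= r.+1 * p)%N by rewrite leq_mul2r ltnS sr orbT.
  lia.
rewrite big_mkord; apply: eq_bigr => r _; rewrite IH mxE ME; congr (_ * nth 0 F _).
by rewrite idx // (leq_trans _ (ltnW sM)).
Qed.

(** The bound telescopes: [(s+1)(q-1)p + (s+1)(p-1) = (s+1)(pq-1)]. *)
Lemma size_frobenius_norm (n : nat) :
  (size (frobenius_norm n.+1) <= s.+1 * (p ^ n.+1 - 1))%N.
Proof.
have pn0 i : (0 < p ^ i)%N by rewrite expn_gt0 p0.
elim: n => [|n IH].
  by rewrite frobenius_normS /frobenius_norm big_ord0 rmorph1 mul1r expn1.
rewrite frobenius_normS; apply: leq_trans (size_polyMleq _ _) _.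
have := size_comp_poly_leq (frobenius_norm n.+1) ('X^p : {poly R}).
rewrite size_polyXn /=.
set a := size (_ \Po _); set b := size (frobenius_norm _) in IH *.
have := szF; set c := size F => szF'.
move=> ab; rewrite expnS; set q := (p ^ n.+1)%N in IH *; have q0 : (0 < q)%N by exact: pn0.
have : (b.-1 * p <= s.+1 * (q - 1) * p)%N by rewrite leq_mul2r (leq_trans (leq_pred _) IH) orbT.
have : (s.+1 * (q - 1) * p + s.+1 * (p - 1) = s.+1 * (p * q - 1))%N.
  rewrite -mulnA -mulnDr; congr (_ * _)%N; rewrite mulnBl mul1n mulnC.
  have : (p <= p * q)%N by rewrite leq_pmulr.
  by move: p0; lia.
lia.
Qed.

(** On the diagonal the exponents are the multiples of [p^n - 1], exactly those kept by
    [frobenius_poly_sum]. *)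
Lemma hasse_witt_trace (n : nat) :
  \tr (hasse_witt ^+ n.+1) = \sum_(k < s) (frobenius_norm n.+1)`_(k.+1 * (p ^ n.+1 - 1)).
Proof.
by apply: eq_bigr => k _; rewrite hasse_witt_expr mulnBr muln1.
Qed.

End CartierMatrix.

(** * Frobenius orbits and Newton's identities *)

Section FrobeniusOrbits.
Variables (p : nat) (K : closedFieldType) (phi : {rmorphism 'F_p -> K}).
Hypotheses (p_pr : prime p) (pK : p \in [pchar K]).

Definition frob_roots (n : nat) : seq K :=
  sval (closed_field_poly_normal ('X^(p ^ n) - 'X : {poly K})).

Lemma frob_rootsP (n : nat) : (0 < n)%N ->
  [/\ uniq (frob_roots n), size (frob_roots n) = (p ^ n)%N &
      forall c, (c \in frob_roots n) = (c ^+ (p ^ n) == c)].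
Proof.
move=> n0; rewrite /frob_roots; case: closed_field_poly_normal => rs' /= E'.
have [rs [urs szrs memrs E]] := frobenius_roots pK n0.
rewrite E (monicP (monic_prod_XsubC _ _ _)) scale1r in E'.
have pe : perm_eq rs rs' by apply: (canLR_in _ _ _ _) || by apply/prod_XsubC_eq.
by rewrite -(perm_uniq pe) -(perm_size pe); split=> // c; rewrite -(perm_mem pe).
Qed.

(** For [x] in F_(p^n), the characteristic polynomial of [x] over F_p as an element of F_(p^n): the
    orbit is repeated when [x] lies in a smaller field. *)
Definition orbit_poly (x : K) (n : nat) : {poly K} := \prod_(i < n) ('X - (x ^+ (p ^ i))%:P).

Lemma Fp_expr (c : 'F_p) : c ^+ p = c.
Proof. by rewrite -[RHS]expf_card card_Fp. Qed.

Lemma frobenius_fixed_in_Fp (c : K) : c ^+ p = c -> exists b : 'F_p, c = phi b.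
Proof.
move=> cp; have [urs szrs memrs] := frob_rootsP (ltn0Sn 0).
have sub : {subset [seq phi b | b : 'F_p] <= frob_roots 1}.
  by move=> ? /mapP[b _ ->]; rewrite memrs -rmorphXn expn1 Fp_expr.
have um : uniq [seq phi b | b : 'F_p] by rewrite map_inj_uniq ?enum_uniq //; apply: fmorph_inj.
have [|e] := uniq_min_size um sub.
  by rewrite szrs size_map -cardE card_Fp.
by move=> /(_ c); rewrite memrs expn1 cp eqxx => /mapP[b _ ->]; exists b.
Qed.

Lemma frobenius_fixed_poly (P : {poly K}) :
  (forall i, P`_i ^+ p = P`_i) -> exists Q : {poly 'F_p}, P = map_poly phi Q.
Proof.
move=> fixP; have [b hb] := choice (fun i => frobenius_fixed_in_Fp (fixP i)).
exists (\poly_(i < size P) b i); apply/polyP => i; rewrite coef_map coef_poly.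
by case: ltnP => [_|ge]; [exact: hb | rewrite nth_default //= rmorph0].
Qed.

Lemma horner_frobenius (Q : {poly 'F_p}) (x : K) :
  (map_poly phi Q).[x] ^+ p = (map_poly phi Q).[x ^+ p].
Proof.
rewrite -!(pFrobenius_autE pK) -horner_map -map_poly_comp; congr (_.[_]).
by apply: eq_map_poly => c; rewrite /= pFrobenius_autE -rmorphXn Fp_expr.
Qed.

Lemma horner_frobeniusX (Q : {poly 'F_p}) (x : K) (n : nat) :
  (map_poly phi Q).[x] ^+ (p ^ n) = (map_poly phi Q).[x ^+ (p ^ n)].
Proof.
by elim: n => [|n IH]; rewrite ?expr1 // expnSr !exprM IH horner_frobenius.
Qed.

Lemma orbit_poly_monic x n : orbit_poly x n \is monic.
Proof. exact: monic_prod_XsubC. Qed.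

Lemma size_orbit_poly x n : size (orbit_poly x n) = n.+1.
Proof. by rewrite /orbit_poly size_prod_XsubC /index_enum -enumT size_enum_ord. Qed.

(** Frobenius permutes the factors cyclically, hence fixes the coefficients. *)
Lemma orbit_poly_Fp (x : K) (n : nat) :
  x ^+ (p ^ n) = x -> exists2 Q : {poly 'F_p}, Q \is monic & orbit_poly x n = map_poly phi Q.
Proof.
move=> xn; case: n xn => [|n] xn.
  by exists 1; rewrite ?monic1 // /orbit_poly big_ord0 rmorph1.
have fixed : map_poly (pFrobenius_aut pK) (orbit_poly x n.+1) = orbit_poly x n.+1.
  rewrite /orbit_poly rmorph_prod /= big_ord_recr big_ord_recl mulrC /=; congr (_ * _).
    apply: eq_bigr => i _.
    by rewrite map_polyXsubC /= pFrobenius_autE -exprM -expnSr.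
  by rewrite map_polyXsubC /= pFrobenius_autE -exprM -expnSr xn expn0 expr1.
have [i|Q E] := @frobenius_fixed_poly (orbit_poly x n.+1).
  by rewrite -(pFrobenius_autE pK) -coef_map fixed.
by exists Q => //; rewrite -(map_monic phi) -E orbit_poly_monic.
Qed.

Lemma orbit_poly_mul (x : K) (e k : nat) :
  x ^+ (p ^ e) = x -> orbit_poly x (k * e) = orbit_poly x e ^+ k.
Proof.
move=> xe; elim: k => [|k IH]; first by rewrite /orbit_poly big_ord0.
rewrite mulSn exprS -IH /orbit_poly big_split_ord /=; congr (_ * _).
by apply: eq_bigr => i _; rewrite expnD exprM xe.
Qed.

Lemma frobenius_inj (n : nat) : injective (fun c : K => c ^+ (p ^ n)).
Proof.
elim: n => [|n IH] a b; first by rewrite !expr1.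
rewrite expnSr !exprM -!(pFrobenius_autE pK) => /fmorph_inj; exact: IH.
Qed.

Section Multiplicity.
Variables (x : K) (e : nat).
Hypotheses (e0 : (0 < e)%N) (xe : x ^+ (p ^ e) = x).
Hypothesis emin : forall n, (0 < n)%N -> x ^+ (p ^ n) = x -> (e <= n)%N.

Lemma frobenius_period (n : nat) : (x ^+ (p ^ n) == x) = (e %| n)%N.
Proof.
have xk k : x ^+ (p ^ (k * e)) = x.
  by elim: k => [|k IH]; rewrite ?mul0n ?expr1 // mulSn expnD exprM xe.
apply/eqP/idP => [xn|/dvdnP[k ->] //].
have xm : x ^+ (p ^ (n %% e)) = x.
  by move: xn; rewrite {1}(divn_eq n e) expnD exprM xk.
rewrite /dvdn; case: posnP => // /emin/(_ xm).
by rewrite leqNgt ltn_pmod.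
Qed.

Let orbit := mkseq (fun i => x ^+ (p ^ i)) e.

Let orbit_uniq : uniq orbit.
Proof.
apply/mkseq_uniqP => i j; rewrite !inE.
wlog lij : i j / (i <= j)%N => [hw|] ie je E.
  by case: (leqP i j) => [|/ltnW] l; [apply: hw|apply/esym/hw].
apply/eqP; rewrite eqn_leq lij /= leqNgt -subn_gt0; apply/negP => ji0.
suff /(emin ji0) : x ^+ (p ^ (j - i)) = x by move: je; clear; lia.
move/(congr1 (fun c => c ^+ (p ^ (e - i)))): E; rewrite -!exprM -!expnD subnKC ?(ltnW ie) // xe.
by rewrite (_ : (j + (e - i))%N = (e + (j - i))%N) ?expnD ?exprM ?xe //; move: lij ie; clear; lia.
Qed.

Let orbitE : orbit_poly x e = \prod_(c <- orbit) ('X - c%:P).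
Proof. rewrite big_map /orbit_poly -(big_mkord xpredT (fun i => 'X - (x ^+ (p ^ i))%:P)).
by rewrite /index_iota subn0.
Qed.

(** As [e] is minimal, [orbit_poly x e] is the minimal polynomial of [x] over F_p and has simple
    roots, so it splits off from [q] as often as [x] is a root. *)
Lemma orbit_polyX_dvdp (k : nat) (q : {poly 'F_p}) :
  q != 0 -> (orbit_poly x e ^+ k %| map_poly phi q) = (k <= mup x (map_poly phi q))%N.
Proof.
move=> q0; have xo : x \in orbit by apply/mapP; exists 0%N; rewrite ?mem_iota ?expr1.
have mupo : mup x (orbit_poly x e) = 1%N.
  by rewrite orbitE mu_prod_XsubC count_uniq_mem // xo.
apply/idP/idP => [dv|].
  rewrite mup_geq ?map_poly_eq0 //; apply: dvdp_trans dv.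
  by apply: dvdp_exp2r; rewrite XsubC_dvd ?mupo ?monic_neq0 ?orbit_poly_monic.
elim: k q q0 => [|k IH] q q0 kq; first by rewrite expr0 dvd1p.
have rx : root (map_poly phi q) x.
  by rewrite -dvdp_XsubCl XsubC_dvd ?map_poly_eq0 // (leq_trans _ kq).
have Mq : orbit_poly x e %| map_poly phi q.
  rewrite orbitE; apply: uniq_roots_dvdp; last by rewrite uniq_rootsE.
  apply/allP => ? /mapP[i _ ->]; rewrite /root -horner_frobeniusX.
  by rewrite (rootP rx) expr0n -leqn0 leqNgt expn_gt0 prime_gt0.
have [M Mm ME] := orbit_poly_Fp xe.
move: Mq kq; rewrite ME dvdp_map => /dvdpP[q' qE].
have q'0 : q' != 0 by apply: contraNneq q0 => q'0; rewrite qE q'0 mul0r.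
rewrite qE rmorphM /= mupM ?map_poly_eq0 ?(monic_neq0 Mm) // -ME mupo addn1 ltnS => /IH.
by rewrite exprSr => h; apply: dvdp_mul => //; apply: h.
Qed.

End Multiplicity.

(** Only the multiples [n = k e] of the period [e] of [x] count, and [orbit_poly x (k e)] is the
    [k]-th power of the minimal polynomial; so the contributions come from [k] between 1 and the
    multiplicity. *)
Lemma orbit_poly_count (x : K) (q : {poly 'F_p}) (l : nat) :
  q \is monic -> size q = l.+1 ->
  (\sum_(0 <= n < l.+1) [&& 0 < n, x ^+ (p ^ n) == x & (orbit_poly x n %| map_poly phi q)%R])%N
  = mup x (map_poly phi q).
Proof.
move=> mq szq; have q0 := monic_neq0 mq; have qm0 : map_poly phi q != 0 by rewrite map_poly_eq0.
have [rx|nrx] := boolP (root (map_poly phi q) x); last first.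
  rewrite mupNroot // big1 // => -[|n] _ //=.
  suff /negPf-> : ~~ (orbit_poly x n.+1 %| map_poly phi q) by rewrite andbF.
  apply: contraNN nrx; rewrite -dvdp_XsubCl; apply: dvdp_trans.
  by rewrite /orbit_poly big_ord_recl expr1 dvdp_mulIl.
have [e [e0 xe emin]] : exists e, [/\ (0 < e)%N, x ^+ (p ^ e) = x &
    forall n, (0 < n)%N -> x ^+ (p ^ n) = x -> (e <= n)%N].
  suff ex : exists e, (0 < e)%N && (x ^+ (p ^ e) == x).
    exists (ex_minn ex); case: ex_minnP => e /andP[e0 /eqP xe] emin.
    by split=> // n n0 xn; apply: emin; rewrite n0 xn eqxx.
  (* The first [l.+1] conjugates are roots of [q], of degree [l], so two of them coincide; as
     Frobenius is injective, [x] itself recurs. *)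
  have : ~~ uniq (mkseq (fun i => x ^+ (p ^ i)) l.+1).
    apply/negP => un; have := max_poly_roots qm0 _ un.
    rewrite size_mkseq size_map_poly szq ltnn => h.
    suff /h : all (root (map_poly phi q)) (mkseq (fun i => x ^+ (p ^ i)) l.+1) by [].
    apply/allP => ? /mapP[i _ ->]; rewrite /root -horner_frobeniusX.
    by rewrite (rootP rx) expr0n -leqn0 leqNgt expn_gt0 prime_gt0.
  case/(uniqPn 0) => i [j []]; rewrite size_mkseq => ij jl.
  rewrite !nth_mkseq ?(ltn_trans ij) // => E.
  exists (j - i)%N; rewrite subn_gt0 ij /=; apply/eqP/(frobenius_inj (n := i)).
  by rewrite -exprM -expnD subnK ?(ltnW ij).
pose G n : nat := [&& 0 < n, x ^+ (p ^ n) == x & (orbit_poly x n %| map_poly phi q)%R]%N.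
have Gbig n : (l < n)%N -> G n = 0%N.
  move=> ln; rewrite /G (_ : (_ %| _) = false) ?andbF //; apply/negP => /dvdp_leq.
  by move=> /(_ qm0); rewrite size_orbit_poly size_map_poly szq ltnS leqNgt ln.
(* Degrees rule out divisibility beyond [l], so the range may be lengthened to a multiple of [e]. *)
transitivity (\sum_(0 <= n < l.+1 * e) G n)%N.
  rewrite [RHS](big_cat_nat (n := l.+1)) //= ?leq_pmulr //.
  by rewrite [X in (_ + X)%N]big_nat_cond [X in (_ + X)%N]big1 ?addn0 // => n /andP[/andP[/Gbig]].
have -> : (\sum_(0 <= n < l.+1 * e) G n = \sum_(0 <= k < l.+1) G (k * e))%N.
  apply: (@big_nat_multiples nat) => // n.
  by rewrite -(frobenius_period e0 xe emin) => /negPf nx; rewrite /G nx andbF.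
have mupl : (mup x (map_poly phi q) <= l)%N.
  rewrite -ltnS -szq -(size_map_poly phi) -(size_exp_XsubC _ x); apply: dvdp_leq => //.
  by rewrite -mup_geq.
rewrite (eq_bigr (fun k => (0 < k <= mup x (map_poly phi q))%N : nat)) => [|k _].
  rewrite (big_cat_nat (n := (mup x (map_poly phi q)).+1)) //=.
  rewrite [X in (_ + X)%N]big_nat_cond [X in (_ + X)%N]big1 ?addn0 => [|k]; last first.
    by rewrite andbT => /andP[lk _]; rewrite [(k <= _)%N]leqNgt lk andbF.
  rewrite big_ltn // add0n big_add1 /= (eq_big_nat _ _ (F2 := fun=> 1%N)) => [|k /andP[_ kl]].
    by rewrite sum_nat_const_nat muln1 subn0.
  by rewrite kl.
rewrite /G orbit_poly_mul // (frobenius_period e0 xe emin) dvdn_mull // muln_gt0 e0 andbT /=.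
by rewrite (orbit_polyX_dvdp e0 xe emin).
Qed.

(** Summing [orbit_poly_count] over [x] counts the roots of [q] with multiplicity. *)
Lemma orbit_poly_total (q : {poly 'F_p}) (l : nat) :
  q \is monic -> size q = l.+1 ->
  (\sum_(0 <= n < l.+1 | (0 < n)%N) \sum_(x <- frob_roots n) (orbit_poly x n %| map_poly phi q)%R)%N
  = l.
Proof.
move=> mq szq; have [R qR] := closed_field_poly_normal (map_poly phi q).
rewrite lead_coef_map (monicP mq) rmorph1 scale1r in qR.
have szR : size R = l.
  by move: szq; rewrite -(size_map_poly phi) qR size_prod_XsubC => -[].
rewrite -[RHS]szR -sum1_size -(big_undup_iterop_count _ R) /=.
rewrite (eq_bigr (fun x => mup x (map_poly phi q))) => [|x _]; last first.
  by rewrite qR mu_prod_XsubC; rewrite Monoid.iteropE iter_addn mul1n addn0.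
under [RHS]eq_bigr => x _ do rewrite -(orbit_poly_count x mq szq).
rewrite exchange_big /= big_mkcond; apply: eq_big_nat => n _.
case: posnP => [->|n0]; first by rewrite big1.
have [urs _ memrs] := frob_rootsP n0.
rewrite [LHS](bigID (mem (undup R))) /= [X in (_ + X)%N]big1_seq ?addn0 => [|x]; last first.
  rewrite mem_undup => /andP[xR _]; apply/eqP; rewrite eqb0.
  apply: contraNN xR => dv; rewrite -root_prod_XsubC -qR -dvdp_XsubCl.
  by apply: dvdp_trans dv; case: n n0 {urs memrs} => // n _; rewrite /orbit_poly big_ord_recl expr1 dvdp_mulIl.
rewrite [RHS](bigID (mem (frob_roots n))) /= [X in _ = (_ + X)%N]big1_seq ?addn0 => [|x]; last first.
  by rewrite memrs => /andP[/negPf-> _].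
rewrite -big_filter -[RHS]big_filter.
apply: etrans (_ : _ = \sum_(x <- [seq x <- undup R | x \in frob_roots n])
  (orbit_poly x n %| map_poly phi q)%R)%N _.
  apply: perm_big; apply: uniq_perm; rewrite ?filter_uniq ?undup_uniq // => x.
  by rewrite !mem_filter andbC.
rewrite [LHS]big_seq [RHS]big_seq; apply: eq_bigr => x.
by rewrite mem_filter memrs => /andP[-> _].
Qed.

Definition monic_sum (V : nmodType) (l : nat) (g : {poly 'F_p} -> V) : V :=
  \sum_(q : {poly_l.+1 'F_p} | (size q == l.+1) && ((q : {poly 'F_p}) \is monic)) g q.

Lemma monic_sum_dvd (V : nmodType) (l n : nat) (g : {poly 'F_p} -> V) (Q : {poly 'F_p}) :
  Q \is monic -> size Q = n.+1 -> (n <= l)%N ->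
  monic_sum l (fun q => if Q %| q then g q else 0) = monic_sum (l - n) (fun r => g (Q * r)).
Proof.
move=> mQ szQ nl; rewrite /monic_sum -big_mkcondr /=.
rewrite (reindex_onto (fun r : {poly_(l - n).+1 'F_p} => npolyp l.+1 (Q * r))
           (fun q : {poly_l.+1 'F_p} => npolyp (l - n).+1 (q %/ Q))) /=; last first.
  move=> q /andP[/andP[/eqP szq _] Qq]; apply/val_inj.
  have szd : (size (val q %/ Q)%R <= (l - n).+1)%N.
    by rewrite size_divp ?monic_neq0 // [size _]szq szQ /= subSn.
  have QK : Q * (val q %/ Q) = val q by rewrite mulrC divpK.
  by rewrite /= (npolypK szd) QK npolypK // szq.
have szQr (r : {poly_(l - n).+1 'F_p}) : (size (Q * r)%R <= l.+1)%N.
  apply: leq_trans (size_polyMleq _ _) _; rewrite szQ addSn /=.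
  by apply: leq_trans (leq_add (leqnn n) (size_npoly r)) _; rewrite addnS subnKC.
apply: eq_big => [r|r _]; last by rewrite npolypK.
rewrite npolypK // dvdp_mulIl andbT monicMl // mulKp ?monic_neq0 //.
rewrite (_ : npolyp _ _ == r) ?andbT; last by apply/eqP/val_inj; rewrite /= npolypK.
case: (boolP (_ \is monic)); rewrite ?andbF ?andbT // => mr.
rewrite size_Mmonic ?monic_neq0 // szQ addSn /=; move: (size r) => k.
by apply/eqP/eqP; move: nl; clear; lia.
Qed.

(* The pairs (n, x) with 0 < n, x in F_(p^n) and orbit_poly x n dividing q number deg q,
   with q monic over F_p (orbit_poly_total). *)
Lemma monic_sum_newton (chi : {poly 'F_p} -> K) (F : {poly K}) (l : nat) :
  (forall Q r : {poly 'F_p}, Q \is monic -> r \is monic -> chi (Q * r) = chi Q * chi r) ->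
  (forall x n Q, Q \is monic -> map_poly phi Q = orbit_poly x n ->
    chi Q = \prod_(i < n) F.[x ^+ (p ^ i)]) ->
  l%:R * monic_sum l chi =
  \sum_(0 <= n < l.+1 | (0 < n)%N)
    (\sum_(x <- frob_roots n) \prod_(i < n) F.[x ^+ (p ^ i)]) * monic_sum (l - n) chi.
Proof.
move=> chiM chiO.
transitivity (monic_sum l (fun q => \sum_(0 <= n < l.+1 | (0 < n)%N)
   \sum_(x <- frob_roots n) if orbit_poly x n %| map_poly phi q then chi q else 0)).
  rewrite /monic_sum mulr_sumr; apply: eq_bigr => q /andP[/eqP szq mq].
  rewrite -{1}(orbit_poly_total mq szq) natr_sum mulr_suml; apply: eq_bigr => n _.
  rewrite natr_sum mulr_suml; apply: eq_bigr => x _.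
  by case: ifP; rewrite ?mul1r ?mul0r.
rewrite /monic_sum exchange_big /= big_nat_cond [RHS]big_nat_cond.
apply: eq_bigr => n /andP[/andP[_ nl] n0].
rewrite exchange_big mulr_suml /= big_seq [RHS]big_seq; apply: eq_bigr => x.
have [_ _ memrs] := frob_rootsP n0; rewrite memrs => /eqP xn.
have [Q mQ QE] := orbit_poly_Fp xn; rewrite QE.
under eq_bigr => q _ do rewrite dvdp_map.
have szQ : size Q = n.+1 by rewrite -(size_map_poly phi) -QE size_orbit_poly.
rewrite -/(monic_sum l (fun q => if Q %| q then chi q else 0)) (monic_sum_dvd _ mQ szQ) //.
rewrite -(chiO x n Q mQ (esym QE)) /monic_sum mulr_sumr.
by apply: eq_bigr => r /andP[_ mr]; rewrite chiM.
Qed.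

End FrobeniusOrbits.

(** Once [n] exceeds the size of [A], Cayley-Hamilton expresses [A^n] by smaller positive powers. *)
Lemma trace_expr_bounded (F : fieldType) (s : nat) (A : 'M[F]_s) :
  (forall n, (0 < n <= s)%N -> \tr (A ^+ n) = 0) -> forall n, (0 < n)%N -> \tr (A ^+ n) = 0.
Proof.
case: s A => [|s] A trA n n0; first by rewrite [A ^+ n]flatmx0 mxtrace0.
elim/ltn_ind: n n0 => n IH n0; case: (leqP n s.+1) => [ns|sn]; first by rewrite trA ?n0.
have /(congr1 (fun B => A ^+ (n - s.+1) * B)) := Cayley_Hamilton A.
rewrite /horner_mx /horner_morph mulr0 horner_coef size_map_poly size_char_poly big_ord_recr /=.
rewrite coef_map [_`_s.+1](_ : _ = 1) ?rmorph1 ?mul1r; last first.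
  by have /monicP := char_poly_monic A; rewrite lead_coefE size_char_poly.
rewrite mulrDr -exprD subnK ?(ltnW sn) // => /(congr1 mxtrace).
rewrite mxtraceD mxtrace0 mulr_sumr raddf_sum big1 ?add0r //= => i _.
rewrite coef_map /= [_%:M * _]mul_scalar_mx -scalerAr -exprD mxtraceZ IH ?mulr0 //.
  by move: (ltn_ord i) sn; clear; lia.
by rewrite addn_gt0 subn_gt0 sn.
Qed.

(** * Newton's identities against the traces of the Hasse-Witt matrix *)

Section TraceFormula.
Variables (p : nat) (K : closedFieldType) (phi : {rmorphism 'F_p -> K}).
Hypotheses (p_pr : prime p).
Variables (d s D : nat) (c : 'I_d -> 'F_p) (e : 'I_d -> nat).

(** For monic [q], [(-1)^(deg q) q.[c i]] is the product of the [b - c i] over the roots [b] of [q],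
    so this is the product of the [(X - c i)^(e i)] evaluated on the divisor of [q]. *)
Definition norm_char (q : {poly 'F_p}) : 'F_p :=
  \prod_(i < d) ((-1) ^+ (size q).-1 * q.[c i]) ^+ e i.

Let F : {poly 'F_p} := \prod_(i < d) ('X - (c i)%:P) ^+ e i.

Hypotheses (sD : (s <= D)%N) (Dp : (D < p)%N) (szF : (size F <= s.+1 * (p - 1))%N).

Let pK : p \in [pchar K].
Proof. by rewrite (fmorph_pchar phi) pchar_Fp. Qed.

Lemma norm_charM (Q r : {poly 'F_p}) :
  Q \is monic -> r \is monic -> norm_char (Q * r) = norm_char Q * norm_char r.
Proof.
move=> mQ mr; rewrite /norm_char -big_split /=; apply: eq_bigr => i _.
rewrite -exprMn hornerM size_Mmonic ?monic_neq0 //.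
case: (size Q) (monic_neq0 mQ) (size_poly_eq0 Q) => [/negPf->//|a] _ _.
case: (size r) (monic_neq0 mr) (size_poly_eq0 r) => [/negPf->//|b] _ _.
by rewrite addSn addnS /= exprD; congr (_ ^+ _); ring.
Qed.

Lemma norm_char_orbit (x : K) (n : nat) (Q : {poly 'F_p}) :
  map_poly phi Q = orbit_poly p x n ->
  phi (norm_char Q) = \prod_(i < n) (map_poly phi F).[x ^+ (p ^ i)].
Proof.
move=> QE; have szQ : size Q = n.+1 by rewrite -(size_map_poly phi) QE size_orbit_poly.
rewrite /norm_char szQ rmorph_prod /=.
under [RHS]eq_bigr => i _ do rewrite /F rmorph_prod horner_prod.
rewrite exchange_big /=; apply: eq_bigr => i _; rewrite rmorphXn /=.
under [RHS]eq_bigr => j _ do rewrite rmorphXn /= map_polyXsubC horner_exp.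
rewrite prodrXl; congr (_ ^+ _); rewrite rmorphM rmorphXn rmorphN1 -horner_map /= QE.
have -> : (-1) ^+ n = \prod_(j < n) (-1 : K) by rewrite prodr_const card_ord.
rewrite /orbit_poly horner_prod -big_split /=.
by apply: eq_bigr => j _; rewrite !hornerE mulN1r opprB.
Qed.

Lemma orbit_sum_trace (n : nat) : (0 < n)%N ->
  \sum_(x <- frob_roots p K n) \prod_(i < n) (map_poly phi F).[x ^+ (p ^ i)]
  = - phi (\tr (hasse_witt p s F ^+ n)).
Proof.
case: n => // n _; have [urs szrs memrs] := frob_rootsP pK (ltn0Sn n).
have sp : (s < p)%N := leq_ltn_trans sD Dp.
rewrite (hasse_witt_trace sp) // rmorph_sum /=.
under [X in - X]eq_bigr => k _ do rewrite -coef_map.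
rewrite -(frobenius_poly_sum pK _ urs szrs memrs) //; last first.
  by rewrite size_map_poly; apply: size_frobenius_norm.
apply: eq_bigr => x _; rewrite [in RHS]/frobenius_norm [in RHS]rmorph_prod /= [RHS]horner_prod.
by apply: eq_bigr => i _; rewrite map_comp_poly map_polyXn horner_comp hornerXn.
Qed.

Lemma monic_sum_phi (l : nat) (g : {poly 'F_p} -> 'F_p) :
  monic_sum l (phi \o g) = phi (monic_sum l g).
Proof. by rewrite /monic_sum rmorph_sum. Qed.

Lemma monic_sum0 : monic_sum 0 norm_char = 1.
Proof.
rewrite /monic_sum (big_pred1 (npolyp 1 1)) => [|q /=].
  rewrite npolypK ?size_poly1 // /norm_char big1 // => i _.
  by rewrite size_poly1 hornerC mulr1 !expr1n.
apply/idP/eqP => [/andP[/size_poly1P[b _ qb] mq]|->]; last first.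
  by rewrite npolypK ?size_poly1 ?monic1.
apply/val_inj; rewrite /= npolypK ?size_poly1 // qb.
by move: mq; rewrite qb monicE lead_coefC => /eqP->.
Qed.

(** Newton's identities can be divided by [l <= D < p], which gives one direction. Conversely, if
    the sums vanish up to [D >= s], the identity of index [n <= s] reduces to its last term, the
    trace of the [n]-th power. *)
Lemma hasse_witt_nilpotentP :
  (exists r, hasse_witt p s F ^+ r = 0) <->
  (forall l, (1 <= l <= D)%N -> monic_sum l norm_char = 0).
Proof.
have newton l := monic_sum_newton p_pr pK (F := map_poly phi F) (chi := phi \o norm_char) l.
have {}newton l : l%:R * phi (monic_sum l norm_char) = \sum_(0 <= n < l.+1 | (0 < n)%N)
    - phi (\tr (hasse_witt p s F ^+ n)) * phi (monic_sum (l - n) norm_char).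
  rewrite -monic_sum_phi (newton phi) => [|Q r mQ mr|x n Q mQ QE].
  - by apply: eq_bigr => n n0; rewrite orbit_sum_trace // -monic_sum_phi.
  - by rewrite /= norm_charM // rmorphM.
  - exact: norm_char_orbit.
split=> [[r Hr] l /andP[l0 lD]|S0].
  apply/eqP; rewrite -(fmorph_eq0 phi) -(inj_eq (mulfI (_ : l%:R != 0))) ?mulr0.
    rewrite newton big1 // => n n0; rewrite (trace_of_nilpotent Hr) //.
    by rewrite rmorph0 oppr0 mul0r.
  rewrite -(dvdn_pcharf pK); apply/negP => /(dvdn_leq l0).
  by rewrite leqNgt (leq_ltn_trans lD).
apply: (@nilpotent_of_trace _ p); rewrite ?pchar_Fp ?(leq_ltn_trans sD) //.
apply: trace_expr_bounded => n /andP[n0 ns].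
have := newton n; rewrite S0 ?n0 ?(leq_trans ns) // rmorph0 mulr0.
rewrite big_mkcond big_nat_recr //= n0 big_nat_cond big1 => [|i /andP[/andP[_ lin] _]].
  rewrite add0r subnn monic_sum0 rmorph1 mulr1 => /esym/eqP.
  by rewrite oppr_eq0 fmorph_eq0 => /eqP.
case: ifP => // i0; rewrite S0 ?rmorph0 ?mulr0 //; move: lin ns sD; clear; lia.
Qed.

End TraceFormula.

(** * Fixed polynomials and nilpotency *)

Section FixedPolynomial.
Variables (p : nat) (K : closedFieldType) (phi : {rmorphism 'F_p -> K}) (s : nat) (F : {poly 'F_p}).
Hypotheses (p_pr : prime p) (sp : (s < p)%N) (szF : (size F <= s.+1 * (p - 1))%N).

(** The equation [D^(p-1) eta = - eta^p] for [eta = h / z_j], read coefficient by coefficient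
    ([derivn_pred_cartier]). *)
Definition cartier_fixed (h : {poly K}) : Prop :=
  forall k, (h * map_poly phi F)`_(k * p + (p - 1)) = h`_k ^+ p.

Let coef_hF (h : {poly K}) (k : nat) : (size h <= s)%N ->
  (h * map_poly phi F)`_(k * p + (p - 1)) = \sum_(i < s) h`_i * phi F`_(k.+1 * p - i.+1).
Proof.
move=> szh; rewrite coefM -(big_mkord xpredT (fun i => h`_i * (map_poly phi F)`_(k * p + (p - 1) - i))).
rewrite (big_cat_nat (n := s)) //=; last by move: sp; clear; lia.
rewrite [X in _ + X]big_nat_cond [X in _ + X]big1 ?addr0 => [|i]; last first.
  by rewrite andbT => /andP[si _]; rewrite nth_default ?mul0r // (leq_trans szh).
rewrite big_mkord; apply: eq_bigr => i _; rewrite coef_map /=; congr (_ * phi (nth 0 F _)).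
by rewrite mulSn; have := ltn_ord i; move: sp; clear; lia.
Qed.

Lemma cartier_fixed_exists :
  ~ (exists r, hasse_witt p s F ^+ r = 0) ->
  exists h : {poly K}, [/\ h != 0, (size h <= s)%N & cartier_fixed h].
Proof.
move=> nil; have pK : p \in [pchar K] by rewrite (fmorph_pchar phi) pchar_Fp.
have [r|v v0 vp] := @frobenius_fixed_vector _ _ phi p s (hasse_witt p s F) pK (Fp_expr p_pr).
  by apply/eqP => r0; apply: nil; exists r.
have szh : (size (rVpoly v^T) <= s)%N by exact: size_poly.
exists (rVpoly v^T); split=> // [|k].
  by apply: contra_neq v0 => /(congr1 (@poly_rV _ s)); rewrite rVpolyK linear0 => /(canRL trmxK) ->; rewrite trmx0.
rewrite coef_hF //; have [ks|sk] := ltnP k s.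
  rewrite -[k]/(nat_of_ord (Ordinal ks)) coef_rVpoly_ord mxE vp mxE.
  by apply: eq_bigr => i _; rewrite !mxE coef_rVpoly_ord mxE mulrC.
(* For [k >= s] both sides vanish: the indices on the left are beyond the degree of [F]. *)
rewrite [_`_k]nth_default ?(leq_trans szh) // expr0n gtn_eqF ?prime_gt0 //.
apply: big1 => i _; rewrite [F`__]nth_default ?rmorph0 ?mulr0 //.
apply: leq_trans szF _; rewrite mulnBr muln1; have := ltn_ord i.
have : (s.+1 * p <= k.+1 * p)%N by rewrite leq_mul2r ltnS sk orbT.
lia.
Qed.

(** The entries of the matrix lie in F_p, so iterating the fixed equation gives [v^(p^n) = H^n v]
    entrywise. *)
Lemma cartier_fixed_nilpotent (h : {poly K}) (r : nat) :
  hasse_witt p s F ^+ r = 0 -> (size h <= s)%N -> cartier_fixed h -> h = 0.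
Proof.
move=> Hr szh fh; pose v : 'cV[K]_s := \col_i h`_i.
have vp n i : v i 0 ^+ (p ^ n) = (map_mx phi (hasse_witt p s F ^+ n) *m v) i 0.
  elim: n i => [|n IH] i; first by rewrite expr0 map_mx1 mul1mx expr1.
  have pK : p \in [pchar K] by rewrite (fmorph_pchar phi) pchar_Fp.
  rewrite expnSr exprM IH exprSr map_mxM -mulmxA [RHS]mxE mxE -(pFrobenius_autE pK) rmorph_sum.
  apply: eq_bigr => j _; rewrite rmorphM /= !pFrobenius_autE [in LHS]mxE -rmorphXn Fp_expr //.
  rewrite [in RHS]mxE; congr (_ * _); rewrite !mxE -fh coef_hF //.
  by apply: eq_bigr => l _; rewrite !mxE mulrC.
apply/polyP => i; rewrite coef0; have [is_|si] := ltnP i s; last by rewrite nth_default ?(leq_trans szh).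
have := vp r (Ordinal is_); rewrite Hr map_mx0 mul0mx [RHS]mxE mxE /= => /eqP.
by rewrite expf_eq0 => /andP[_ /eqP].
Qed.

End FixedPolynomial.

(** * Orders at a place *)

Section Places.
Variables (K L : fieldType) (iota : {rmorphism K -> L}).
Implicit Types P Q : place iota.

Lemma placeP P Q : P =1 Q -> P = Q.
Proof.
case: P Q => [f fM fA fC fU] [g gM gA gC gU] /= /funext fg; case: _ / fg in gM gA gC gU *.
by congr Place; apply: Prop_irrelevance.
Qed.

Lemma ord0 P : P 0 = 0. Proof. by rewrite -(rmorph0 iota) place_const. Qed.
Lemma ord1 P : P 1 = 0. Proof. by rewrite -(rmorph1 iota) place_const. Qed.

Lemma ordV P u : P u^-1 = - P u.
Proof.
have [->|u0] := eqVneq u 0; first by rewrite invr0 ord0 oppr0.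
by apply/eqP; rewrite -addr_eq0 addrC -place_mul ?invr_eq0 // divff // ord1.
Qed.

Lemma ordN P u : P (- u) = P u.
Proof.
have [->|u0] := eqVneq u 0; first by rewrite oppr0.
by rewrite -mulN1r place_mul ?oppr_eq0 ?oner_eq0 // -(rmorphN1 iota) place_const add0r.
Qed.

Lemma ordX P u n : P (u ^+ n) = n%:Z * P u.
Proof.
have [->|u0] := eqVneq u 0; first by rewrite expr0n; case: n => [|n]; rewrite ?ord1 ?ord0 ?mulr0.
elim: n => [|n IH]; first by rewrite ord1 mul0r.
by rewrite exprS place_mul ?expf_neq0 // IH; lia.
Qed.

Lemma ord_prod P (I : Type) (r : seq I) (F : I -> L) :
  (forall i, F i != 0) -> P (\prod_(i <- r) F i) = \sum_(i <- r) P (F i).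
Proof.
move=> F0; elim: r => [|i r IH]; rewrite ?big_nil ?ord1 // !big_cons place_mul ?IH //.
by elim/big_ind: _ => // [|a b]; [exact: oner_neq0 | exact: mulf_neq0].
Qed.

(* Places take the junk value 0 at 0. *)
Definition ord_ge P (n : int) (u : L) : bool := (u == 0) || (n <= P u).

Lemma ord_ge0 P n : ord_ge P n 0. Proof. by rewrite /ord_ge eqxx. Qed.

Lemma ord_geE P n u : u != 0 -> ord_ge P n u = (n <= P u).
Proof. by rewrite /ord_ge => /negPf->. Qed.

Lemma ord_ge_trans P n k u : k <= n -> ord_ge P n u -> ord_ge P k u.
Proof. by move=> kn /orP[/eqP->|nu]; rewrite ?ord_ge0 // /ord_ge (le_trans kn nu) orbT. Qed.

Lemma ord_geD P n u v : ord_ge P n u -> ord_ge P n v -> ord_ge P n (u + v).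
Proof.
rewrite /ord_ge; have [->|u0] /= := eqVneq u 0; first by rewrite add0r.
have [->|v0] /= := eqVneq v 0; first by rewrite addr0 (negPf u0).
move=> nu nv; have [//|uv0] /= := eqVneq (u + v) 0.
by apply: le_trans (place_add P u0 v0 uv0); rewrite le_min nu.
Qed.

Lemma ord_geN P n u : ord_ge P n (- u) = ord_ge P n u.
Proof. by rewrite /ord_ge oppr_eq0 ordN. Qed.

Lemma ord_geB P n u v : ord_ge P n u -> ord_ge P n v -> ord_ge P n (u - v).
Proof. by move=> nu nv; rewrite ord_geD ?ord_geN. Qed.

Lemma ord_geM P n k u v : ord_ge P n u -> ord_ge P k v -> ord_ge P (n + k) (u * v).
Proof.
rewrite /ord_ge mulf_eq0; case: (eqVneq u 0) => //= u0; case: (eqVneq v 0) => //= v0.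
by move=> nu kv; rewrite place_mul // lerD.
Qed.

Lemma ord_ge_sum P n (I : Type) (r : seq I) (A : pred I) (F : I -> L) :
  (forall i, A i -> ord_ge P n (F i)) -> ord_ge P n (\sum_(i <- r | A i) F i).
Proof. by move=> nF; elim/big_ind: _ => //; [apply: ord_ge0 | apply: ord_geD]. Qed.

Lemma ord_ge_const P c : ord_ge P 0 (iota c).
Proof. by rewrite /ord_ge place_const lexx orbT. Qed.

Lemma ord_addl P u v : u != 0 -> ord_ge P (P u + 1) v -> (u + v != 0) && (P (u + v) == P u).
Proof.
move=> u0 uv; have uv0 : u + v != 0.
  apply/negP; rewrite addr_eq0 => /eqP uE; move: uv.
  by rewrite -ord_geN -uE ord_geE //; lia.
rewrite uv0 /= eq_le; apply/andP; split.
  rewrite leNgt; apply/negP => lt.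
  have := @ord_geB P (P u + 1) (u + v) v _ uv; rewrite addrK !ord_geE // => /(_ _).
  lia.
have : ord_ge P (P u) (u + v).
  by rewrite ord_geD //; [rewrite ord_geE | apply: ord_ge_trans uv; lia].
by rewrite ord_geE.
Qed.

(** The summand of least order cannot be cancelled by the others. *)
Lemma ord_sum_distinct P (I : finType) (F : I -> L) (i : I) :
  (forall j k, j != k -> F j != 0 -> F k != 0 -> P (F j) != P (F k)) ->
  F i != 0 -> \sum_j F j != 0 /\ P (\sum_j F j) <= P (F i).
Proof.
move=> dist i0.
have [j j0 jmin] := @Order.TotalTheory.arg_minP _ _ _ i (fun k => F k != 0) (fun k => P (F k)) i0.
rewrite (bigD1 j) //=.
have rest : ord_ge P (P (F j) + 1) (\sum_(k | k != j) F k).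
  apply: ord_ge_sum => k kj; have [->|k0] := eqVneq (F k) 0; first exact: ord_ge0.
  by rewrite ord_geE //; have := jmin k k0; have := dist k j kj k0 j0; lia.
by have /andP[s0 /eqP sP] := ord_addl j0 rest; rewrite sP; split=> //; apply: jmin.
Qed.

Lemma horner_root_factor (c : K) (g : {poly K}) (x : L) :
  exists q : {poly K}, (map_poly iota g).[x] = iota g.[c] + (x - iota c) * (map_poly iota q).[x].
Proof.
have /factor_theorem[q gq] : root (g - g.[c]%:P) c by rewrite rootE !hornerE subrr.
exists q; have E : g = g.[c]%:P + q * ('X - c%:P) by rewrite -gq addrC subrK.
by rewrite [in LHS]E rmorphD rmorphM /= map_polyC map_polyXsubC !hornerE /= [in RHS]mulrC.
Qed.

Section OverPoint.
Variables (P : place iota) (x : L) (c : K).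

Lemma ord_ge_horner (g : {poly K}) y :
  ord_ge P 0 y -> ord_ge P 0 (map_poly iota g).[y].
Proof.
move=> y0; elim/poly_ind: g => [|g a IH]; first by rewrite rmorph0 horner0 ord_ge0.
rewrite rmorphD rmorphM /= map_polyX map_polyC !hornerE ord_geD ?ord_ge_const //.
by rewrite -[0]addr0 ord_geM.
Qed.

Hypothesis xc : x != iota c.
Hypothesis Pxc : 0 < P (x - iota c).

Let x0 : ord_ge P 0 x.
Proof.
rewrite -[x](subrK (iota c)) ord_geD ?ord_ge_const // ord_geE ?subr_eq0 //.
exact: ltW.
Qed.

Lemma ord_horner_nroot (g : {poly K}) : ~~ root g c ->
  (map_poly iota g).[x] != 0 /\ P (map_poly iota g).[x] = 0.
Proof.
rewrite rootE => gc; have [q ->] := horner_root_factor c g x.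
have gc0 : iota g.[c] != 0 by rewrite fmorph_eq0.
have := @ord_addl P _ ((x - iota c) * (map_poly iota q).[x]) gc0.
rewrite place_const add0r => /(_ _)/andP[|? /eqP->] //.
rewrite -[1]addr0; apply: ord_geM; last exact: ord_ge_horner.
by rewrite ord_geE ?subr_eq0 //; move: Pxc; clear; lia.
Qed.

Lemma ord_horner_mup (g : {poly K}) : g != 0 ->
  (map_poly iota g).[x] != 0 /\ P (map_poly iota g).[x] = (mup c g)%:Z * P (x - iota c).
Proof.
move=> g0; have := @mup_geq _ c g (mup c g) g0; rewrite leqnn => /esym/dvdpP[q gq].
have rq : ~~ root q c.
  apply: contraTN (leqnn (mup c g)) => rq; rewrite -ltnNge mup_geq // {2}gq exprS.
  by rewrite dvdp_mul // dvdp_XsubCl.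
have [q0 Pq] := ord_horner_nroot rq.
have -> : (map_poly iota g).[x] = (map_poly iota q).[x] * (x - iota c) ^+ mup c g.
  by rewrite [in LHS]gq rmorphM rmorphXn /= map_polyXsubC hornerM horner_exp !hornerE.
have xc0 : (x - iota c) ^+ mup c g != 0 by rewrite expf_neq0 // subr_eq0.
by rewrite mulf_neq0 // place_mul // ordX Pq add0r.
Qed.

End OverPoint.

Lemma ord_horner_pole P (x : L) (g : {poly K}) : P x < 0 -> g != 0 ->
  (map_poly iota g).[x] != 0 /\ P (map_poly iota g).[x] = (size g).-1%:Z * P x.
Proof.
move=> Px; have x0 : x != 0 by apply: contraTneq Px => ->; rewrite ord0.
elim/poly_ind: g => [|g c IH]; rewrite ?eqxx // => gc0.
rewrite rmorphD rmorphM /= map_polyX map_polyC /= !hornerE.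
have [g0|g0] := eqVneq g 0.
  move: gc0; rewrite g0 rmorph0 mul0r add0r horner0 mul0r add0r polyC_eq0 size_polyC => c0.
  by rewrite fmorph_eq0 c0 place_const /= mul0r.
have [gx0 gP] := IH g0; have gxx0 : (map_poly iota g).[x] * x != 0 by rewrite mulf_neq0.
have /andP[-> /eqP->] : ((map_poly iota g).[x] * x + iota c != 0) &&
    (P ((map_poly iota g).[x] * x + iota c) == P ((map_poly iota g).[x] * x)).
  apply: ord_addl => //; have [->|c0] := eqVneq c 0; first by rewrite rmorph0 ord_ge0.
  by rewrite ord_geE ?fmorph_eq0 // place_const place_mul // gP; nia.
split=> //; rewrite place_mul // gP size_MXaddC (negPf g0) /=.
have : (0 < size g)%N by rewrite size_poly_gt0.
by case: (size g) => //= n _; rewrite -[n.+1]addn1 PoszD mulrDl mul1r.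
Qed.

End Places.

Lemma closed_nth_root (K : closedFieldType) (c : K) (n : nat) :
  (0 < n)%N -> exists b : K, b ^+ n = c.
Proof.
case: n => // n _; have [b] := @solve_monicpoly K n.+1 (fun i => if i is 0 then c else 0) isT.
rewrite big_ord_recl /= big1 ?addr0 ?expr0 ?mulr1 => [E|i _]; last by rewrite mul0r.
by exists b.
Qed.

Lemma binomial_sum_recr (V : nmodType) (n : nat) (f : nat -> nat -> V) :
  \sum_(k < n.+2) f (n.+1 - k)%N k *+ 'C(n.+1, k)
  = \sum_(k < n.+1) (f (n - k).+1 k + f (n - k)%N k.+1) *+ 'C(n, k).
Proof.
under [RHS]eq_bigr => k _ do rewrite mulrnDl.
rewrite [RHS]big_split /= big_ord_recl [X in _ = X + _]big_ord_recl /= !subn0 !bin0 -addrA.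
congr (_ + _); rewrite big_ord_recr [X in _ = _ + X]big_ord_recr /= addrA; congr (_ + _).
  rewrite -big_split /=; apply: eq_bigr => k _; rewrite /bump /= !add1n subSS binS mulrnDr.
  by rewrite -subSn // subSS.
by rewrite /bump /= add1n subSS !subnn !binn.
Qed.

(** * Derivations and Jacobson's formula *)

Section Derivation.
Variables (K : closedFieldType) (L : fieldType) (iota : {rmorphism K -> L}).
Variables (p : nat) (pK : p \in [pchar K]) (x : L).
Hypothesis basis : forall u, exists w : 'I_p -> L, u = \sum_(i < p) w i ^+ p * x ^+ i.
Hypothesis indep : forall w : 'I_p -> L, \sum_(i < p) w i ^+ p * x ^+ i = 0 -> forall i, w i = 0.

Let pL : p \in [pchar L]. Proof. by rewrite (fmorph_pchar iota). Qed.
Let p_pr : prime p := pcharf_prime pK.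
Let p0 : (0 < p)%N := prime_gt0 p_pr.
Local Notation frob := (pFrobenius_aut pL).
Local Notation fpoly W := (map_poly frob W).

Lemma frob_poly_ex (u : L) : exists2 W : {poly L}, (size W <= p)%N & u = (fpoly W).[x].
Proof.
have [w ->] := basis u; pose v i := if insub i is Some j then w j else 0.
exists (\poly_(i < p) v i); first exact: size_poly.
have szW : (size (fpoly (\poly_(i < p) v i)) <= p)%N by rewrite size_map_poly size_poly.
rewrite (horner_coef_wide _ szW); apply: eq_bigr => i _.
by rewrite coef_map coef_poly ltn_ord /= pFrobenius_autE /v valK.
Qed.

(** This makes the derivation well defined. All relations come from [X^p - x^p], whose derivative is
    0; multiples of it lower the degree of [W] until [indep] applies. *)
Lemma frob_poly_deriv0 (W : {poly L}) : (fpoly W).[x] = 0 -> (fpoly W)^`().[x] = 0.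
Proof.
have [n] := ubnP (size W); elim: n W => // n IH W szW W0.
have [Wp|pW] := leqP (size W) p.
  suff -> : W = 0 by rewrite rmorph0 deriv0 horner0.
  apply/polyP => i; rewrite coef0; have [ip|pi] := ltnP i p; last first.
    by rewrite nth_default // (leq_trans Wp).
  have szW' : (size (fpoly W) <= p)%N by rewrite size_map_poly.
  apply: (@indep (fun i : 'I_p => W`_i) _ (Ordinal ip)).
  rewrite -[RHS]W0 (horner_coef_wide _ szW'); apply: eq_bigr => j _.
  by rewrite coef_map /= pFrobenius_autE.
set k := ((size W).-1 - p)%N; have szWE : (size W).-1 = (k + p)%N.
  by rewrite subnK // -ltnS prednK // (leq_trans _ pW).
(* The Frobenius twist of [T] is [X^k (X^p - x^p)]. *)
pose T : {poly L} := 'X^(k + p) - x *: 'X^k.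
have ET : fpoly T = 'X^(k + p) - x ^+ p *: 'X^k.
  by rewrite rmorphB /= map_polyZ !map_polyXn /= pFrobenius_autE.
have T0 : (fpoly T).[x] = 0 by rewrite ET !hornerE -exprD addnC subrr.
have dT0 : (fpoly T)^`().[x] = 0.
  rewrite ET derivB derivZ !derivXn !hornerE !hornerMn !hornerXn.
  rewrite mulrnDr; case: k {szWE T ET T0} => [|k].
    by rewrite mulr0n add0r mulr0n mulr0 subr0 -mulr_natr (pcharf0 pL) mulr0.
  rewrite -[in X in X + _ - _]mulr_natr -[in X in _ + X - _]mulr_natr (pcharf0 pL) mulr0 addr0.
  by rewrite addSn /= mulr_natr mulrnAr -exprD addnC subrr.
have WT : W = W - lead_coef W *: T + lead_coef W *: T by rewrite subrK.
rewrite WT rmorphD derivD hornerD /= map_polyZ derivZ hornerZ dT0 mulr0 addr0.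
apply: IH; last by rewrite rmorphB /= map_polyZ !hornerE W0 T0 mulr0 subr0.
have szT : size T = (k + p).+1.
  rewrite size_polyDl size_polyXn // size_polyN; apply: leq_ltn_trans (size_scale_leq _ _) _.
  by rewrite size_polyXn ltnS -{1}[k]addn0 ltn_add2l.
have W00 : (0 < size W)%N by apply: leq_trans pW.
have lT : lead_coef T = 1.
  rewrite /T lead_coefDl ?lead_coefXn // size_polyN size_polyXn ltnS.
  apply: leq_trans (size_scale_leq _ _) _.
  by rewrite size_polyXn -{1}[k]addn0 ltn_add2l.
rewrite -ltnS; apply: leq_trans szW; rewrite ltnS -[X in (_ < X)%N](prednK W00) ltnS.
apply/leq_sizeP => j; rewrite leq_eqVlt => /predU1P[<-|lj]; rewrite coefB coefZ.
  rewrite -lead_coefE (_ : T`_(size W).-1 = 1) ?mulr1 ?subrr //.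
  by rewrite -lT lead_coefE szT szWE.
rewrite !nth_default ?mulr0 ?subr0 //; last by rewrite -(prednK W00).
by rewrite szT -szWE.
Qed.

(** The derivation d/dx, computed on an expression of [u] in [x] with p-th powers as coefficients;
    by [deriv_eltE] the choice of the expression does not matter. *)
Definition deriv_elt (u : L) : L := (fpoly (s2val (cid2 (frob_poly_ex u))))^`().[x].
Local Notation D := deriv_elt.

Lemma deriv_eltE (W : {poly L}) : D (fpoly W).[x] = (fpoly W)^`().[x].
Proof.
rewrite /D; case: cid2 => V /= _ E; apply/eqP.
rewrite -subr_eq0 -hornerN -hornerD -derivN -derivD -rmorphN -rmorphD.
by apply/eqP/frob_poly_deriv0; rewrite rmorphD rmorphN hornerD hornerN E subrr.
Qed.

Lemma deriv_eltD : {morph D : u v / u + v}.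
Proof.
move=> u v; have [U _ ->] := frob_poly_ex u; have [V _ ->] := frob_poly_ex v.
by rewrite -hornerD -rmorphD !deriv_eltE rmorphD derivD hornerD.
Qed.

Lemma deriv_eltM u v : D (u * v) = D u * v + u * D v.
Proof.
have [U _ ->] := frob_poly_ex u; have [V _ ->] := frob_poly_ex v.
by rewrite -hornerM -rmorphM !deriv_eltE rmorphM derivM hornerD !hornerM.
Qed.

Lemma deriv_elt_pth w : D (w ^+ p) = 0.
Proof.
have -> : w ^+ p = (fpoly w%:P).[x] by rewrite map_polyC hornerC /= pFrobenius_autE.
by rewrite deriv_eltE map_polyC derivC horner0.
Qed.

Lemma deriv_elt_x : D x = 1.
Proof.
have {1}-> : x = (fpoly 'X).[x] by rewrite map_polyX hornerX.
by rewrite deriv_eltE map_polyX derivX hornerC.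
Qed.

Lemma derivation_exists : exists D : L -> L,
  [/\ {morph D : u v / u + v}, forall u v, D (u * v) = D u * v + u * D v,
      forall w, D (w ^+ p) = 0 & D x = 1].
Proof.
by exists deriv_elt; split; [exact: deriv_eltD | exact: deriv_eltM | exact: deriv_elt_pth | exact: deriv_elt_x].
Qed.

End Derivation.

Section Jacobson.
Variables (K : closedFieldType) (L : fieldType) (iota : {rmorphism K -> L}).
Variables (p : nat) (pK : p \in [pchar K]) (x : L) (D : L -> L).
Hypothesis basis : forall u, exists w : 'I_p -> L, u = \sum_(i < p) w i ^+ p * x ^+ i.
Hypotheses (DD : {morph D : u v / u + v}) (DM : forall u v, D (u * v) = D u * v + u * D v).
Hypotheses (Dpth : forall w, D (w ^+ p) = 0) (Dx : D x = 1).
Hypothesis x_transc : forall c, x != iota c.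

Let pL : p \in [pchar L]. Proof. by rewrite (fmorph_pchar iota). Qed.
Let p_pr : prime p := pcharf_prime pK.
Let p0 : (0 < p)%N := prime_gt0 p_pr.

Let D0 : D 0 = 0. Proof. by have := Dpth 0; rewrite expr0n gtn_eqF. Qed.
Let D1 : D 1 = 0. Proof. by have := Dpth 1; rewrite expr1n. Qed.
Let DN u : D (- u) = - D u.
Proof. by apply/eqP; rewrite -addr_eq0 -DD addNr D0. Qed.
Let frobN (u : L) : (- u) ^+ p = - u ^+ p.
Proof. by rewrite -!(pFrobenius_autE pL) rmorphN. Qed.
Let D_sum (I : Type) (r : seq I) (F : I -> L) : D (\sum_(i <- r) F i) = \sum_(i <- r) D (F i).
Proof. exact: (big_morph D DD D0). Qed.
Let DX u n : D (u ^+ n) = u ^+ n.-1 * D u *+ n.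
Proof.
elim: n => [|n IH]; first by rewrite D1 mulr0n.
rewrite exprS DM IH mulrnAr mulrA -exprS; case: n {IH} => [|n]; first by rewrite !expr0 mulr0n addr0 mulrC.
by rewrite [RHS]mulrS mulrC.
Qed.

Let D_const c : D (iota c) = 0.
Proof. by have [b <-] := closed_nth_root c p0; rewrite rmorphXn Dpth. Qed.

Let D_pth_mul w u : D (w ^+ p * u) = w ^+ p * D u.
Proof. by rewrite DM Dpth mul0r add0r. Qed.

Lemma deriv_horner (g : {poly K}) : D (map_poly iota g).[x] = (map_poly iota g^`()).[x].
Proof.
elim/poly_ind: g => [|g c IH]; first by rewrite deriv0 rmorph0 horner0.
rewrite derivMXaddC !rmorphD !rmorphM /= !map_polyX map_polyC !hornerE DD DM D_const addr0 IH Dx mulr1.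
by rewrite addrC.
Qed.

Lemma iter_deriv_horner (g : {poly K}) n :
  iter n D (map_poly iota g).[x] = (map_poly iota g^`(n)).[x].
Proof. by elim: n => [|n IH] //; rewrite iterS IH deriv_horner derivnS. Qed.

Lemma iter_deriv_pth_mul w u n : iter n D (w ^+ p * u) = w ^+ p * iter n D u.
Proof. by elim: n => [|n IH] //; rewrite !iterS IH D_pth_mul. Qed.

Lemma iter_derivD u v n : iter n D (u + v) = iter n D u + iter n D v.
Proof. by elim: n => [|n IH] //; rewrite !iterS IH DD. Qed.

Lemma iter_deriv0 n : iter n D 0 = 0.
Proof. by elim: n => [|n IH] //; rewrite iterS IH D0. Qed.

Lemma iter_deriv_sum (I : Type) (r : seq I) (F : I -> L) n :
  iter n D (\sum_(i <- r) F i) = \sum_(i <- r) iter n D (F i).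
Proof. by elim: n => [|n IH] //; rewrite iterS IH D_sum. Qed.

Lemma iter_deriv_p u : iter p D u = 0.
Proof.
have [w ->] := basis u; rewrite iter_deriv_sum big1 // => i _; rewrite iter_deriv_pth_mul.
have -> : x ^+ i = (map_poly iota 'X^i).[x] by rewrite map_polyXn hornerXn.
rewrite iter_deriv_horner derivn_poly0 ?rmorph0 ?horner0 ?mulr0 //.
by rewrite size_polyXn.
Qed.

(** The connection [D + eta]; a nonzero solution of [nabla (- eta) u = 0] has logarithmic derivative
    [eta]. *)
Definition nabla (eta v : L) : L := D v + eta * v.

Lemma iter_nablaM eta zeta a b n :
  iter n (nabla (eta + zeta)) (a * b)
  = \sum_(k < n.+1) iter (n - k) (nabla eta) a * iter k (nabla zeta) b *+ 'C(n, k).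
Proof.
elim: n => [|n IH]; first by rewrite big_ord1 /= mulr1n.
rewrite (binomial_sum_recr n (fun i j => iter i (nabla eta) a * iter j (nabla zeta) b)).
rewrite iterS IH /nabla D_sum mulr_sumr -big_split; apply: eq_bigr => k _ /=.
set u := iter _ _ a; set v := iter _ _ b; set N := 'C(n, k).
have DMn (y : L) m : D (y *+ m) = D y *+ m.
  by elim: m => [|m IHm]; rewrite ?mulr0n ?D0 // !mulrS DD IHm.
rewrite DMn DM mulrnAr -mulrnDl; congr (_ *+ _).
by rewrite /nabla; ring.
Qed.

Lemma iter_nablaM_p eta zeta a b :
  iter p (nabla (eta + zeta)) (a * b)
  = iter p (nabla eta) a * b + a * iter p (nabla zeta) b.
Proof.
rewrite iter_nablaM; case: p p_pr pL => // q q_pr qL.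
rewrite big_ord_recl big_ord_recr big1 => [|k _].
  by rewrite /= /bump /= add1n subnn binn bin0 !mulr1n add0r.
rewrite -mulr_natr (_ : 'C(_, _)%:R = 0) ?mulr0 //.
apply/eqP; rewrite -(dvdn_pcharf qL) prime_dvd_bin //.
by rewrite /= /bump /=; have := ltn_ord k; lia.
Qed.

(** The p-curvature of [D + eta]: since [D^p = 0], the p-th iterate of the connection is
    multiplication by this element ([iter_nabla_p]). *)
Definition jacobson eta : L := iter p (nabla eta) 1.

Lemma jacobsonD eta zeta : jacobson (eta + zeta) = jacobson eta + jacobson zeta.
Proof. by rewrite /jacobson -{1}[1]mulr1 iter_nablaM_p mulr1 mul1r. Qed.

Lemma iter_nabla_p eta v : iter p (nabla eta) v = jacobson eta * v.
Proof.
rewrite -{1}[v]mul1r -{1}[eta]addr0 iter_nablaM_p (_ : iter p (nabla 0) v = 0) ?mulr0 ?addr0 //.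
rewrite -[RHS](iter_deriv_p v); apply: eq_iter => y.
by rewrite /nabla mul0r addr0.
Qed.

Lemma jacobson0 : jacobson 0 = 0.
Proof. by apply: (addrI (jacobson 0)); rewrite -jacobsonD !addr0. Qed.

Lemma prod_sub_nat (s : L) : \prod_(i < p) (s - i%:R) = s ^+ p - s.
Proof.
pose rs : seq L := [seq i%:R | i <- seq.iota 0 p].
have urs : uniq rs.
  rewrite map_inj_in_uniq ?iota_uniq // => i j; rewrite !mem_iota /= => ip jp.
  wlog lij : i j ip jp / (i <= j)%N => [hw|] E.
    by case/orP: (leq_total i j) => l; [apply: hw | apply/esym/hw].
  apply/eqP; rewrite eqn_leq lij -subn_eq0 eqn0Ngt /=; apply/negP => ji0.
  have : (p %| j - i)%N by rewrite (dvdn_pcharf pL) natrB // -E subrr.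
  by move/(dvdn_leq ji0); lia.
have Prs : all (root ('X^p - 'X)) rs.
  apply/allP => ? /mapP[i _ ->]; rewrite /root !hornerE -(pFrobenius_autE pL).
  by rewrite pFrobenius_aut_nat subrr.
have szP : size ('X^p - 'X : {poly L}) = p.+1.
  by rewrite size_polyDl size_polyXn // size_polyN size_polyX ltnS prime_gt1.
have lP : lead_coef ('X^p - 'X : {poly L}) = 1.
  by rewrite lead_coefDl ?lead_coefXn // size_polyN size_polyX size_polyXn ltnS prime_gt1.
have := @all_roots_prod_XsubC _ ('X^p - 'X) rs.
rewrite szP lP size_map size_iota uniq_rootsE => /(_ erefl Prs urs)/(congr1 (horner^~ s)).
rewrite scale1r big_map -{2}(subn0 p) -/(index_iota 0 p) big_mkord horner_prod !hornerE => ->.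
by apply: eq_bigr => i _; rewrite !hornerE.
Qed.

Lemma iter_deriv_exprn (X : L) n k : D X = 1 -> (k <= n)%N ->
  iter k D (X ^+ n) = X ^+ (n - k) *+ n ^_ k.
Proof.
move=> DX1; elim: k => [|k IH] kn; first by rewrite subn0 ffactn0.
rewrite iterS IH ?(ltnW kn) // ffactnSr mulrnA.
have DMn (y : L) m : D (y *+ m) = D y *+ m.
  by elim: m => [|m IHm]; rewrite ?mulr0n ?D0 // !mulrS DD IHm.
by rewrite DMn DX DX1 mulr1 -subnS mulrnAC.
Qed.

Lemma iter_deriv_top (X : L) : D X = 1 -> iter p.-1 D (X ^+ p.-1) = -1.
Proof.
move=> DX1; rewrite iter_deriv_exprn // subnn expr0 ffactnn.
by apply/eqP; rewrite -addr_eq0 natr1 -(dvdn_pcharf pL) -Wilson ?prime_gt1.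
Qed.

(* With s = (w X)^p, a constant of D, X^k nabla^k 1 = prod_(i < k) (s - i). *)
Lemma jacobson_top (w X : L) : X != 0 -> D X = 1 ->
  jacobson (w ^+ p * X ^+ p.-1) = (w ^+ p * X ^+ p.-1) ^+ p - w ^+ p.
Proof.
move=> X0 DX1; set eta := w ^+ p * X ^+ p.-1; pose s := (w * X) ^+ p.
have sE : eta * X = s by rewrite /eta /s exprMn -mulrA -exprSr prednK.
have Dsn k : D (s - k%:R) = 0.
  by rewrite DD DN Dpth -(rmorph_nat iota) D_const subrr.
have step k : X ^+ k * iter k (nabla eta) 1 = \prod_(i < k) (s - i%:R) /\ D (\prod_(i < k) (s - i%:R)) = 0.
  elim: k => [|k [IH1 IH2]]; first by rewrite big_ord0 mul1r.
  rewrite big_ord_recr /= DM IH2 Dsn mulr0 mul0r addr0; split=> //.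
  have := congr1 D IH1; rewrite IH2 DM DX DX1 mulr1 => E.
  have {}E : X ^+ k.+1 * D (iter k (nabla eta) 1) = - (k%:R * (X ^+ k * iter k (nabla eta) 1)).
    apply/eqP; rewrite -addr_eq0 exprS -mulrA addrC; apply/eqP.
    rewrite -[RHS](mulr0 X) -E mulrDr; congr (_ + _).
    case: k {IH1 IH2 E} => [|k]; first by rewrite mulr0n !mul0r mulr0.
    by rewrite /= mulr_natl mulrA mulrnAr -exprS mulrnAl.
  set v := iter k _ _ in IH1 E *; rewrite /nabla mulrDr E IH1.
  have -> : X ^+ k.+1 * (eta * v) = eta * X * (X ^+ k * v) by rewrite exprS; ring.
  by rewrite sE IH1; ring.
apply: (mulfI (expf_neq0 p X0)); rewrite (step p).1 prod_sub_nat mulrBr; congr (_ - _).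
  by rewrite -exprMn [X * _]mulrC sE.
by rewrite /s exprMn mulrC.
Qed.

(** Both sides are additive in [eta], so Jacobson's formula need only be checked on a spanning
    set. *)
Let good (eta : L) := jacobson eta = eta ^+ p + iter p.-1 D eta.

Let good0 : good 0.
Proof. by rewrite /good jacobson0 expr0n gtn_eqF // iter_deriv0 addr0. Qed.

Let goodD eta zeta : good eta -> good zeta -> good (eta + zeta).
Proof.
rewrite /good jacobsonD iter_derivD => -> ->.
by rewrite -!(pFrobenius_autE pL) rmorphD addrACA.
Qed.

Let good_sum (I : Type) (r : seq I) (A : pred I) (F : I -> L) :
  (forall i, A i -> good (F i)) -> good (\sum_(i <- r | A i) F i).
Proof. by move=> gF; elim/big_ind: _. Qed.

Let good_top (w : L) (a : K) : good (w ^+ p * (x - iota a) ^+ p.-1).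
Proof.
have DX1 : D (x - iota a) = 1 by rewrite DD DN D_const subr0.
by rewrite /good jacobson_top ?subr_eq0 // iter_deriv_pth_mul iter_deriv_top // mulrN1.
Qed.

(* For i < p - 1, x^i is - sum_(c in F_p) c^i (x - c)^(p-1). *)
Let good_monomial (w : L) (i : nat) : (i < p)%N -> good (w ^+ p * x ^+ i).
Proof.
move=> ip; have [->|ip1] := eqVneq i p.-1.
  by have := good_top w 0; rewrite rmorph0 subr0.
have {ip ip1}ip : (i < p.-1)%N by move: ip ip1; clear -p0; lia.
have [urs szrs memrs] := frob_rootsP pK (ltn0Sn 0).
have fixc c : c \in frob_roots p K 1 -> c ^+ p = c by rewrite memrs expn1 => /eqP.
have top c : c \in frob_roots p K 1 ->
    (x - iota c) ^+ p.-1 = \sum_(k < p) x ^+ (p.-1 - k) * iota c ^+ k.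
  move=> cr; have xc0 : x - iota c != 0 by rewrite subr_eq0.
  apply: (mulfI xc0); rewrite -subrXX -exprS prednK //.
  by rewrite -!(pFrobenius_autE pL) rmorphB.
suff -> : w ^+ p * x ^+ i = \sum_(c <- frob_roots p K 1 | c \in frob_roots p K 1)
    (- (w * iota (c ^+ i))) ^+ p * (x - iota c) ^+ p.-1.
  by apply: good_sum => c _; apply: good_top.
transitivity (\sum_(c <- frob_roots p K 1 | c \in frob_roots p K 1)
    \sum_(k < p) - (w ^+ p * x ^+ (p.-1 - k) * iota (c ^+ (i + k)))); last first.
  apply: eq_bigr => c cr; rewrite top // frobN exprMn -rmorphXn exprAC fixc // mulNr mulr_sumr -sumrN; apply: eq_bigr => k _.
  by rewrite exprD rmorphM !rmorphXn /=; ring.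
rewrite -big_seq exchange_big /=.
have ipo : (p.-1 - i < p)%N by move: p0; clear; lia.
rewrite (bigD1 (Ordinal ipo)) //= sumrN -mulr_sumr -rmorph_sum /=.
rewrite (frobenius_power_sum pK _ urs szrs memrs) // expn1 subn1.
have -> : (i + (p.-1 - i))%N = p.-1 by move: ip; clear; lia.
have -> : (p.-1 - (p.-1 - i))%N = i by move: ip; clear; lia.
rewrite dvdnn andbT (_ : (0 < p.-1)%N) ?rmorphN1 ?mulrN1 ?opprK; last by move: ip; clear; lia.
rewrite big1 ?addr0 // => k kn; rewrite sumrN -mulr_sumr -rmorph_sum /=.
rewrite (frobenius_power_sum pK _ urs szrs memrs) // expn1 subn1.
rewrite (_ : _ && _ = false) ?oppr0 ?rmorph0 ?mulr0 ?oppr0 //.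
apply/negP => /andP[ik0 /dvdnP[t E]]; move: kn; rewrite -val_eqE /=.
have := ltn_ord k; case: t E => [|[|t]]; first by move: ik0; clear; lia.
  by move: ip; clear; lia.
by rewrite !mulSn; move: ip p0; clear; lia.
Qed.

Lemma jacobson_formula eta v : iter p (nabla eta) v = (eta ^+ p + iter p.-1 D eta) * v.
Proof.
rewrite iter_nabla_p; congr (_ * v); have [w ->] := basis eta.
by apply: good_sum => i _; apply: good_monomial.
Qed.

(* The last nonzero iterate of the nilpotent operator D - eta on 1. *)
Lemma log_derivative_exists eta : iter p.-1 D eta = - eta ^+ p ->
  exists2 u, u != 0 & D u = eta * u.
Proof.
move=> fix_eta; have nil v : iter p (nabla (- eta)) v = 0.
  have iterN n : iter n D (- eta) = - iter n D eta.
    by elim: n => [|n IH] //; rewrite !iterS IH DN.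
  rewrite jacobson_formula frobN iterN fix_eta.
  by rewrite opprK addNr mul0r.
have ex : exists n, iter n (nabla (- eta)) 1 == 0 by exists p; rewrite nil.
case: (ex_minnP ex) => -[|n]; first by rewrite oner_eq0.
move=> /eqP E emin; exists (iter n (nabla (- eta)) 1).
  by apply/negP => /emin; rewrite ltnn.
by move/eqP: E; rewrite /= /nabla mulNr subr_eq0 => /eqP.
Qed.

(** [D - eta] kills [u], hence so does its p-th iterate, which is multiplication by
    [- (eta^p + D^(p-1) eta)]. *)
Lemma log_derivative_fixed u : u != 0 -> iter p.-1 D (D u / u) = - (D u / u) ^+ p.
Proof.
move=> u0; set eta := D u / u.
have : iter p (nabla (- eta)) u = 0.
  rewrite -(prednK p0) iterSr.
  have -> : nabla (- eta) u = 0 by rewrite /nabla /eta mulNr divfK // subrr.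
  by elim: p.-1 => //= n ->; rewrite /nabla D0 mulr0 addr0.
have iterN n : iter n D (- eta) = - iter n D eta.
  by elim: n => [|n IH] //; rewrite !iterS IH DN.
rewrite jacobson_formula frobN iterN.
move/eqP; rewrite mulf_eq0 (negPf u0) orbF -opprD oppr_eq0 addr_eq0 eq_sym eqr_oppLR.
by move/eqP.
Qed.

End Jacobson.

Lemma int_multiple_small (p : nat) (n k : int) :
  - p%:Z < n < p%:Z -> n = p%:Z * k -> n = 0.
Proof.
move=> np E; have [k0|[k0|k0]] : k = 0 \/ (1 <= k \/ k <= -1) by lia.
- by rewrite E k0 mulr0.
- have : p%:Z * 1 <= p%:Z * k by rewrite ler_wpM2l. lia.
- have : p%:Z * k <= p%:Z * -1 by rewrite ler_wpM2l. lia.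
Qed.

(** * Orders of a function and of its logarithmic derivative *)

Section LogDerivativeOrders.
Variables (K : closedFieldType) (L : fieldType) (iota : {rmorphism K -> L}).
Variables (p : nat) (pK : p \in [pchar K]).
Let pL : p \in [pchar L]. Proof. by rewrite (fmorph_pchar iota). Qed.
Let p_pr : prime p := pcharf_prime pK.
Let p0 : (0 < p)%N := prime_gt0 p_pr.

(** The order of [X] at [P] is prime to [p], in the form in which it is applied to differences of
    orders. *)
Definition p_tame (P : place iota) (X : L) : Prop :=
  forall n k : int, n * P X = p%:Z * k -> exists k', n = p%:Z * k'.

Section Terms.
Variables (P : place iota) (X : L).
Hypothesis tame : p_tame P X.

Let X0 : X != 0.
Proof.
apply/eqP => X0; have [|k] := tame (n := 1) (k := 0); first by rewrite X0 ord0 !mulr0.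
by move/int_multiple_small; have := prime_gt1 p_pr; lia.
Qed.

Let term (w : 'I_p -> L) (i : 'I_p) : L := w i ^+ p * X ^+ i.

Let term0 w i : (term w i == 0) = (w i == 0).
Proof. by rewrite mulf_eq0 !expf_eq0 (negPf X0) andbF orbF p0. Qed.

Let ord_term w i : w i != 0 -> P (term w i) = p%:Z * P (w i) + i%:Z * P X.
Proof. by move=> w0; rewrite /term place_mul ?expf_neq0 // !ordX. Qed.

(** Mod [p] the order is [i P(X)], and tameness separates the [i < p]. *)
Let ord_term_dist w i j : i != j -> w i != 0 -> w j != 0 -> P (term w i) != P (term w j).
Proof.
move=> ij wi wj; rewrite !ord_term //; apply: contraNneq ij => E.
have [|k ek] := tame (n := i%:Z - j%:Z) (k := P (w j) - P (w i)).
  by rewrite mulrBr mulrBl; lia.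
apply/eqP/val_inj => /=; have := ltn_ord i; have := ltn_ord j.
by move: ek => /int_multiple_small; lia.
Qed.

Let sum_term_bound w i : w i != 0 ->
  \sum_j term w j != 0 /\ P (\sum_j term w j) <= P (term w i).
Proof.
move=> wi; apply: (ord_sum_distinct (F := term w)); last by rewrite term0.
by move=> j k jk; rewrite !term0; apply: ord_term_dist.
Qed.

Lemma pth_powers_indep (w : 'I_p -> L) :
  \sum_(i < p) w i ^+ p * X ^+ i = 0 -> forall i, w i = 0.
Proof.
move=> E i; apply/eqP/negPn/negP => wi.
by have [] := sum_term_bound wi; rewrite /term E eqxx.
Qed.

Variables (D : L -> L).
Hypotheses (DD : {morph D : u v / u + v}) (DM : forall u v, D (u * v) = D u * v + u * D v).
Hypotheses (Dpth : forall w, D (w ^+ p) = 0) (DX1 : D X = 1).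
Hypothesis basis : forall u, exists w : 'I_p -> L, u = \sum_(i < p) w i ^+ p * X ^+ i.

(** [X D] is an Euler operator, diagonal on these terms: it removes the term [i = 0] and keeps the
    orders of the others. *)
Let euler_term w i : X * D (term w i) = term w i *+ i.
Proof.
rewrite /term DM Dpth mul0r add0r mulrCA -mulrnAr; congr (_ * _).
elim: (nat_of_ord i) => [|n IH]; first by have := Dpth 1; rewrite expr1n expr0 => ->; rewrite mulr0.
rewrite exprS DM DX1 mul1r mulrDr mulrCA IH mulrnAr -exprS mulrS; congr (_ + _).
Qed.

Let euler_sum w : X * D (\sum_i term w i) = \sum_i term w i *+ i.
Proof.
have D0 : D 0 = 0 by have := Dpth 0; rewrite expr0n gtn_eqF.
by rewrite (big_morph D DD D0) mulr_sumr; apply: eq_bigr => i _; rewrite euler_term.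
Qed.

Let ord_euler_term w (i : 'I_p) : w i != 0 -> (i != 0 :> nat)%N ->
  term w i *+ i != 0 /\ P (term w i *+ i) = P (term w i).
Proof.
move=> wi i0; rewrite -mulr_natl.
have in0 : i%:R != 0 :> L.
  by rewrite -(dvdn_pcharf pL) gtnNdvd // lt0n.
rewrite mulf_eq0 (negPf in0) term0 wi place_mul ?term0 //.
by rewrite -(rmorph_nat iota) place_const add0r.
Qed.

Let sum_euler_bound w (i : 'I_p) : w i != 0 -> (i != 0 :> nat)%N ->
  \sum_j term w j *+ j != 0 /\ P (\sum_j term w j *+ j) <= P (term w i).
Proof.
move=> wi i0; have [n0 <-] := ord_euler_term wi i0.
apply: (ord_sum_distinct (F := fun j => term w j *+ j)) => // j k jk.
have w0 l : term w l *+ l != 0 -> w l != 0 /\ (l != 0 :> nat)%N.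
  move=> h; split; apply: contraNneq h => h; last by rewrite h mulr0n.
  by have := term0 w l; rewrite h eqxx => /eqP->; rewrite mul0rn.
move=> /w0[wj j0] /w0[wk k0]; rewrite (ord_euler_term wj j0).2 (ord_euler_term wk k0).2.
exact: ord_term_dist.
Qed.

Let p_mult (w : 'I_p -> L) (i : 'I_p) (k : int) :
  w i != 0 -> P (term w i) = p%:Z * k -> nat_of_ord i = 0%N.
Proof.
move=> wi; rewrite ord_term // => E.
have [|k' ek] := tame (n := i%:Z) (k := k - P (w i)); first by rewrite mulrBr; lia.
by have := ltn_ord i; move: ek => /int_multiple_small; lia.
Qed.

(** A nonzero term with [i != 0] would survive in [X D u]. *)
Lemma pth_power_of_deriv0 u : D u = 0 -> exists v, u = v ^+ p.
Proof.
have [w ->] := basis u; rewrite -/(term w _) => E.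
exists (w (Ordinal p0)); rewrite (bigD1 (Ordinal p0)) //= mulr1 big1 ?addr0 // => i i0.
apply/eqP; rewrite -/(term w i) term0; apply/negPn/negP => wi.
have [|] := sum_euler_bound wi; first by move: i0; rewrite -val_eqE.
by rewrite -euler_sum E mulr0 eqxx.
Qed.

(** When [p] divides [P u], the term of least order is the one with [i = 0], and [X D] removes
    it. *)
Lemma ord_log_derivative u (k : int) : u != 0 -> P u = p%:Z * k ->
  ord_ge P (P u + 1) (X * D u).
Proof.
have [w ->] := basis u; rewrite -/(term w _) => u0 Pu; rewrite euler_sum.
apply: ord_ge_sum => i _; have [wi|wi] := eqVneq (w i) 0.
  by have := term0 w i; rewrite wi eqxx => /eqP->; rewrite mul0rn ord_ge0.
have [i0|i0] := eqVneq (nat_of_ord i) 0%N; first by rewrite i0 mulr0n ord_ge0.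
have [n0 nP] := ord_euler_term wi i0; rewrite ord_geE // nP.
have [_ le] := sum_term_bound wi.
have neq : P (term w i) != P (\sum_j term w j).
  by apply: contra_neq i0; rewrite Pu; apply: p_mult.
by rewrite -/(\sum_j term w j) in Pu *; rewrite Pu in neq le *; lia.
Qed.

(** Conversely, [X D u = (X eta) u] has larger order than [u]; hence so have all the terms with
    [i != 0], and [u] has the order of the p-th power that remains. *)
Lemma ord_log_exponential u eta : u != 0 -> D u = eta * u -> ord_ge P 1 (X * eta) ->
  exists k : int, P u = p%:Z * k.
Proof.
have [w ->] := basis u; rewrite -/(term w _); set u' := \sum_i _ => u0 E Xeta.
have rest : ord_ge P (P u' + 1) (\sum_(i | i != Ordinal p0) term w i).
  apply: ord_ge_sum => i; rewrite -val_eqE /= => i0; have [wi|wi] := eqVneq (w i) 0.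
    by have := term0 w i; rewrite wi eqxx => /eqP->; rewrite ord_ge0.
  have [s0 sP] := sum_euler_bound wi i0; rewrite ord_geE ?term0 //.
  have : ord_ge P (1 + P u') (\sum_j term w j *+ j).
    by rewrite -euler_sum -/u' E mulrA ord_geM // ord_geE.
  by rewrite ord_geE // addrC => h; apply: le_trans h sP.
have uE : term w (Ordinal p0) = u' - \sum_(i | i != Ordinal p0) term w i.
  by rewrite /u' (bigD1 (Ordinal p0)) //= addrK.
have /andP[n0 /eqP nP] : (u' - \sum_(i | i != Ordinal p0) term w i != 0) &&
    (P (u' - \sum_(i | i != Ordinal p0) term w i) == P u').
  by apply: ord_addl; rewrite ?ord_geN.
exists (P (w (Ordinal p0))); rewrite -nP -uE ord_term ?mul0r ?addr0 //.
by rewrite -term0 uE.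
Qed.

End Terms.

Section Shift.
Variable x : L.
Hypothesis basis : forall u, exists w : 'I_p -> L, u = \sum_(i < p) w i ^+ p * x ^+ i.

Lemma shifted_basis (c : K) (u : L) :
  exists w : 'I_p -> L, u = \sum_(i < p) w i ^+ p * (x - iota c) ^+ i.
Proof.
have [W szW ->] := frob_poly_ex iota pK basis u.
have [b bc] := closed_nth_root c p0.
(* The Frobenius twist of [X + b] is [X + c], as [b^p = c]. *)
pose W' := W \Po ('X + (iota b)%:P).
have szW' : (size W' <= p)%N by rewrite size_comp_poly2 ?size_XaddC.
exists (fun i : 'I_p => W'`_i).
transitivity ((map_poly (pFrobenius_aut (etrans (fmorph_pchar iota p) pK)) W').[x - iota c]).
  rewrite map_comp_poly rmorphD /= map_polyX map_polyC /= pFrobenius_autE -rmorphXn bc.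
  by rewrite horner_comp !hornerE subrK; congr (_.[x]); apply: eq_map_poly => a; rewrite !pFrobenius_autE.
rewrite (horner_coef_wide _ (_ : (size _ <= p)%N)) ?size_map_poly //.
by apply: eq_bigr => i _; rewrite coef_map /= pFrobenius_autE.
Qed.

End Shift.
End LogDerivativeOrders.

(** * Smooth points of a plane model *)

Section PlaneEvaluation.
Variables (K : closedFieldType) (L : fieldType) (jota : {rmorphism K -> L}).

(** A composite of ring morphisms, like [ev2] and [pt2], so that the morphism structure is
    inherited. *)
Definition ev1 (x : L) : {poly K} -> L := horner_eval x \o map_poly jota.
HB.instance Definition _ (x : L) := GRing.RMorphism.on (ev1 x).

Definition ev2 (x t : L) : {poly {poly K}} -> L :=
  horner_eval x \o (horner_eval t%:P \o map_poly (map_poly jota)).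
HB.instance Definition _ (x t : L) := GRing.RMorphism.on (ev2 x t).

Definition pt2 (c b : K) : {poly {poly K}} -> K := horner_eval c \o horner_eval b%:P.
HB.instance Definition _ (c b : K) := GRing.RMorphism.on (pt2 c b).

Lemma ev1C x c : ev1 x c%:P = jota c.
Proof. by rewrite /ev1 /= map_polyC /horner_eval hornerC. Qed.

Lemma ev1X x : ev1 x 'X = x.
Proof. by rewrite /ev1 /= map_polyX /horner_eval hornerX. Qed.

Lemma ev1_XsubC x c : ev1 x ('X - c%:P) = x - jota c.
Proof. by rewrite rmorphB /= ev1C ev1X. Qed.

Lemma ev2C x t g : ev2 x t g%:P = ev1 x g.
Proof. by rewrite /ev2 /= map_polyC /horner_eval hornerC. Qed.

Lemma ev2X x t : ev2 x t 'X = t.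
Proof. by rewrite /ev2 /= map_polyX /horner_eval hornerX hornerC. Qed.

Lemma pt2C c b g : pt2 c b g%:P = g.[c].
Proof. by rewrite /pt2 /= /horner_eval hornerC. Qed.

Lemma pt2X c b : pt2 c b 'X = b.
Proof. by rewrite /pt2 /= /horner_eval hornerX hornerC. Qed.

Lemma ev2B x t P Q : ev2 x t (P - Q) = ev2 x t P - ev2 x t Q.
Proof. exact: rmorphB. Qed.

Lemma ev2E x t g : ev2 x t g = \sum_(i < size g) ev1 x g`_i * t ^+ i.
Proof.
rewrite -{1}[g]coefK poly_def rmorph_sum; apply: eq_bigr => i _.
by rewrite -mul_polyC rmorphM rmorphXn /= ev2C ev2X.
Qed.

Lemma ev2_comp x t (q : {poly {poly K}}) g :
  ev2 x t (q \Po g) = (map_poly (ev1 x) q).[ev2 x t g].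
Proof.
elim/poly_ind: q => [|q c IH]; first by rewrite comp_poly0 !rmorph0 horner0.
rewrite comp_poly_MXaddC rmorphD rmorphM /= IH ev2C rmorphD rmorphM /= map_polyX map_polyC.
by rewrite !hornerE.
Qed.

Lemma pt2_ideal c b g : exists r1 r2,
  g = (pt2 c b g)%:P%:P + ('X - c%:P)%:P * r1 + ('X - b%:P%:P) * r2.
Proof.
have /factor_theorem[r2 E2] : root (g - g.[b%:P]%:P) b%:P by rewrite rootE !hornerE subrr.
have /factor_theorem[r1 E1] : root (g.[b%:P] - (g.[b%:P].[c])%:P) c by rewrite rootE !hornerE subrr.
have Eg : g = r2 * ('X - b%:P%:P) + g.[b%:P]%:P by rewrite -E2 subrK.
have Eb : g.[b%:P] = r1 * ('X - c%:P) + (g.[b%:P].[c])%:P by rewrite -E1 subrK.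
by exists r1%:P, r2; rewrite /pt2 /= /horner_eval [in LHS]Eg {1}Eb rmorphD rmorphM /=; ring.
Qed.

Section Model.
Variables (x t : L) (m : nat) (f : {poly K}).
Hypotheses (m0 : (0 < m)%N) (tm : t ^+ m = ev1 x f).

Lemma ev2_integral g : integralOver (ev1 x) (ev2 x t g).
Proof.
have int_t : integralOver (ev1 x) t.
  exists ('X^m - f%:P); first by apply: monicXnsubC.
  by rewrite /root rmorphB /= map_polyXn map_polyC !hornerE /= tm subrr.
rewrite ev2E; elim/big_ind: _ => [|u v|i _].
- exact: integral0.
- exact: integral_add.
apply: integral_mul; first exact: integral_id.
elim: (nat_of_ord i) => [|n IH]; first exact: integral1.
by rewrite exprS; apply: integral_mul.
Qed.

(** In a monic equation [q1 X + c] of [g] over K[x], the constant term is [g] times [- q1(g)]. If it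
    is 0, then [q1] is a shorter equation. *)
Lemma ev2_norm g : ev2 x t g != 0 ->
  exists g' R, ev1 x R != 0 /\ ev2 x t (g * g') = ev1 x R.
Proof.
move=> g0; have [q mq rq] := ev2_integral g; have [n] := ubnP (size q).
elim: n q mq rq => // n IH q mq rq szq.
have [q1 [c qE]] : exists q1 c, q = q1 * 'X + c%:P.
  by elim/poly_ind: (q) => [|q1 c _]; [exists 0, 0; rewrite mul0r add0r | exists q1, c].
have [c0|c0] := eqVneq (ev1 x c) 0; last first.
  exists (- (q1 \Po g)), c; split=> //.
  rewrite mulrN rmorphN rmorphM /= ev2_comp; apply/eqP; rewrite eq_sym -addr_eq0 addrC.
  move: rq; rewrite /root qE rmorphD rmorphM /= map_polyX map_polyC !hornerE.
  by rewrite mulrC.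
have q10 : q1 != 0.
  apply/eqP => q10; move: mq; rewrite qE q10 mul0r add0r monicE lead_coefC => /eqP c1.
  by move/eqP: c0; rewrite c1 rmorph1 oner_eq0.
have szq1 : size q = (size q1).+1 by rewrite qE size_MXaddC (negPf q10).
apply: (IH q1).
- rewrite monicE; move: mq; rewrite monicE qE lead_coefDl ?lead_coefMX //.
  by rewrite size_mulX // (leq_ltn_trans (size_polyC_leq1 _)) // ltnS size_poly_gt0.
- move: rq; rewrite /root qE rmorphD rmorphM /= map_polyX map_polyC /= c0 !hornerE.
  by rewrite mulf_eq0 (negPf g0) orbF.
- by rewrite -ltnS -szq1.
Qed.

Section SmoothPoint.
Variables (c b : K).
Hypothesis xc : x != jota c.
Hypothesis h_ev : forall g, ev2 x t g = 0 -> pt2 c b g = 0.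
Hypothesis h_rat : forall u, exists g1 g2, ev2 x t g2 != 0 /\ u = ev2 x t g1 / ev2 x t g2.
(** [T] is a uniformiser at [(c, b)]: up to [e], a unit there, it divides [X - c] and [Y - b]. By
    [eM], [X - c] is [T^M] up to units. *)
Variables (T e q1 q2 e1 e2 : {poly {poly K}}) (M : nat).
Hypotheses (T0 : pt2 c b T = 0) (e0 : pt2 c b e != 0).
Hypothesis eX : ev2 x t (e * ('X - c%:P)%:P) = ev2 x t (T * q1).
Hypothesis eY : ev2 x t (e * ('X - b%:P%:P)) = ev2 x t (T * q2).
Hypotheses (e10 : pt2 c b e1 != 0) (e20 : pt2 c b e2 != 0).
Hypothesis eM : ev2 x t (e1 * ('X - c%:P)%:P) = ev2 x t (T ^+ M * e2).

Local Notation ev := (ev2 x t).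
Local Notation pt := (pt2 c b).

Let ev_neq0 g : pt g != 0 -> ev g != 0.
Proof. by apply: contra_neq; apply: h_ev. Qed.

Let pt_eq g h : ev g = ev h -> pt g = pt h.
Proof.
move=> E; have := h_ev (g := g - h); rewrite !rmorphB /= E subrr => /(_ erefl)/eqP.
by rewrite subr_eq0 => /eqP.
Qed.

Let evT0 : ev T != 0.
Proof.
apply/eqP => ET; move/eqP: eX; rewrite !rmorphM /= ET mul0r mulf_eq0 (negPf (ev_neq0 e0)) /=.
by rewrite ev2C ev1_XsubC subr_eq0 (negPf xc).
Qed.

(** As long as the cofactor vanishes at the point, it lies in the ideal of [X - c] and [Y - b], and
    multiplication by [e] brings out one more [T]. *)
Let descent g k : (exists s h n, [/\ pt s != 0, pt h != 0 & ev (s * g) = ev (T ^+ n * h)])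
  \/ exists h, ev (e ^+ k * g) = ev (T ^+ k * h).
Proof.
elim: k => [|k [ex|[h E]]]; first by right; exists g.
  by left.
have [h0|h0] := eqVneq (pt h) 0; last first.
  by left; exists (e ^+ k), h, k; rewrite rmorphXn expf_neq0.
right; have [r1 [r2]] := pt2_ideal c b h; rewrite h0 !polyC0 add0r => hE.
exists (q1 * r1 + q2 * r2).
rewrite exprS -mulrA [LHS]rmorphM /= E exprS {1}hE.
transitivity (ev T ^+ k * (ev (e * ('X - c%:P)%:P) * ev r1 + ev (e * ('X - b%:P%:P)) * ev r2)).
  by rewrite !(rmorphM, rmorphD, rmorphXn) /=; ring.
by rewrite eX eY !(rmorphM, rmorphD, rmorphXn) /=; ring.
Qed.

(* The descent stops because the norm of g, a polynomial in x, vanishes to finite order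
   at c. *)
Let local_form g : ev g != 0 ->
  exists s h n, [/\ pt s != 0, pt h != 0 & ev (s * g) = ev (T ^+ n * h)].
Proof.
move=> g0; have [g' [R [R0 E]]] := ev2_norm g0.
have nzR : R != 0 by apply: contraNneq R0 => ->; rewrite rmorph0.
have [n [R' R'c RE]] := multiplicity_XsubC R c.
rewrite nzR /root in R'c.
have [//|[h Eh]] := descent g (M * n).+1; exfalso.
have TMn : ev T ^+ (M * n) != 0 by rewrite expf_neq0.
have key : ev (e ^+ (M * n).+1 * e2 ^+ n * R'%:P) = ev (T * (h * g' * e1 ^+ n)).
  apply: (mulfI TMn).
  transitivity (ev (e ^+ (M * n).+1 * g) * ev g' * ev e1 ^+ n).
    have -> : ev (e ^+ (M * n).+1 * g) * ev g' = ev e ^+ (M * n).+1 * ev (g * g').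
      by rewrite !(rmorphM, rmorphXn) /=; ring.
    have ER : ev1 x R = ev R'%:P * ev ('X - c%:P)%:P ^+ n.
      by rewrite RE rmorphM rmorphXn /= -!(ev2C x t).
    rewrite E ER.
    transitivity (ev e ^+ (M * n).+1 * ev R'%:P * ev (T ^+ M * e2) ^+ n); last first.
      by rewrite -eM !(rmorphM, rmorphXn) /= exprMn; ring.
    by rewrite !(rmorphM, rmorphXn) /= exprMn -exprM; ring.
  by rewrite Eh !(rmorphM, rmorphXn) /= exprS; ring.
have := pt_eq key; rewrite !rmorphM /= T0 mul0r !rmorphXn /= pt2C => /eqP.
by rewrite !mulf_eq0 !expf_eq0 (negPf e0) (negPf e20) (negPf R'c) !andbF.
Qed.

(** [u] is [T^k] times a unit of the local ring at the point, so [k] is to be its order. *)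
Let rep u k := exists s h, [/\ pt s != 0, pt h != 0 & ev s * u = ev T ^ k * ev h].

Let rep_ex u : u != 0 -> exists k : int, rep u k.
Proof.
move=> u0; have [g1 [g2 [g20 uE]]] := h_rat u.
have g10 : ev g1 != 0 by apply: contra_neq u0 => g10; rewrite uE g10 mul0r.
have [s1 [h1 [n1 [s10 h10 E1]]]] := local_form g10.
have [s2 [h2 [n2 [s20 h20 E2]]]] := local_form g20.
exists (n1%:Z - n2%:Z), (s1 * h2), (s2 * h1); rewrite !rmorphM !mulf_neq0 //; split=> //=.
apply: (mulfI g20); rewrite uE [LHS](_ : _ = ev h2 * (ev s1 * ev g1)); last by field.
have -> : ev g2 * (ev T ^ (n1%:Z - n2%:Z) * (ev s2 * ev h1))
    = ev T ^ (n1%:Z - n2%:Z) * ev h1 * (ev s2 * ev g2) by ring.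
have -> : ev s1 * ev g1 = ev T ^+ n1 * ev h1 by move: E1; rewrite !rmorphM rmorphXn.
have -> : ev s2 * ev g2 = ev T ^+ n2 * ev h2 by move: E2; rewrite !rmorphM rmorphXn.
rewrite expfzDr // -exprnN -exprnP.
have Tn2 : ev T ^+ n2 != 0 by rewrite expf_neq0.
by field.
Qed.

Let rep_le u k k' : rep u k -> rep u k' -> k' <= k.
Proof.
case=> s [h [s0 h0 E]] [s' [h' [s'0 h'0 E']]]; rewrite leNgt; apply/negP => kk'.
have [n kE] : exists n : nat, k' = k + n.+1%:Z by exists (absz (k' - k - 1)%R); lia.
have Tk : ev T ^ k != 0 by rewrite expfz_neq0.
have key : ev (s' * h) = ev (T * (T ^+ n * s * h')).
  apply: (mulfI Tk); transitivity (ev s' * (ev s * u)); first by rewrite E rmorphM /=; ring.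
  transitivity (ev s * (ev s' * u)); first by ring.
  by rewrite E' kE expfzDr // -exprnP exprS !(rmorphM, rmorphXn) /=; ring.
have := pt_eq key; rewrite !rmorphM /= T0 mul0r => /eqP.
by rewrite mulf_eq0 (negPf s'0) (negPf h0).
Qed.

Let rep_uniq u k k' : rep u k -> rep u k' -> k = k'.
Proof. by move=> r r'; apply/eqP; rewrite eq_le (rep_le r r') (rep_le r' r). Qed.

Let rep_mul u v k k' : rep u k -> rep v k' -> rep (u * v) (k + k').
Proof.
case=> s [h [s0 h0 E]] [s' [h' [s'0 h'0 E']]].
exists (s * s'), (h * h'); rewrite !rmorphM !mulf_neq0 //; split=> //=.
by rewrite mulrACA E E' expfzDr // mulrACA.
Qed.

Let rep_add u v k (n : nat) : rep u k -> rep v (k + n%:Z) -> u + v != 0 ->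
  exists j : nat, rep (u + v) (k + j%:Z).
Proof.
case=> s [h [s0 h0 E]] [s' [h' [s'0 h'0 E']]] uv0.
pose w := s' * h + T ^+ n * s * h'.
have Ew : ev (s * s') * (u + v) = ev T ^ k * ev w.
  transitivity (ev s' * (ev s * u) + ev s * (ev s' * v)); first by rewrite rmorphM /=; ring.
  rewrite E E' expfzDr // -exprnP !(rmorphM, rmorphXn, rmorphD) /=.
  by move: (_ ^ k) => z; ring.
have w0 : ev w != 0.
  apply: contraNneq uv0 => w0; move/eqP: Ew; rewrite w0 mulr0 mulf_eq0.
  by rewrite rmorphM mulf_eq0 !(negPf (ev_neq0 _)).
have [s2 [h2 [j [s20 h20 E2]]]] := local_form w0; exists j.
exists (s2 * (s * s')), h2; rewrite !rmorphM !mulf_neq0 //; split=> //=.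
rewrite -mulrA -rmorphM /= Ew mulrCA -rmorphM /= E2 rmorphM rmorphXn /=.
by rewrite expfzDr // -exprnP mulrA.
Qed.

Let rep_const a : a != 0 -> rep (jota a) 0.
Proof.
move=> a0; exists 1, a%:P%:P; rewrite !rmorph1 oner_neq0 pt2C hornerC ev2C ev1C; split=> //.
Qed.

Let ordT u : int := if pselect (u != 0) is left u0 then sval (cid (rep_ex u0)) else 0.

Let ordT_rep u : u != 0 -> rep u (ordT u).
Proof. by rewrite /ordT; case: pselect => // u0 _; case: cid. Qed.

Let ordTE u k : u != 0 -> rep u k -> ordT u = k.
Proof. by move=> u0; apply: rep_uniq; apply: ordT_rep. Qed.

Let ordT_mul u v : u != 0 -> v != 0 -> ordT (u * v) = ordT u + ordT v.
Proof.
move=> u0 v0; apply: ordTE; first by rewrite mulf_neq0.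
by apply: rep_mul; apply: ordT_rep.
Qed.

Let ordT_add u v : u != 0 -> v != 0 -> u + v != 0 -> Num.min (ordT u) (ordT v) <= ordT (u + v).
Proof.
wlog le : u v / ordT u <= ordT v => [hw|] u0 v0 uv0.
  case/orP: (le_total (ordT u) (ordT v)) => l; first exact: hw.
  by rewrite minC addrC; apply: hw => //; rewrite addrC.
rewrite (min_idPl le); have [n nE] : exists n : nat, ordT v = ordT u + n%:Z.
  by exists (absz (ordT v - ordT u)%R); lia.
have := ordT_rep v0; rewrite nE => rv.
have [j rj] := rep_add (ordT_rep u0) rv uv0.
by rewrite (ordTE uv0 rj); lia.
Qed.

Let ordT_const a : ordT (jota a) = 0.
Proof.
have [->|a0] := eqVneq a 0; last by apply: ordTE; [rewrite fmorph_eq0 | exact: rep_const].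
by rewrite rmorph0 /ordT; case: pselect => // n0; exfalso; move: n0; rewrite eqxx.
Qed.

Let ordT_unif : exists2 u, u != 0 & ordT u = 1.
Proof.
exists (ev T) => //; apply: ordTE => //.
by exists 1, 1; rewrite !rmorph1 oner_neq0 expr1z mulr1 mul1r.
Qed.

Lemma smooth_point_place : exists P : place jota,
  P (x - jota c) = M%:Z /\ ord_ge P 1 (t - jota b).
Proof.
pose P := Place ordT_mul ordT_add ordT_const ordT_unif; exists P; split.
  apply: ordTE; first by rewrite subr_eq0.
  exists e1, e2; split=> //; rewrite -ev1_XsubC -(ev2C x t) -rmorphM /= eM.
  by rewrite rmorphM rmorphXn.
rewrite /ord_ge; have [//|tb0] /= := eqVneq (t - jota b) 0.
have evY : ev ('X - b%:P%:P) = t - jota b by rewrite rmorphB /= ev2X ev2C ev1C.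
have [s [h [n [s0 h0 E]]]] := local_form (g := 'X - b%:P%:P) (eq_rect _ (fun v => v != 0) tb0 _ (esym evY)).
have -> : ordT (t - jota b) = n%:Z.
  apply: ordTE => //; exists s, h; split=> //.
  by rewrite -evY -rmorphM /= E rmorphM rmorphXn.
rewrite lez_nat lt0n; apply/eqP => n0; have := pt_eq E.
rewrite n0 expr0 mul1r rmorphM /= [pt ('X - _)](_ : _ = 0) ?mulr0 => [/esym/eqP|].
  by rewrite (negPf h0).
by rewrite rmorphB /= pt2X pt2C hornerC subrr.
Qed.

Let ord_ge1_pt (P : place jota) g : 0 < P (x - jota c) -> ord_ge P 1 (t - jota b) ->
  ord_ge P 1 (ev g - jota (pt g)).
Proof.
move=> Px Pt; have x_ge : ord_ge P 0 x.
  rewrite -[x](subrK (jota c)) ord_geD ?ord_ge_const // ord_geE ?subr_eq0 //; exact: ltW.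
have t_ge : ord_ge P 0 t.
  by rewrite -[t](subrK (jota b)) ord_geD ?ord_ge_const // (ord_ge_trans _ Pt).
have ev_ge h : ord_ge P 0 (ev h).
  rewrite ev2E; apply: ord_ge_sum => i _; rewrite -[0]addr0 ord_geM //.
    exact: ord_ge_horner.
  elim: (nat_of_ord i) => [|n IH]; first by rewrite expr0 -(rmorph1 jota) ord_ge_const.
  by rewrite exprS -[0]addr0 ord_geM.
have [r1 [r2 gE]] := pt2_ideal c b g.
have -> : ev g - jota (pt g) = (x - jota c) * ev r1 + (t - jota b) * ev r2.
  have evY : ev ('X - b%:P%:P) = t - jota b by rewrite rmorphB /= ev2X ev2C ev1C.
  rewrite [in ev g]gE 2!rmorphD 2!rmorphM /= evY !ev2C ev1C ev1_XsubC.
  by ring.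
by rewrite -[1]addr0 ord_geD // ord_geM // ord_geE ?subr_eq0 //; move: Px; clear; lia.
Qed.

(** Units at the point have order 0 at any place centred there, so such a place is a multiple of the
    order along [T]; being normalised, it is equal to it. *)
Lemma smooth_point_place_uniq (P Q : place jota) :
  0 < P (x - jota c) -> ord_ge P 1 (t - jota b) ->
  0 < Q (x - jota c) -> ord_ge Q 1 (t - jota b) -> P = Q.
Proof.
have unit (P0 : place jota) g : 0 < P0 (x - jota c) -> ord_ge P0 1 (t - jota b) ->
    pt g != 0 -> P0 (ev g) = 0.
  move=> Px Pt g0; have := ord_ge1_pt g Px Pt; have jg0 : jota (pt g) != 0 by rewrite fmorph_eq0.
  move=> h; have := @ord_addl _ _ _ P0 _ (ev g - jota (pt g)) jg0.
  by rewrite place_const add0r => /(_ h)/andP[_]; rewrite addrC subrK => /eqP.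
have ordE (P0 : place jota) u : 0 < P0 (x - jota c) -> ord_ge P0 1 (t - jota b) ->
    u != 0 -> P0 u = ordT u * P0 (ev T).
  move=> Px Pt u0; have [s [h [s0 h0 E]]] := ordT_rep u0.
  have := congr1 P0 E; rewrite (place_mul P0 (ev_neq0 s0) u0) (place_mul P0 (expfz_neq0 _ evT0) (ev_neq0 h0)).
  rewrite (unit _ _ Px Pt s0) (unit _ _ Px Pt h0) add0r addr0 => ->.
  by case: (ordT u) => n; rewrite ?NegzE -?exprnN -?exprnP ?ordV ordX ?mulNr.
have ordT1 (P0 : place jota) : 0 < P0 (x - jota c) -> ord_ge P0 1 (t - jota b) -> P0 (ev T) = 1.
  move=> Px Pt; have := ord_ge1_pt T Px Pt; rewrite T0 rmorph0 subr0 ord_geE //.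
  have [u u0 Pu] := place_unif P0; move: Pu; rewrite ordE // => E1.
  have [k0|[k0|k0]] : ordT u = 0 \/ (1 <= ordT u \/ ordT u <= -1) by lia.
  - by move: E1; rewrite k0 mul0r.
  - by nia.
  - by nia.
move=> Px Pt Qx Qt; apply: placeP => u; have [->|u0] := eqVneq u 0; first by rewrite !ord0.
by rewrite (ordE P u Px Pt u0) (ordE Q u Qx Qt u0) (ordT1 P Px Pt) (ordT1 Q Qx Qt).
Qed.

End SmoothPoint.
End Model.
End PlaneEvaluation.

(** * Change of plane model, and the place at a simple root *)

Section RationalChange.
Variables (K : closedFieldType) (L : fieldType) (jota : {rmorphism K -> L}).

Definition is_ratio (x t u : L) : Prop :=
  exists g1 g2, ev2 jota x t g2 != 0 /\ u = ev2 jota x t g1 / ev2 jota x t g2.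

Section Closure.
Variables (x t : L).
Local Notation Rat := (is_ratio x t).

Lemma is_ratio_ev2 g : Rat (ev2 jota x t g).
Proof. by exists g, 1; rewrite rmorph1 oner_neq0 divr1. Qed.

Lemma is_ratioD u v : Rat u -> Rat v -> Rat (u + v).
Proof.
move=> [g1 [g2 [g20 ->]]] [h1 [h2 [h20 ->]]]; exists (g1 * h2 + h1 * g2), (g2 * h2).
by rewrite !(rmorphM, rmorphD) mulf_neq0 //=; split=> //; field; rewrite g20 h20.
Qed.

Lemma is_ratioM u v : Rat u -> Rat v -> Rat (u * v).
Proof.
move=> [g1 [g2 [g20 ->]]] [h1 [h2 [h20 ->]]]; exists (g1 * h1), (g2 * h2).
by rewrite !rmorphM mulf_neq0 //=; split=> //; field; rewrite g20 h20.
Qed.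

Lemma is_ratioV u : Rat u -> Rat u^-1.
Proof.
move=> [g1 [g2 [g20 ->]]]; have [E|g10] := eqVneq (ev2 jota x t g1) 0.
  by rewrite E mul0r invr0 -(rmorph0 (ev2 jota x t)); apply: is_ratio_ev2.
by exists g2, g1; rewrite invf_div.
Qed.

Lemma is_ratio_const c : Rat (jota c).
Proof. by have := is_ratio_ev2 c%:P%:P; rewrite ev2C ev1C. Qed.

Lemma is_ratioX u n : Rat u -> Rat (u ^+ n).
Proof.
move=> ru; elim: n => [|n IH]; first by rewrite expr0 -(rmorph1 jota); apply: is_ratio_const.
by rewrite exprS; apply: is_ratioM.
Qed.

Lemma is_ratio_ev1 u g : Rat u -> Rat (ev1 jota u g).
Proof.
move=> ru; elim/poly_ind: g => [|g c IH].
  by rewrite rmorph0 -(rmorph0 jota); apply: is_ratio_const.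
by rewrite rmorphD rmorphM /= ev1X ev1C; apply: is_ratioD (is_ratio_const _); apply: is_ratioM.
Qed.

End Closure.

Lemma is_ratio_change (x y x' t u : L) :
  is_ratio x' t x -> is_ratio x' t y -> is_ratio x y u -> is_ratio x' t u.
Proof.
move=> rx ry [g1 [g2 [_ ->]]].
suff r g : is_ratio x' t (ev2 jota x y g) by apply: is_ratioM => //; apply: is_ratioV.
elim/poly_ind: g => [|g c IH]; first by rewrite rmorph0 -(rmorph0 jota); apply: is_ratio_const.
rewrite rmorphD rmorphM /= ev2X ev2C; apply: is_ratioD; last exact: is_ratio_ev1.
exact: is_ratioM.
Qed.

Lemma ev1_inj (x : L) : (forall c, x != jota c) -> forall R, ev1 jota x R = 0 -> R = 0.
Proof.
move=> xc R; have [r ->] := closed_field_poly_normal R; move: (lead_coef R) => a.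
have [->|a0] := eqVneq a 0; first by rewrite scale0r.
rewrite -mul_polyC rmorphM rmorph_prod /= ev1C => /eqP.
rewrite mulf_eq0 fmorph_eq0 (negPf a0) /= => /eqP E; exfalso; move/eqP: E; apply/negP.
elim/big_rec: _ => [|c v _ v0]; first exact: oner_neq0.
by rewrite mulf_neq0 // ev1_XsubC subr_eq0.
Qed.

Section SmoothZero.
Variables (x t : L) (m : nat) (c : K) (g1 : {poly K}).
Hypotheses (m0 : (0 < m)%N) (xc : forall c, x != jota c).
Hypothesis tm : t ^+ m = ev1 jota x (('X - c%:P) * g1).
Hypothesis g1c : g1.[c] != 0.
Hypothesis rat : forall u, is_ratio x t u.

(** K[x] is integrally closed: clearing denominators in an equation of [v = B / A] leaves [B^n] plus
    multiples of [A], to be evaluated at [c]. *)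
Let integral_normal (A B : {poly K}) (v : L) : A.[c] = 0 -> B.[c] != 0 ->
  integralOver (ev1 jota x) v -> ev1 jota x A * v = ev1 jota x B -> False.
Proof.
move=> Ac Bc [q mq rq] E; pose n := (size q).-1.
have szq : size q = n.+1 by rewrite prednK // size_poly_gt0 monic_neq0.
pose S := \sum_(i < n.+1) q`_i * A ^+ (n - i) * B ^+ i.
have S0 : S = 0.
  apply: (ev1_inj xc); rewrite rmorph_sum /=.
  transitivity (ev1 jota x A ^+ n * (map_poly (ev1 jota x) q).[v]); last first.
    by rewrite (rootP rq) mulr0.
  rewrite (@horner_coef_wide _ n.+1) ?size_poly // -?szq ?size_poly // szq.
  rewrite mulr_sumr; apply: eq_bigr => i _; rewrite coef_map !rmorphM !rmorphXn /= -E exprMn.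
  have -> : ev1 jota x A ^+ n = ev1 jota x A ^+ (n - i) * ev1 jota x A ^+ i.
    by rewrite -exprD subnK // -ltnS.
  by move: (_ ^+ (n - i)) (_ ^+ i) (v ^+ i) => ? ? ?; ring.
have := congr1 (horner^~ c) S0; rewrite /S horner0 horner_sum big_ord_recr /= subnn expr0 mulr1.
rewrite big1 ?add0r => [|i _]; last first.
  by rewrite !hornerE Ac expr0n subn_eq0 leqNgt ltn_ord mulr0 mul0r.
have -> : q`_n = 1 by move: mq; rewrite monicE lead_coefE => /eqP.
by rewrite mul1r horner_exp => /eqP; rewrite expf_eq0 (negPf Bc) andbF.
Qed.

(** The ideal of relations between [x] and [t] is not given, only the value of [t^m]. If [g] did not
    vanish at [(c, 0)], a nonzero multiple of [g1] would be divisible by [t], and its m-th power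
    would contradict [integral_normal]. *)
Let zero_ev g : ev2 jota x t g = 0 -> pt2 c 0 g = 0.
Proof.
move=> E; apply/eqP/negPn/negP; set g00 := pt2 c 0 g => g000.
have [r1 [r2 gE]] := pt2_ideal c 0 g.
pose W := 'X^(m.-1) * r1 + g1%:P * r2.
have key : ev1 jota x (- g00 *: g1) = t * ev2 jota x t W.
  have : jota g00 + ((x - jota c) * ev2 jota x t r1 + t * ev2 jota x t r2) = 0.
    rewrite -[RHS]E [in RHS]gE 2!rmorphD 2!rmorphM /= !ev2C ev1C ev1_XsubC !polyC0 subr0 ev2X.
    by rewrite addrA.
  move/eqP; rewrite addr_eq0 => /eqP E'.
  rewrite -mul_polyC rmorphM /= ev1C rmorphN /= E' opprK rmorphD !rmorphM /= rmorphXn /= ev2X ev2C.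
  rewrite [RHS]mulrDr mulrA -exprS prednK // tm rmorphM /= ev1_XsubC.
  by ring.
apply: (@integral_normal (('X - c%:P) * g1) ((- g00 *: g1) ^+ m) (ev2 jota x t (W ^+ m))).
- by rewrite !hornerE subrr mul0r.
- by rewrite horner_exp expf_neq0 // hornerZ mulf_neq0 // oppr_eq0.
- exact: ev2_integral m0 tm _.
by rewrite !rmorphXn /= key exprMn tm.
Qed.

Let T0 : pt2 c 0 ('X : {poly {poly K}}) = 0. Proof. exact: pt2X. Qed.
Let e0 : pt2 c 0 g1%:P != 0. Proof. by rewrite pt2C. Qed.
Let eX : ev2 jota x t (g1%:P * ('X - c%:P)%:P) = ev2 jota x t ('X * 'X^(m.-1)).
Proof. by rewrite -exprS prednK // rmorphXn /= ev2X tm -rmorphM /= ev2C mulrC. Qed.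
Let eY : ev2 jota x t (g1%:P * ('X - 0%:P%:P)) = ev2 jota x t ('X * g1%:P).
Proof. by rewrite !polyC0 subr0 mulrC. Qed.
Let one0 : pt2 c 0 1 != 0. Proof. by rewrite rmorph1 oner_neq0. Qed.
Let eM : ev2 jota x t (g1%:P * ('X - c%:P)%:P) = ev2 jota x t ('X ^+ m * 1).
Proof. by rewrite eX -exprS prednK // mulr1. Qed.

Lemma smooth_zero_place : exists P : place jota, P (x - jota c) = m%:Z.
Proof.
by have [P []] := smooth_point_place m0 tm (xc c) zero_ev rat T0 e0 eX eY e0 one0 eM; exists P.
Qed.

Lemma smooth_zero_place_uniq (P Q : place jota) :
  0 < P (x - jota c) -> 0 < P t -> 0 < Q (x - jota c) -> 0 < Q t -> P = Q.
Proof.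
have ge (P0 : place jota) : 0 < P0 t -> ord_ge P0 1 (t - jota 0).
  by move=> Pt; rewrite rmorph0 subr0 /ord_ge; apply/orP; right; lia.
move=> Px /ge Pt Qx /ge Qt.
exact: (smooth_point_place_uniq m0 tm (xc c) zero_ev rat T0 e0 eX eY e0 one0 eM Px Pt Qx Qt).
Qed.

End SmoothZero.
End RationalChange.

Lemma prime_modn_inverse (m a b : nat) : prime m -> ~~ (m %| a)%N -> exists k, (k * a = b %[mod m])%N.
Proof.
move=> m_pr ma; have cop : coprime a m by rewrite coprime_sym prime_coprime.
have a0 : (0 < a)%N by case: a ma {cop} => //; rewrite dvdn0.
case: (egcdnP m a0) => k l E _.
by exists (k * b)%N; rewrite mulnAC E (eqP cop) mulnDl mul1n mulnAC modnMDl.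
Qed.

Lemma ev2_kummer (K : closedFieldType) (L : fieldType) (jota : {rmorphism K -> L}) x y m g :
  ev2 jota x y ('X^m - g%:P) = y ^+ m - ev1 jota x g.
Proof. by rewrite ev2B rmorphXn /= ev2X ev2C. Qed.

(** * The curve y^m = f(x) *)

Section Curve.
Variables (K : closedFieldType) (L : fieldType) (jota : {rmorphism K -> L}) (x y : L).
Variables (m d : nat) (a : 'I_d -> nat) (c : 'I_d -> K).
Hypotheses (m_pr : prime m) (mK : m%:R != 0 :> K).
Hypotheses (ha : forall i, (1 <= a i < m)%N) (hasum : ~~ (m %| \sum_(i < d) a i)%N).
Hypothesis c_inj : injective c.

Definition branch_poly (e : 'I_d -> nat) : {poly K} := \prod_(i < d) ('X - (c i)%:P) ^+ e i.
Local Notation f := (branch_poly a).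
Hypothesis hL : is_function_field jota ('X^m - f%:P) x y.

Local Notation ev1 := (ev1 jota).
Local Notation ev2 := (ev2 jota).

Let m0 : (0 < m)%N := prime_gt0 m_pr.
Let h : {poly {poly K}} := 'X^m - f%:P.

Lemma branch_polyM e e' : branch_poly e * branch_poly e' = branch_poly (fun i => e i + e' i)%N.
Proof. by rewrite /branch_poly -big_split; apply: eq_bigr => i _; rewrite exprD. Qed.

Lemma branch_polyX e n : branch_poly e ^+ n = branch_poly (fun i => e i * n)%N.
Proof. by rewrite /branch_poly -prodrXl; apply: eq_bigr => i _; rewrite exprM. Qed.

Lemma branch_poly_monic e : branch_poly e \is monic.
Proof. by apply: monic_prod => i _; rewrite monic_exp ?monicXsubC. Qed.

Lemma root_branch_poly e b : root (branch_poly e) b -> exists i, b = c i.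
Proof.
rewrite /root horner_prod prodf_seq_eq0 => /hasP[i _] /=.
by rewrite horner_exp expf_eq0 !hornerE subr_eq0 => /andP[_ /eqP->]; exists i.
Qed.

Lemma root_branch_polyE e i : root (branch_poly e) (c i) = (0 < e i)%N.
Proof.
apply/idP/idP; last first.
  move=> ei; rewrite /root horner_prod (bigD1 i) //= horner_exp !hornerE subrr expr0n.
  by rewrite gtn_eqF // mul0r.
rewrite /root horner_prod prodf_seq_eq0 => /hasP[j _] /=.
by rewrite horner_exp expf_eq0 !hornerE subr_eq0 => /andP[ej /eqP /c_inj ij]; rewrite ij.
Qed.

Lemma mup_branch_poly e i : mup (c i) (branch_poly e) = e i.
Proof.
rewrite /branch_poly (bigD1 i) //= mupMl.
  by rewrite mup_XsubCX eqxx.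
apply/negP; rewrite /root horner_prod prodf_seq_eq0 => /hasP[j _] /=.
case/andP=> ji; rewrite horner_exp expf_eq0 !hornerE subr_eq0 => /andP[_ /eqP /c_inj ij].
by rewrite ij eqxx in ji.
Qed.

Lemma size_branch_poly e : size (branch_poly e) = (\sum_(i < d) e i).+1.
Proof.
rewrite /branch_poly size_prod => [|i _]; last by rewrite expf_neq0 // polyXsubC_eq0.
rewrite (eq_bigr (fun i => (e i + 1)%N)) => [|i _]; last by rewrite size_exp_XsubC addn1.
by rewrite big_split /= sum1_card -addSn addnK.
Qed.

Lemma curve_ker g : ev2 x y g = 0 <-> exists q, g = q * h.
Proof. by have [H _] := hL; exact: H. Qed.

Let hm : h \is monic. Proof. exact: monicXnsubC. Qed.
Let szh : size h = m.+1. Proof. by rewrite size_XnsubC. Qed.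

Lemma curve_ev2_small (g : {poly {poly K}}) : (size g <= m)%N -> ev2 x y g = 0 -> g = 0.
Proof.
move=> szg /curve_ker[q gE]; move: szg; rewrite gE; have [->|q0] := eqVneq q 0; first by rewrite mul0r.
by rewrite size_Mmonic // szh addnS /= -[X in (_ <= X)%N]add0n leq_add2r leqn0 size_poly_eq0 (negPf q0).
Qed.

Lemma curve_eq : y ^+ m = ev1 x f.
Proof.
have : ev2 x y h = 0 by apply/curve_ker; exists 1; rewrite mul1r.
by rewrite /h ev2_kummer => /eqP; rewrite subr_eq0 => /eqP.
Qed.

Lemma curve_x_transc b : x != jota b.
Proof.
apply/eqP => E; have : ev2 x y ('X - b%:P)%:P = 0 by rewrite ev2C ev1_XsubC E subrr.
move/curve_ev2_small; rewrite size_polyC polyXsubC_eq0 => /(_ m0)/eqP.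
by rewrite polyC_eq0 polyXsubC_eq0.
Qed.

Lemma ev1_eq0 R : (ev1 x R == 0) = (R == 0).
Proof.
apply/eqP/eqP => [|->]; last by rewrite rmorph0.
exact: (ev1_inj curve_x_transc).
Qed.

Lemma curve_rat u : is_ratio jota x y u.
Proof. by have [_ H] := hL; have [g1 [g2 [g20 ->]]] := H u; exists g1, g2. Qed.

Let f0 : f != 0. Proof. exact: monic_neq0 (branch_poly_monic a). Qed.

Let y0 : y != 0.
Proof.
apply/eqP => y0; have := curve_eq; rewrite y0 expr0n gtn_eqF // => /esym/eqP.
by rewrite ev1_eq0 (negPf f0).
Qed.

Lemma curve_integral_form u : exists (R : {poly K}) (g : {poly {poly K}}),
  [/\ R != 0, (size g <= m)%N & ev1 x R * u = ev2 x y g].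
Proof.
have [g1 [g2 [g20 ->]]] := curve_rat u.
have [g' [R [R0 E]]] := ev2_norm m0 curve_eq g20.
exists R, (Pdiv.CommonRing.rmodp (g1 * g') h); split; first by apply: contraNneq R0 => ->; rewrite rmorph0.
  by rewrite -ltnS -szh Pdiv.CommonRing.ltn_rmodpN0 // monic_neq0.
have -> : ev2 x y (Pdiv.CommonRing.rmodp (g1 * g') h) = ev2 x y (g1 * g').
  rewrite [in RHS](Pdiv.RingMonic.rdivp_eq hm (g1 * g')) rmorphD rmorphM /=.
  by rewrite [ev2 x y h](_ : _ = 0) ?mulr0 ?add0r //; apply/curve_ker; exists 1; rewrite mul1r.
by rewrite -E !rmorphM /=; field.
Qed.

Definition zden (j : nat) : {poly K} := branch_poly (fun i => j * a i %/ m)%N.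
Definition zpow (j : nat) : {poly K} := branch_poly (fun i => j * a i %% m)%N.
Definition zelt (j : nat) : L := y ^+ j / ev1 x (zden j).

Lemma zden_neq0 j : ev1 x (zden j) != 0.
Proof. by rewrite ev1_eq0 monic_neq0 // branch_poly_monic. Qed.

Lemma zelt_neq0 j : zelt j != 0.
Proof. by rewrite mulf_neq0 ?invr_eq0 ?zden_neq0 // expf_neq0. Qed.

Lemma zeltE j : y ^+ j = ev1 x (zden j) * zelt j.
Proof. by rewrite mulrC divfK // zden_neq0. Qed.

Lemma zelt_expm j : zelt j ^+ m = ev1 x (zpow j).
Proof.
apply: (mulfI (expf_neq0 m (zden_neq0 j))); rewrite -exprMn -zeltE exprAC curve_eq -!rmorphXn -rmorphM.
congr (ev1 x _); rewrite !branch_polyX branch_polyM; apply: eq_bigr => i _; congr (_ ^+ _).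
by rewrite -divn_eq mulnC.
Qed.

Lemma zelt_form u : exists (R : {poly K}) (G : 'I_m -> {poly K}),
  R != 0 /\ ev1 x R * u = \sum_(j < m) ev1 x (G j) * zelt j.
Proof.
have [R [g [R0 szg E]]] := curve_integral_form u.
exists R, (fun j => g`_j * zden j); split=> //; rewrite E ev2E.
rewrite (big_ord_widen m (fun i => ev1 x g`_i * y ^+ i)) // big_mkcond /=.
apply: eq_bigr => j _; rewrite rmorphM /= -mulrA -zeltE; case: ifP => // /negbT.
by rewrite -leqNgt => gj; rewrite nth_default // rmorph0 mul0r.
Qed.

Lemma ndvd_a i : ~~ (m %| a i)%N.
Proof. by have /andP[a1 am] := ha i; rewrite gtnNdvd. Qed.

Lemma mulmod_inj b (j k : 'I_m) : ~~ (m %| b)%N -> (j * b = k * b %[mod m])%N -> j = k.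
Proof.
move=> mb E; apply: val_inj; wlog ljk : j k E / (j <= k)%N => [hw|].
  by case/orP: (leq_total j k) => l; [apply: hw | apply/esym/hw].
have : (m %| (k - j) * b)%N by rewrite mulnBl -eqn_mod_dvd ?leq_mul2r ?ljk ?orbT //; apply/eqP.
rewrite Euclid_dvdM // (negPf mb) orbF => dv; apply/eqP; rewrite eqn_leq ljk /= -subn_eq0.
by have := ltn_ord k; case: posnP => // kj0; have := dvdn_leq kj0 dv; lia.
Qed.

Section AtPlace.
Variable P : place jota.

Lemma ord_ev1 b G : 0 < P (x - jota b) -> G != 0 ->
  P (ev1 x G) = (mup b G)%:Z * P (x - jota b).
Proof. by move=> Pb G0; have [_] := ord_horner_mup (curve_x_transc b) Pb G0. Qed.

Lemma ord_ev1_pole G : P x < 0 -> G != 0 -> P (ev1 x G) = (size G).-1%:Z * P x.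
Proof. by move=> Px G0; have [_] := ord_horner_pole Px G0. Qed.

Lemma ord_zelt_ram i j : 0 < P (x - jota (c i)) ->
  m%:Z * P (zelt j) = (j * a i %% m)%N%:Z * P (x - jota (c i)).
Proof.
move=> Pc; rewrite -ordX zelt_expm (ord_ev1 Pc) ?mup_branch_poly //.
exact: monic_neq0 (branch_poly_monic _).
Qed.

Lemma ord_zelt_inf j : P x < 0 ->
  m%:Z * P (zelt j) = (\sum_(i < d) (j * a i %% m))%N%:Z * P x.
Proof.
move=> Px; rewrite -ordX zelt_expm (ord_ev1_pole Px) ?size_branch_poly //.
exact: monic_neq0 (branch_poly_monic _).
Qed.

(** Otherwise every [x - b] has order 0, hence so have all nonzero polynomials in [x], and [y]; then
    nothing has a pole, not even the inverse of a uniformiser. *)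
Lemma place_trichotomy : P x < 0 \/ exists b, 0 < P (x - jota b).
Proof.
have [Px|Px] := ltP (P x) 0; [by left | right; apply: contrapT => nb].
have x0 : ord_ge P 0 x by rewrite /ord_ge Px orbT.
have Pb b : P (x - jota b) = 0.
  have n0 : x - jota b != 0 by rewrite subr_eq0 curve_x_transc.
  have : ord_ge P 0 (x - jota b) by rewrite ord_geB // ord_ge_const.
  rewrite ord_geE // le_eqVlt => /orP[/eqP<-//|Pb]; exfalso.
  by apply: nb; exists b.
have PR R : R != 0 -> P (ev1 x R) = 0.
  move=> R0; have [r ->] := closed_field_poly_normal R; have lR : lead_coef R != 0 by rewrite lead_coef_eq0.
  have pr0 : ev1 x (\prod_(z <- r) ('X - z%:P)) != 0.
    by rewrite ev1_eq0 monic_neq0 // monic_prod_XsubC.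
  rewrite -mul_polyC rmorphM /= ev1C place_mul ?fmorph_eq0 // place_const add0r rmorph_prod /=.
  rewrite ord_prod => [|z]; last by rewrite ev1_XsubC subr_eq0 curve_x_transc.
  by rewrite big1 // => z _; rewrite ev1_XsubC Pb.
have Py : P y = 0.
  have := congr1 P curve_eq; rewrite ordX PR //.
  by move/eqP; rewrite mulf_eq0 => /orP[/eqP m00|/eqP//]; move: m0; lia.
have ge0 u : u != 0 -> 0 <= P u.
  move=> u0; have [R [g [R0 _ E]]] := curve_integral_form u.
  have : ord_ge P 0 (ev1 x R * u).
    rewrite E ev2E; apply: ord_ge_sum => i _; rewrite -[0]addr0 ord_geM //.
      exact: ord_ge_horner.
    by rewrite /ord_ge ordX Py mulr0 lexx orbT.
  by rewrite ord_geE ?mulf_neq0 ?ev1_eq0 // place_mul ?ev1_eq0 // PR // add0r.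
have [u u0 Pu] := place_unif P.
by have := ge0 u^-1; rewrite invr_eq0 u0 ordV Pu => /(_ isT).
Qed.

End AtPlace.


(** So [x] and [zelt j] generate L, and [j] may be chosen to give a model that is smooth where it is
    wanted. *)
Lemma y_from_zelt (j k : nat) : (k * j = 1 %[mod m])%N ->
  exists A B : {poly K}, B != 0 /\ y = zelt j ^+ k * ev1 x A / ev1 x B.
Proof.
move=> E; exists (zden j ^+ k), (f ^+ (k * j %/ m)); rewrite expf_neq0 ?f0 //; split=> //.
rewrite !rmorphXn /= [zelt j ^+ k * _]mulrC -exprMn -zeltE -exprM -curve_eq -exprM.
apply: (canRL (mulfK _)); first by rewrite expf_neq0 ?y0.
rewrite -exprS [(j * k)%N]mulnC {2}(divn_eq (k * j) m) E modn_small ?prime_gt1 // addn1.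
by rewrite mulnC.
Qed.

Let ratio_change x' t : is_ratio jota x' t x -> (exists j k : nat, (k * j = 1 %[mod m])%N /\
  is_ratio jota x' t (zelt j)) -> forall u, is_ratio jota x' t u.
Proof.
move=> rx [j [k [jk rz]]] u; apply: (is_ratio_change rx _ (curve_rat u)).
have [A [B [B0 ->]]] := y_from_zelt jk.
apply: is_ratioM; last by apply: is_ratioV; apply: is_ratio_ev1.
by apply: is_ratioM; [apply: is_ratioX | apply: is_ratio_ev1].
Qed.

(** With [j] inverse to [a i] mod [m], [c i] is a simple root of [zpow j]. *)
Let ram_data i : exists (j : nat) (g1 : {poly K}), [/\ (j * a i = 1 %[mod m])%N, g1.[c i] != 0,
  zelt j ^+ m = ev1 x (('X - (c i)%:P) * g1) & forall u, is_ratio jota x (zelt j) u].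
Proof.
have [j ja] := prime_modn_inverse 1 m_pr (ndvd_a i).
exists j, (branch_poly (fun l => if l == i then 0 else j * a l %% m)%N); split=> //.
- have := root_branch_polyE (fun l => if l == i then 0 else j * a l %% m)%N i.
  by rewrite eqxx /root => /negbT.
- rewrite zelt_expm; congr (ev1 x _); rewrite /zpow /branch_poly (bigD1 i) //= [in RHS](bigD1 i) //=.
  rewrite eqxx expr0 mul1r ja modn_small ?prime_gt1 // expr1; congr (_ * _).
  by apply: eq_bigr => l /negPf->.
apply: ratio_change.
  by have := is_ratio_ev2 jota x (zelt j) 'X%:P; rewrite ev2C ev1X.
exists j, (a i); rewrite mulnC; split=> //.
by have := is_ratio_ev2 jota x (zelt j) 'X; rewrite ev2X.
Qed.

Lemma ram_place_ex i : exists P : place jota, P (x - jota (c i)) = m%:Z.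
Proof.
have [j [g1 [_ g10 tm rat]]] := ram_data i.
exact: (smooth_zero_place m0 curve_x_transc tm g10 rat).
Qed.

Lemma ram_place_uniq i (P Q : place jota) :
  0 < P (x - jota (c i)) -> 0 < Q (x - jota (c i)) -> P = Q.
Proof.
have [j [g1 [ja g10 tm rat]]] := ram_data i => Px Qx.
have pos (P0 : place jota) : 0 < P0 (x - jota (c i)) -> 0 < P0 (zelt j).
  move=> P0x; have := ord_zelt_ram j P0x; rewrite ja modn_small ?prime_gt1 // mul1r.
  by move: m0 P0x => m_pos; nia.
exact: (smooth_zero_place_uniq m0 curve_x_transc tm g10 rat Px (pos _ Px) Qx (pos _ Qx)).
Qed.

Lemma ram_place_ord i (P : place jota) : 0 < P (x - jota (c i)) -> P (x - jota (c i)) = m%:Z.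
Proof.
move=> Px; have [Q Qx] := ram_place_ex i.
by rewrite (ram_place_uniq Px (_ : 0 < Q (x - jota (c i)))) ?Qx // ltz_nat.
Qed.

Let x0 : x != 0. Proof. by have := curve_x_transc 0; rewrite rmorph0. Qed.

Lemma xV_transc b : x^-1 != jota b.
Proof.
apply/eqP => E; have := curve_x_transc b^-1.
by rewrite fmorphV -E invrK eqxx.
Qed.

Let inf_data : exists (t : L) (g1 : {poly K}), [/\ g1.[0] != 0,
  t ^+ m = ev1 x^-1 (('X - 0%:P) * g1) & forall u, is_ratio jota x^-1 t u].
Proof.
(* Here [m - 1] stands for -1: the degree [B] of [zpow j] becomes [n m - 1], and division of
   [zelt j] by [x^n] leaves a simple zero at [1/x = 0]. *)
have [j jA] := prime_modn_inverse (m - 1) m_pr hasum.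
have mj : ~~ (m %| j)%N.
  apply/negP => mj; move: jA; rewrite -modnMml (eqP mj) mul0n mod0n modn_small; last first.
    by rewrite subn1 prednK.
  by move/eqP; rewrite eq_sym subn_eq0 leqNgt prime_gt1.
have [k kj] := prime_modn_inverse 1 m_pr mj.
pose b i := (j * a i %% m)%N; pose B := (\sum_(i < d) b i)%N.
have /dvdnP[n BE] : (m %| B.+1)%N.
  rewrite /dvdn /B -addn1 -modnDml modn_summ -big_distrr /= jA modnDml subn1 addn1 prednK // modnn.
  by [].
pose t := zelt j / x ^+ n; pose g1 : {poly K} := \prod_(i < d) (1 - (c i)%:P * 'X) ^+ b i.
have xn0 : x ^+ n != 0 by rewrite expf_neq0.
exists t, g1; split.
- rewrite horner_prod big1 ?oner_neq0 // => i _.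
  by rewrite !hornerE ?mulr0 ?subr0 expr1n.
- have E : ev1 x (zpow j) = x ^+ B * ev1 x^-1 g1.
    rewrite /zpow /branch_poly /g1 !rmorph_prod expr_sum -big_split /=; apply: eq_bigr => i _.
    rewrite !rmorphXn /= -exprMn ev1_XsubC rmorphB rmorph1 rmorphM /= ev1C ev1X; congr (_ ^+ _).
    by field.
  rewrite expr_div_n zelt_expm E -exprM -BE exprS rmorphM /= ev1_XsubC rmorph0 subr0.
  by field; rewrite x0 expf_neq0.
have rx : is_ratio jota x^-1 t x.
  rewrite -[X in is_ratio _ _ _ X]invrK; apply: is_ratioV.
  by have := is_ratio_ev2 jota x^-1 t 'X%:P; rewrite ev2C ev1X.
apply: ratio_change => //; exists j, k; split=> //.
have -> : zelt j = t * x ^+ n by rewrite divfK.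
apply: is_ratioM; last exact: is_ratioX.
by have := is_ratio_ev2 jota x^-1 t 'X; rewrite ev2X.
Qed.

Lemma inf_place_ex : exists P : place jota, P x = - m%:Z.
Proof.
have [t [g1 [g10 tm rat]]] := inf_data.
have [P] := smooth_zero_place m0 xV_transc tm g10 rat.
by rewrite rmorph0 subr0 ordV => E; exists P; rewrite -E opprK.
Qed.

Lemma inf_place_uniq (P Q : place jota) : P x < 0 -> Q x < 0 -> P = Q.
Proof.
have [t [g1 [g10 tm rat]]] := inf_data.
have neg (P0 : place jota) : P0 x < 0 -> 0 < P0 (x^-1 - jota 0) /\ 0 < P0 t.
  move=> Px; have Pv : 0 < P0 (x^-1 - jota 0) by rewrite rmorph0 subr0 ordV oppr_gt0.
  split=> //; have [g0 Pg] := ord_horner_nroot (xV_transc 0) Pv g10.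
  have := congr1 P0 tm; rewrite ordX rmorphM /= ev1_XsubC place_mul ?subr_eq0 ?xV_transc //.
  rewrite [P0 (ev1 _ g1)]Pg addr0 => E; move: m0 => m_pos.
  by rewrite -E in Pv; nia.
move=> /neg[Px Pt] /neg[Qx Qt].
exact: (smooth_zero_place_uniq m0 xV_transc tm g10 rat Px Pt Qx Qt).
Qed.

Lemma inf_place_ord (P : place jota) : P x < 0 -> P x = - m%:Z.
Proof.
move=> Px; have [Q Qx] := inf_place_ex.
by rewrite (inf_place_uniq Px (_ : Q x < 0)) ?Qx // oppr_lt0 ltz_nat.
Qed.

Section Unramified.
Variables (b r : K).
Hypotheses (fb : f.[b] != 0) (rm : r ^+ m = f.[b]).

Let r0 : r != 0.
Proof. by apply: contraNneq fb => r0; rewrite -rm r0 expr0n gtn_eqF. Qed.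

Let ker_ev g : ev2 x y g = 0 -> pt2 b r g = 0.
Proof.
move/curve_ker => [q ->]; rewrite rmorphM rmorphB rmorphXn /= pt2X pt2C rm subrr mulr0 //.
Qed.

(** The quotient of [Y^m - r^m] by [Y - r]. At the point it is [m r^(m-1)], nonzero by [mK], and
    this makes [X - b] a uniformiser. *)
Let e : {poly {poly K}} := \sum_(i < m) 'X^(m.-1 - i) * (r%:P%:P) ^+ i.

Let pt_e : pt2 b r e != 0.
Proof.
rewrite rmorph_sum /= (eq_bigr (fun=> r ^+ m.-1)) => [|i _].
  by rewrite sumr_const card_ord -mulr_natr mulf_neq0 // expf_neq0.
rewrite rmorphM !rmorphXn /= pt2X pt2C hornerC -exprD subnK //.
by have := ltn_ord i; rewrite -{2}(prednK m0) ltnS.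
Qed.

Let unram_eY : exists q2, ev2 x y (e * ('X - r%:P%:P)) = ev2 x y (('X - b%:P)%:P * q2).
Proof.
have [q E] := horner_root_factor jota b f x.
exists q%:P; rewrite mulrC -subrXX -rmorphXn -rmorphXn ev2_kummer curve_eq ev1C rm rmorphM /= !ev2C.
by rewrite [LHS](_ : _ = ev1 x f - jota f.[b]) // [ev1 x f]E addrC addKr ev1_XsubC.
Qed.

Lemma unram_place_ex : exists P : place jota, P (x - jota b) = 1 /\ ord_ge P 1 (y - jota r).
Proof.
have [q2 eY] := unram_eY.
have one0 : pt2 b r 1 != 0 by rewrite rmorph1 oner_neq0.
have T0 : pt2 b r ('X - b%:P)%:P = 0 by rewrite pt2C !hornerE subrr.
have eX : ev2 x y (e * ('X - b%:P)%:P) = ev2 x y (('X - b%:P)%:P * e) by rewrite mulrC.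
have eM : ev2 x y (1 * ('X - b%:P)%:P) = ev2 x y (('X - b%:P)%:P ^+ 1 * 1) by rewrite mulr1 mul1r expr1.
exact: (smooth_point_place m0 curve_eq (curve_x_transc b) ker_ev curve_rat T0 pt_e eX eY one0 one0 eM).
Qed.

Lemma unram_place_uniq (P Q : place jota) :
  0 < P (x - jota b) -> ord_ge P 1 (y - jota r) ->
  0 < Q (x - jota b) -> ord_ge Q 1 (y - jota r) -> P = Q.
Proof.
have [q2 eY] := unram_eY.
have one0 : pt2 b r 1 != 0 by rewrite rmorph1 oner_neq0.
have T0 : pt2 b r ('X - b%:P)%:P = 0 by rewrite pt2C !hornerE subrr.
have eX : ev2 x y (e * ('X - b%:P)%:P) = ev2 x y (('X - b%:P)%:P * e) by rewrite mulrC.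
have eM : ev2 x y (1 * ('X - b%:P)%:P) = ev2 x y (('X - b%:P)%:P ^+ 1 * 1) by rewrite mulr1 mul1r expr1.
move=> Px Py Qx Qy.
exact: (smooth_point_place_uniq m0 curve_eq (curve_x_transc b) ker_ev curve_rat T0 pt_e eX eY one0 one0 eM Px Py Qx Qy).
Qed.

End Unramified.

(** The product of the [y - r] over the m-th roots [r] of [f.[b]] is [f(x) - f(b)], which vanishes
    at [P]; so one of the factors does. *)
Lemma unram_place_y b (P : place jota) : f.[b] != 0 -> 0 < P (x - jota b) ->
  exists2 r, r ^+ m = f.[b] & ord_ge P 1 (y - jota r).
Proof.
move=> fb Pb; have [rs E] := closed_field_poly_normal ('X^m - f.[b]%:P).
rewrite (monicP (monicXnsubC _ _)) // scale1r in E.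
suff [r rrs Pr] : exists2 r, r \in rs & ord_ge P 1 (y - jota r).
  exists r => //; apply/eqP; rewrite -subr_eq0 -[X in X == 0](_ : ('X^m - f.[b]%:P).[r] = _).
    by rewrite E -/(root _ _) root_prod_XsubC.
  by rewrite !hornerE.
apply/hasP; rewrite -[has _ _]negbK; apply/negP => /hasPn nP.
have big : ord_ge P 1 (\prod_(r <- rs) (y - jota r)).
  have -> : \prod_(r <- rs) (y - jota r) = y ^+ m - jota f.[b].
    transitivity (ev1 y (\prod_(r <- rs) ('X - r%:P))).
      by rewrite rmorph_prod; apply: eq_bigr => r _; rewrite /= ev1_XsubC.
    by rewrite -E rmorphB rmorphXn /= ev1X ev1C.
  have [q Eq] := horner_root_factor jota b f x.
  rewrite curve_eq [ev1 x f]Eq addrC addKr -[1]addr0 ord_geM //.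
    by rewrite ord_geE ?subr_eq0 ?curve_x_transc //; move: Pb; clear; lia.
  apply: ord_ge_horner; rewrite -[x](subrK (jota b)) ord_geD ?ord_ge_const //.
  by rewrite ord_geE ?subr_eq0 ?curve_x_transc // ltW.
have [n0 neg] : \prod_(r <- rs) (y - jota r) != 0 /\ P (\prod_(r <- rs) (y - jota r)) <= 0.
  elim: rs nP {E big} => [|r rs IH] nP; first by rewrite big_nil oner_neq0 ord1.
  have [|n0 neg] := IH; first by move=> z zr; apply: nP; rewrite inE zr orbT.
  have := nP r (mem_head _ _); rewrite /ord_ge negb_or => /andP[yr0 Pr].
  rewrite big_cons mulf_neq0 // place_mul //; split=> //; lia.
by move: big; rewrite ord_geE //; lia.
Qed.

Lemma unram_place_ord b (P : place jota) : f.[b] != 0 -> 0 < P (x - jota b) -> P (x - jota b) = 1.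
Proof.
move=> fb Pb; have [r rm Pr] := unram_place_y fb Pb; have [Q [Qb Qr]] := unram_place_ex fb rm.
by rewrite (unram_place_uniq fb rm Pb Pr (_ : 0 < Q (x - jota b)) Qr) ?Qb.
Qed.

Lemma places_over_finite b : exists s : seq (place jota), forall P : place jota,
  0 < P (x - jota b) -> P \in s.
Proof.
have [/eqP/root_branch_poly[i ->]|fb] := eqVneq f.[b] 0.
  have [P Px] := ram_place_ex i; exists [:: P] => Q Qx.
  by rewrite inE (ram_place_uniq Qx (_ : 0 < P (x - jota (c i)))) ?Px ?ltz_nat.
have [rs E] := closed_field_poly_normal ('X^m - f.[b]%:P).
rewrite (monicP (monicXnsubC _ _)) // scale1r in E.
(* The place at infinity is a default value when [r] is not an m-th root of [f.[b]]. *)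
have pl (r : K) : exists P : place jota, r ^+ m = f.[b] -> 0 < P (x - jota b) /\ ord_ge P 1 (y - jota r).
  have [rm|nrm] := eqVneq (r ^+ m) f.[b]; last first.
    by have [P _] := inf_place_ex; exists P => /eqP; rewrite (negPf nrm).
  by have [P [Pb Pr]] := unram_place_ex fb rm; exists P; rewrite Pb.
have [F hF] := choice pl; exists [seq F r | r <- rs] => P Pb.
have [r rm Pr] := unram_place_y fb Pb; apply/mapP; exists r.
  by rewrite -root_prod_XsubC -E /root !hornerE rm subrr.
by have [Fb Fr] := hF r rm; apply: (unram_place_uniq fb rm).
Qed.

Lemma kummer_roots (v : K) : v != 0 -> exists2 rs : seq K,
  uniq rs & size rs = m /\ forall r, (r \in rs) = (r ^+ m == v).
Proof.
move=> v0; have [rs E] := closed_field_poly_normal ('X^m - v%:P).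
rewrite (monicP (monicXnsubC _ _)) // scale1r in E.
exists rs.
  rewrite -separable_prod_XsubC -E unlock derivB derivXn derivC subr0.
  (* The derivative yields [v^-1 X^m]; subtracting [v^-1 (X^m - v)] leaves 1. *)
  apply/Bezout_eq1_coprimepP; exists ((- v^-1)%:P, (v^-1 / m%:R)%:P * 'X) => /=.
  have -> : (v^-1 / m%:R)%:P * 'X * ('X^(m.-1) *+ m) = v^-1%:P * 'X^m :> {poly K}.
    rewrite -[in RHS](prednK m0) exprS -scaler_nat -mul_polyC -[in RHS](divfK mK v^-1) [(_ * m%:R)%:P]polyCM.
    by ring.
  transitivity ((v^-1 * v)%:P); last by rewrite mulVf.
  by rewrite polyCN polyCM; ring.
split=> [|r].
  by apply: succn_inj; rewrite -(size_prod_XsubC rs (fun z => z)) -E size_XnsubC.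
by rewrite -root_prod_XsubC -E /root !hornerE subr_eq0.
Qed.

Lemma unity_root_neq1 : exists2 z : K, z ^+ m = 1 & z != 1.
Proof.
have [rs urs [szr mem]] := kummer_roots (oner_neq0 K).
case: (rs) urs szr mem => [|r1 [|r2 s]] /= u szr mem; try by have := prime_gt1 m_pr; rewrite -szr.
have r12 : r1 != r2 by move: u; rewrite inE negb_or => /andP[/andP[]].
have e1 : r1 ^+ m = 1 by apply/eqP; rewrite -mem mem_head.
have e2 : r2 ^+ m = 1 by apply/eqP; rewrite -mem !inE eqxx orbT.
have [r1E|] := eqVneq r1 1; last by exists r1.
by exists r2; rewrite // eq_sym -r1E.
Qed.

Lemma unity_root_pow (z : K) j : z ^+ m = 1 -> z != 1 -> z ^+ j = 1 -> (m %| j)%N.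
Proof.
move=> zm z1 zj; apply: contraNT z1 => mj.
have [k E] := prime_modn_inverse 1 m_pr mj.
have zM n : z ^+ n = z ^+ (n %% m) by rewrite {1}(divn_eq n m) exprD mulnC exprM zm expr1n mul1r.
by have := zM (k * j)%N; rewrite E -zM mulnC exprM zj expr1n expr1 => <-.
Qed.

Lemma ord_ge_ev2 (P : place jota) n g : ord_ge P 0 x -> ord_ge P 0 n -> ord_ge P 0 (ev2 x n g).
Proof.
move=> Px Pn; rewrite ev2E; apply: ord_ge_sum => i _; rewrite -[0]addr0 ord_geM //.
  exact: ord_ge_horner.
elim: (i : nat) => [|k IH]; first by rewrite expr0 /ord_ge ord1 lexx orbT.
by rewrite exprS -[0]addr0 ord_geM.
Qed.

Lemma ord_ge_x (P : place jota) b : 0 < P (x - jota b) -> ord_ge P 0 x.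
Proof.
move=> Pb; rewrite -[x](subrK (jota b)) ord_geD ?ord_ge_const //.
by rewrite ord_geE ?subr_eq0 ?curve_x_transc // ltW.
Qed.

Lemma ord_ge_lt_const (P : place jota) b : ord_ge P 1 (jota b) -> b = 0.
Proof. by rewrite /ord_ge fmorph_eq0 place_const orbF => /eqP. Qed.

Definition ztotal (j : nat) : nat := (\sum_(i < d) (j * a i %% m))%N.

Lemma ztotal_mod j : (ztotal j = j * \sum_(i < d) a i %[mod m])%N.
Proof. by rewrite /ztotal modn_summ big_distrr. Qed.

Lemma ord_zelt_ramE (P : place jota) i j : 0 < P (x - jota (c i)) ->
  P (zelt j) = (j * a i %% m)%N%:Z.
Proof.
move=> Pc; have := ord_zelt_ram j Pc; rewrite (ram_place_ord Pc) mulrC => /mulIf; apply.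
by move: m0; lia.
Qed.

Lemma ord_zelt_infE (P : place jota) j : P x < 0 -> P (zelt j) = - (ztotal j)%:Z.
Proof.
move=> Px; have := ord_zelt_inf j Px; rewrite (inf_place_ord Px) mulrN -mulNr mulrC => /mulIf; apply.
by move: m0; lia.
Qed.

Lemma ord_zelt_unram (P : place jota) b j : f.[b] != 0 -> 0 < P (x - jota b) -> P (zelt j) = 0.
Proof.
move=> fb Pb; have := ordX P (zelt j) m; rewrite zelt_expm.
have z0 : zpow j != 0 by apply: monic_neq0; apply: branch_poly_monic.
rewrite (ord_ev1 Pb z0) mupNroot ?mul0r => [/eqP|].
  by rewrite eq_sym mulf_eq0 => /orP[/eqP m00|/eqP//]; move: m0; lia.
apply/negP => /root_branch_poly[i bE]; case/negP: fb; rewrite bE -/(root f (c i)) root_branch_polyE.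
by have /andP[] := ha i.
Qed.

(** * Orders of sums over the [zelt j] *)

Section ZSum.
Variable G : 'I_m -> {poly K}.
Let S := \sum_(j < m) ev1 x (G j) * zelt j.

Let term0 j : (ev1 x (G j) * zelt j == 0) = (G j == 0).
Proof. by rewrite mulf_eq0 (negPf (zelt_neq0 _)) orbF ev1_eq0. Qed.

(** Mod [m] the term of index [j] has order [j a_i], so the orders are distinct. *)
Lemma zsum_ram (P : place jota) i j : 0 < P (x - jota (c i)) -> G j != 0 ->
  S != 0 /\ P S <= (m * mup (c i) (G j) + (j * a i %% m))%N%:Z.
Proof.
move=> Pc Gj; have ordt k : G k != 0 -> P (ev1 x (G k) * zelt k) = (m * mup (c i) (G k) + (k * a i %% m))%N%:Z.
  move=> Gk; rewrite place_mul ?zelt_neq0 ?ev1_eq0 // (ord_ev1 Pc Gk) (ord_zelt_ramE _ Pc).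
  by rewrite (ram_place_ord Pc) PoszD PoszM mulrC.
have [||S0 PS] := @ord_sum_distinct _ _ _ P _ (fun j => ev1 x (G j) * zelt j) j.
- move=> k l kl; rewrite !term0 => Gk Gl; rewrite !ordt //; apply: contra_neq kl => -[E].
  apply: (@mulmod_inj (a i)); first exact: ndvd_a.
  by have /(congr1 (modn^~ m)) := E; rewrite ![(m * _)%N]mulnC !modnMDl !modn_mod.
- by rewrite term0.
by rewrite -ordt.
Qed.

(** Mod [m] the order is now [- j] times the sum of the [a_i]; [hasum] separates the terms. *)
Lemma zsum_inf (P : place jota) j : P x < 0 -> G j != 0 ->
  S != 0 /\ P S <= - (m * (size (G j)).-1 + ztotal j)%N%:Z.
Proof.
move=> Px Gj; have ordt k : G k != 0 -> P (ev1 x (G k) * zelt k) = - (m * (size (G k)).-1 + ztotal k)%N%:Z.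
  move=> Gk; rewrite place_mul ?zelt_neq0 ?ev1_eq0 // (ord_ev1_pole Px Gk) (ord_zelt_infE _ Px).
  by rewrite (inf_place_ord Px) PoszD PoszM; ring.
have [||S0 PS] := @ord_sum_distinct _ _ _ P _ (fun j => ev1 x (G j) * zelt j) j.
- move=> k l kl; rewrite !term0 => Gk Gl; rewrite !ordt //; apply: contra_neq kl => /oppr_inj[E].
  apply: (mulmod_inj hasum); rewrite -!ztotal_mod.
  by have /(congr1 (modn^~ m)) := E; rewrite ![(m * _)%N]mulnC !modnMDl.
- by rewrite term0.
by rewrite -ordt.
Qed.

(** Over [b] there is a place for each of the [m] values [r] of [y]. Cleared of denominators, [S]
    takes there the value at [r] of a polynomial of degree below [m], which thus has [m] roots. *)
Lemma zsum_unram b j : f.[b] != 0 ->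
  (forall P : place jota, 0 < P (x - jota b) -> ord_ge P 1 S) -> root (G j) b.
Proof.
move=> fb hS; pose V k := \prod_(l < m | l != k) zden l.
have Vb k : (V k).[b] != 0.
  rewrite horner_prod prodf_seq_neq0; apply/allP => l _ /=; apply/implyP => _.
  apply: contraNneq fb => /eqP/root_branch_poly[i ->]; rewrite -/(root f (c i)) root_branch_polyE.
  by have /andP[] := ha i.
pose g : {poly {poly K}} := \sum_(k < m) (G k * V k) *: 'X^k.
have gE : ev2 x y g = ev1 x (\prod_(l < m) zden l) * S.
  rewrite /g rmorph_sum /S big_distrr; apply: eq_bigr => k _ /=.
  rewrite -mul_polyC rmorphM rmorphXn /= ev2C ev2X zeltE (bigD1 k) //= !rmorphM /=.
  by rewrite /V; ring.
have ptg r : pt2 b r g = (\poly_(k < m) (if insub k is Some k then (G k * V k).[b] else 0)).[r].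
  rewrite horner_poly rmorph_sum; apply: eq_bigr => k _ /=.
  rewrite -mul_polyC rmorphM rmorphXn /= pt2C pt2X.
  by case: insubP => [k' _ /val_inj->|]; rewrite ?ltn_ord.
have zero r : r ^+ m = f.[b] -> pt2 b r g = 0.
  move=> rm; have [P [Pb Pr]] := unram_place_ex fb rm.
  have P0 : 0 < P (x - jota b) by rewrite Pb.
  have Px := ord_ge_x P0.
  have Py : ord_ge P 0 y by rewrite -[y](subrK (jota r)) ord_geD ?ord_ge_const // (ord_ge_trans _ Pr).
  apply: (@ord_ge_lt_const P); have [r1 [r2 E]] := pt2_ideal b r g.
  have := congr1 (ev2 x y) E; rewrite gE 2!rmorphD 2!rmorphM /= ev2B !ev2C ev1_XsubC !ev1C ev2X => E2.
  have -> : jota (pt2 b r g) = ev1 x (\prod_(l < m) zden l) * S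
     - ((x - jota b) * ev2 x y r1 + (y - jota r) * ev2 x y r2) by rewrite E2; ring.
  rewrite ord_geB ?ord_geD // -[1]addr0; last 2 first.
  - by rewrite ord_geM ?ord_ge_ev2 // /ord_ge Pb lexx orbT.
  - by rewrite ord_geM ?ord_ge_ev2.
  by rewrite addrC ord_geM ?hS //; apply: ord_ge_horner.
have [rs urs [szr mem]] := kummer_roots fb.
set q := \poly_(k < m) _ in ptg.
have q0 : q = 0.
  apply/eqP; apply: contraT => q0; have := max_poly_roots q0 _ urs.
  rewrite szr ltnNge size_poly /= => -> //; apply/allP => r; rewrite mem => /eqP rm.
  by rewrite /root -ptg zero.
have := congr1 (fun q : {poly K} => q`_j) q0; rewrite coef_poly ltn_ord coef0.
case: insubP => [k' _ /val_inj->|]; last by rewrite ltn_ord.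
by move/eqP; rewrite hornerM mulf_eq0 (negPf (Vb _)) orbF.
Qed.

End ZSum.

Definition finite_regular (u : L) : Prop :=
  forall (P : place jota) b, 0 < P (x - jota b) -> ord_ge P 0 u.

(* At a root b of the denominator R all the G j vanish, so R can be shortened. *)
Lemma finite_regular_form u : finite_regular u ->
  exists G : 'I_m -> {poly K}, u = \sum_(j < m) ev1 x (G j) * zelt j.
Proof.
move=> reg; have [R [G [R0 E]]] := zelt_form u.
elim: {R}(size R) {-2}R (leqnn (size R)) G R0 E => [|n IH] R szR G R0 E.
  by rewrite leqn0 size_poly_eq0 (negPf R0) in szR.
have [sz1|sz1] := leqP (size R) 1.
  have [k k0 RE] : exists2 k, k != 0 & R = k%:P.
    by have RE := size1_polyC sz1; exists R`_0; rewrite // -polyC_eq0 -RE.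
  exists (fun j => k^-1 *: G j); apply: (mulfI (_ : jota k != 0)); first by rewrite fmorph_eq0.
  rewrite -(ev1C jota x) -RE E big_distrr; apply: eq_bigr => j _ /=.
  rewrite RE ev1C -mul_polyC rmorphM /= ev1C.
  have k'0 : jota k != 0 by rewrite fmorph_eq0.
  by rewrite fmorphV; field.
have [b Rb] : exists b, root R b by apply/closed_rootP; rewrite gtn_eqF.
have over (P : place jota) : 0 < P (x - jota b) ->
    ord_ge P (P (x - jota b)) (\sum_(j < m) ev1 x (G j) * zelt j).
  move=> Pb; rewrite -E -[P (x - _)]addr0 ord_geM ?(reg _ _ Pb) //.
  rewrite ord_geE ?ev1_eq0 // (ord_ev1 Pb R0); have : (0 < mup b R)%N by rewrite -XsubC_dvd // dvdp_XsubCl.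
  by move: Pb; nia.
have Gb j : root (G j) b.
  have [/eqP/root_branch_poly[i bE]|fb] := eqVneq f.[b] 0; last first.
    apply: (zsum_unram _ fb) => P Pb; apply: ord_ge_trans (over P Pb).
    by rewrite (unram_place_ord fb Pb).
  rewrite bE in over *; have [P Pm] := ram_place_ex i.
  have Pc : 0 < P (x - jota (c i)) by rewrite Pm ltz_nat.
  have [->|Gj] := eqVneq (G j) 0; first exact: root0.
  have [S0 PS] := zsum_ram Pc Gj; have := over P Pc; rewrite ord_geE // Pm => mS.
  rewrite -dvdp_XsubCl XsubC_dvd //; case: (posnP (mup (c i) (G j))) => // mu0.
  by rewrite mu0 muln0 add0n in PS; have := ltn_pmod (j * a i) m0; lia.
have [R' RE] := factor_theorem _ _ Rb.
have fG j : exists G', G j = G' * ('X - b%:P) by apply/factor_theorem.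
have [G' GE] := choice fG.
have R'0 : R' != 0 by apply: contraNneq R0 => R'0; rewrite RE R'0 mul0r.
apply: (IH R' _ G' R'0).
  by rewrite -ltnS; move: szR; rewrite RE size_Mmonic ?monicXsubC // size_XsubC addn2.
have xb : x - jota b != 0 by rewrite subr_eq0 curve_x_transc.
apply: (mulfI xb); rewrite mulrA -[x - _](ev1_XsubC jota) -rmorphM mulrC [_ * R']mulrC -RE mulrC E.
rewrite big_distrr; apply: eq_bigr => j _ /=.
by rewrite GE rmorphM /= ; ring.
Qed.

(** Such a [u] is a sum whose terms do not cancel at infinity; order 0 there leaves only [j = 0]
    with a constant coefficient. *)
Lemma ord_all0_const u : u != 0 -> (forall P : place jota, P u = 0) -> exists2 k, k != 0 & u = jota k.
Proof.
move=> u0 Pu; have [G E] : exists G : 'I_m -> {poly K}, u = \sum_(j < m) ev1 x (G j) * zelt j.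
  by apply: finite_regular_form => P b _; rewrite /ord_ge Pu lexx orbT.
have [P Px] := inf_place_ex; have Px0 : P x < 0 by rewrite Px oppr_lt0 ltz_nat.
have Gj j : G j != 0 -> j = 0%N :> nat /\ (size (G j) <= 1)%N.
  move=> Gj; have [_] := zsum_inf Px0 Gj; rewrite -E Pu oppr_ge0 => le0.
  have {le0} : (m * (size (G j)).-1 + ztotal j == 0)%N by rewrite -leqn0; move: le0; rewrite lez_nat.
  rewrite addn_eq0 muln_eq0 gtn_eqF //= => /andP[/eqP sz0 /eqP z0]; split; last by move: sz0; lia.
  have := ztotal_mod j; rewrite z0 mod0n => /esym/eqP/dvdnP[q qE].
  have := @mulmod_inj _ j (Ordinal m0) hasum; rewrite /= mul0n mod0n => H.
  by rewrite H // qE modnMl.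
have E0 : u = ev1 x (G (Ordinal m0)) * zelt 0.
  rewrite E (bigD1 (Ordinal m0)) //= big1 ?addr0 // => j jn0.
  have [->|/Gj[j0 _]] := eqVneq (G j) 0; first by rewrite rmorph0 mul0r.
  by case/eqP: jn0; apply: val_inj.
have G0 : G (Ordinal m0) != 0 by apply: contraNneq u0 => g0; rewrite E0 g0 rmorph0 mul0r.
have [_ sz] := Gj _ G0; have z0 : zelt 0 = 1.
  rewrite /zelt expr0 div1r (_ : zden 0 = 1) ?rmorph1 ?invr1 // /zden /branch_poly big1 // => i _.
  by rewrite mul0n div0n expr0.
have GE := size1_polyC sz; exists (G (Ordinal m0))`_0; first by rewrite -polyC_eq0 -GE.
by rewrite E0 z0 mulr1 {1}GE ev1C.
Qed.

(** * Regular differentials and the p-rank *)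

(* The differential eta dx is regular: x - b, resp. x, has order e, resp. - e, at P, and
   dx has order e - 1, resp. - e - 1. *)
Definition regular_differential (eta : L) : Prop :=
  (forall (P : place jota) b, 0 < P (x - jota b) -> ord_ge P 1 ((x - jota b) * eta)) /\
  (forall P : place jota, P x < 0 -> ord_ge P 1 (x * eta)).

Let r := branch_poly (fun=> 1%N).

Lemma mod_mul_compl i j : (0 < j < m)%N -> (j * a i %% m + (m - j) * a i %% m = m)%N.
Proof.
move=> /andP[j0 jm]; have nz k : (0 < k < m)%N -> (0 < k * a i %% m)%N.
  by move=> /andP[k0 km]; rewrite lt0n -/(dvdn _ _) Euclid_dvdM // (negPf (ndvd_a i)) orbF gtnNdvd.
have n1 := nz j; have n2 := nz (m - j)%N; rewrite j0 jm in n1.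
rewrite subn_gt0 jm ltn_subrL j0 m0 in n2; have {}n1 := n1 isT; have {}n2 := n2 isT; have l1 := ltn_pmod (j * a i) m0.
have l2 := ltn_pmod ((m - j) * a i) m0.
have : (m %| j * a i %% m + (m - j) * a i %% m)%N.
  by rewrite /dvdn modnDm -mulnDl subnKC ?(ltnW jm) // modnMr.
by move=> /dvdnP[[|[|q]]]; rewrite ?mul0n ?mulSn ?mul0n => E; move: E n1 n2 l1 l2; clear; lia.
Qed.

Lemma ztotal_compl j : (0 < j < m)%N -> (ztotal j + ztotal (m - j) = m * d)%N.
Proof.
move=> jm; rewrite /ztotal -big_split (eq_bigr (fun=> m)) => [|i _]; last exact: mod_mul_compl.
by rewrite sum_nat_const card_ord mulnC.
Qed.

Lemma zelt_compl j : (0 < j < m)%N -> zelt j * zelt (m - j) = ev1 x r.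
Proof.
move=> jm; have fE : f = zden j * zden (m - j) * r.
  rewrite /zden /r !branch_polyM; apply: eq_bigr => i _; congr (_ ^+ _).
  have := mod_mul_compl i jm; have := divn_eq (j * a i) m; have := divn_eq ((m - j) * a i) m.
  move: (_ %/ m)%N (_ %% m)%N => q1 s1; move: (_ %/ m)%N (_ %% m)%N => q2 s2.
  case/andP: jm => _ /ltnW jm; rewrite mulnBl => E1 E2 E3.
  have le : (j * a i <= m * a i)%N by rewrite leq_mul2r jm orbT.
  apply/eqP; rewrite -(eqn_pmul2l m0); move: le E1 E2 E3; clear; lia.
have := curve_eq; rewrite -{1}(subnKC (ltnW (proj2 (andP jm)))) exprD !zeltE fE !rmorphM /=.
rewrite mulrACA => /mulfI; apply.
by rewrite mulf_neq0 ?zden_neq0.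
Qed.

Lemma ndvd_ztotal j : (0 < j < m)%N -> ~~ (m %| ztotal j)%N.
Proof.
move=> /andP[j0 jm]; rewrite /dvdn ztotal_mod -/(dvdn _ _) Euclid_dvdM // (negPf hasum) orbF.
by rewrite gtnNdvd.
Qed.

Lemma regular_quotient j (H : {poly K}) : (0 < j < m)%N -> (m * size H <= ztotal j)%N ->
  regular_differential (ev1 x H / zelt j).
Proof.
move=> jm szH; split=> [P b Pb|P Px].
  have reg0 : ord_ge P 0 (ev1 x H) by apply: ord_ge_horner; apply: ord_ge_x Pb.
  rewrite mulrCA -[1]add0r ord_geM // ord_geE ?mulf_neq0 ?invr_eq0 ?zelt_neq0 ?subr_eq0 ?curve_x_transc //.
  rewrite place_mul ?invr_eq0 ?zelt_neq0 ?subr_eq0 ?curve_x_transc // ordV.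
  have [/eqP/root_branch_poly[i bE]|fb] := eqVneq f.[b] 0.
    rewrite bE in Pb *; rewrite (ram_place_ord Pb) (ord_zelt_ramE _ Pb).
    by have := ltn_pmod (j * a i) m0; clear; lia.
  by rewrite (unram_place_ord fb Pb) (ord_zelt_unram _ fb Pb) subr0.
have [->|H0] := eqVneq H 0; first by rewrite rmorph0 mul0r mulr0 ord_ge0.
have xn0 : x != 0 by exact: x0.
rewrite ord_geE ?mulf_neq0 ?invr_eq0 ?zelt_neq0 ?ev1_eq0 //.
rewrite !place_mul ?mulf_neq0 ?invr_eq0 ?zelt_neq0 ?ev1_eq0 // ordV.
rewrite (ord_ev1_pole Px H0) (ord_zelt_infE _ Px) (inf_place_ord Px) opprK.
have sz0 : (0 < size H)%N by rewrite lt0n size_poly_eq0.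
(* Divisibility excludes equality; strictness is the order at least 1 wanted at infinity. *)
have ne : (m * size H != ztotal j)%N by apply: contraNneq (ndvd_ztotal jm) => <-; rewrite dvdn_mulr.
by move: sz0 ne szH; case: (size H) => // n _; rewrite /= mulnS; clear; lia.
Qed.

Let opp_ord (j : 'I_m) : 'I_m := Ordinal (ltn_pmod (m - j) m0).

Let opp_ordK : involutive opp_ord.
Proof.
move=> j; apply: val_inj; rewrite /=; have := ltn_ord j; case: (posnP j) => [->|j0] jm.
  by rewrite subn0 modnn subn0 modnn.
by rewrite (@modn_small (m - j)) ?subKn ?modn_small ?(ltnW jm) //; move: j0 jm; clear; lia.
Qed.

(** Multiplication by [r], the product of the [x - c i], makes [eta] regular away from infinity. As
    [zelt j * zelt (m - j)] is [r], an expansion in the [zelt j] then becomes one in their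
    inverses. *)
Lemma regular_differential_form eta : regular_differential eta ->
  exists H : 'I_m -> {poly K}, [/\ forall j, (m * size (H j) <= ztotal j)%N &
    eta = \sum_(j < m) ev1 x (H j) / zelt j].
Proof.
move=> [fin inf]; have r0 : r != 0 by apply: monic_neq0; apply: branch_poly_monic.
have szr : size r = d.+1 by rewrite size_branch_poly sum1_card card_ord.
have [->|eta0] := eqVneq eta 0.
  exists (fun=> 0); split=> [j|]; first by rewrite size_poly0 muln0.
  by rewrite big1 // => j _; rewrite rmorph0 mul0r.
have finE (P : place jota) b : 0 < P (x - jota b) -> 1 <= P (x - jota b) + P eta.
  move=> Pb; have := fin P b Pb; rewrite ord_geE ?mulf_neq0 ?subr_eq0 ?curve_x_transc //.
  by rewrite place_mul ?subr_eq0 ?curve_x_transc.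
have re0 : ev1 x r * eta != 0 by rewrite mulf_neq0 ?ev1_eq0.
have ramE (P : place jota) i : 0 < P (x - jota (c i)) -> 1 <= P (ev1 x r * eta).
  move=> Pc; rewrite place_mul ?ev1_eq0 // (ord_ev1 Pc r0) mup_branch_poly mul1r.
  exact: finE.
have [G GE] : exists G : 'I_m -> {poly K}, ev1 x r * eta = \sum_(j < m) ev1 x (G j) * zelt j.
  apply: finite_regular_form => P b Pb; rewrite ord_geE //.
  have [/eqP/root_branch_poly[i bE]|fb] := eqVneq f.[b] 0.
    by rewrite bE in Pb; rewrite (le_trans _ (ramE P i Pb)).
  have := finE P b Pb; rewrite place_mul ?ev1_eq0 // (unram_place_ord fb Pb) lerDl => ge0.
  by rewrite addr_ge0 // (ord_ev1 Pb r0) mulr_ge0 // ltW.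
have sz j : G j != 0 -> (m * size (G j) + ztotal j < m * d)%N.
  move=> Gj; have [P Pm] := inf_place_ex; have Px : P x < 0 by rewrite Pm oppr_lt0 ltz_nat.
  have [_] := zsum_inf Px Gj; rewrite -GE place_mul ?ev1_eq0 // (ord_ev1_pole Px r0) szr Pm /=.
  have := inf P Px; have xn0 : x != 0 by exact: x0.
  rewrite ord_geE ?mulf_neq0 // place_mul // Pm.
  have : (0 < size (G j))%N by rewrite lt0n size_poly_eq0.
  by case: (size (G j)) => // n _ /=; rewrite mulnS; clear; nia.
pose i0 := Ordinal m0.
(* [G i0] vanishes at the [d] points [c i], while the bound at infinity makes its size less than
   [d]. *)
have G0 : G i0 = 0.
  apply: contraTeq isT => G0; have := sz i0 G0; rewrite /ztotal big1 => [|i _]; last by rewrite mul0n mod0n.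
  rewrite addn0 ltn_pmul2l // ltnNge => /negP[].
  have : (\prod_(i < d) ('X - (c i)%:P) ^+ 1%N %| G i0).
    have -> : \prod_(i < d) ('X - (c i)%:P) ^+ 1%N = \prod_(z <- codom c) ('X - z%:P).
      by rewrite big_map enumT; apply: eq_bigr => i _; rewrite expr1.
    apply: uniq_roots_dvdp; last by rewrite uniq_rootsE (map_inj_uniq c_inj) enum_uniq.
    apply/allP => _ /codomP[i ->]; have [P Pm] := ram_place_ex i.
    have Pc : 0 < P (x - jota (c i)) by rewrite Pm ltz_nat.
    have [_] := zsum_ram Pc G0; rewrite -GE mul0n mod0n addn0 => le.
    rewrite -dvdp_XsubCl XsubC_dvd //; have := ramE P i Pc; case: (posnP (mup _ _)) le => // ->.
    by rewrite muln0; clear; lia.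
  by move/(dvdp_leq G0); rewrite -/(branch_poly _) -/r szr => /ltnW.
exists (fun j => G (opp_ord j)); split=> [j|].
  have [->|Gj] := eqVneq (G (opp_ord j)) 0; first by rewrite size_poly0 muln0.
  have := sz _ Gj; have := ltn_ord j; case: (posnP j) => [j0|j0] jm.
    have E : opp_ord j = i0 by apply: val_inj; rewrite /= j0 subn0 modnn.
    by rewrite E G0 eqxx in Gj.
  have jm' : (0 < j < m)%N by rewrite j0.
  rewrite -(ztotal_compl jm') /= (@modn_small (m - j)); first by clear; lia.
  by move: j0 jm; clear; lia.
apply: (mulfI (_ : ev1 x r != 0)); first by rewrite ev1_eq0.
rewrite GE (reindex_inj (inv_inj opp_ordK)) big_distrr; apply: eq_bigr => j _ /=.
have jm := ltn_ord j; case: (posnP j) => [j0|j0].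
  have -> : opp_ord j = i0 by apply: val_inj; rewrite /= j0 subn0 modnn.
  by rewrite G0 rmorph0 !mul0r mulr0.
rewrite (@modn_small (m - j)); last by move: j0 jm; clear; lia.
rewrite -(zelt_compl (_ : 0 < j < m)%N) ?j0 //.
by have := zelt_neq0 j => z0; field.
Qed.

(** Away from infinity, zeros and poles lie over the roots of a denominator [R] or of the norm [R']
    of the numerator. *)
Lemma support_finite u : u != 0 -> exists B : seq K, forall P : place jota, P u != 0 ->
  P x < 0 \/ exists2 b, b \in B & 0 < P (x - jota b).
Proof.
move=> u0; have [R [g [R0 _ E]]] := curve_integral_form u.
have g0 : ev2 x y g != 0 by rewrite -E mulf_neq0 ?ev1_eq0.
have [g' [R' [R'0 E']]] := ev2_norm m0 curve_eq g0.
rewrite ev1_eq0 in R'0; have [B BE] := closed_field_poly_normal (R * R').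
exists B => P Pu; have [Px|[b Pb]] := place_trichotomy P; [by left | right; exists b => //].
have RR0 : R * R' != 0 by rewrite mulf_neq0.
apply: contraNT Pu => bB.
have : ~~ root (R * R') b by rewrite BE rootZ ?lead_coef_eq0 // root_prod_XsubC.
rewrite rootM negb_or => /andP[Rb R'b].
have PR : P (ev1 x R) = 0 by rewrite (ord_ev1 Pb R0) mupNroot // mul0r.
have PR' : P (ev1 x R') = 0 by rewrite (ord_ev1 Pb R'0) mupNroot // mul0r.
have Px := ord_ge_x Pb.
have Py : ord_ge P 0 y.
  rewrite /ord_ge; apply/orP; right; have := congr1 P curve_eq; rewrite ordX (ord_ev1 Pb f0).
  by have : (0 < m%:Z) by [rewrite ltz_nat]; have := ltW Pb; clear; nia.
have g'0 : ev2 x y g' != 0.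
  apply: contraNneq R'0 => g'0; rewrite -ev1_eq0 -E' rmorphM /=.
  by rewrite [ev2 x y g']g'0 mulr0.
have ge := ord_ge_ev2 g Px Py; have ge' := ord_ge_ev2 g' Px Py.
rewrite ord_geE // in ge; rewrite ord_geE // in ge'.
have := congr1 P E'; rewrite rmorphM /= place_mul // PR' => sum0.
have := congr1 P E; rewrite place_mul ?ev1_eq0 // PR add0r => ->.
by move: sum0 ge ge'; clear; lia.
Qed.

Lemma places_over_seq (B : seq K) : exists2 s : seq (place jota), uniq s &
  forall P, P \in s <-> P x < 0 \/ exists2 b, b \in B & 0 < P (x - jota b).
Proof.
have [F hF] := choice places_over_finite; have [Pi Pix] := inf_place_ex.
have Pi0 : Pi x < 0 by rewrite Pix oppr_lt0 ltz_nat.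
pose good (P : place jota) := `[< P x < 0 \/ exists2 b, b \in B & 0 < P (x - jota b) >].
exists (undup [seq P <- Pi :: flatten [seq F b | b <- B] | good P]); first exact: undup_uniq.
move=> P; rewrite mem_undup mem_filter; split=> [/andP[/asboolP]//|gP].
apply/andP; split; first exact/asboolP.
rewrite inE; case: gP => [Px|[b bB Pb]]; first by rewrite (inf_place_uniq Px Pi0) eqxx.
by apply/orP; right; apply/flattenP; exists (F b); [apply: map_f | apply: hF].
Qed.

(** * Automorphisms of L over K(x) *)

Lemma rmorph_ev1 (s : {rmorphism L -> L}) g : (forall k, s (jota k) = jota k) ->
  s x = x -> s (ev1 x g) = ev1 x g.
Proof.
move=> sj sx; rewrite -[g]coefK poly_def !rmorph_sum; apply: eq_bigr => i _ /=.
by rewrite -mul_polyC !rmorphM !rmorphXn /= ev1X ev1C sx sj.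
Qed.

Lemma rmorph_ev2 (s : {rmorphism L -> L}) g : (forall k, s (jota k) = jota k) ->
  s x = x -> s (ev2 x y g) = ev2 x (s y) g.
Proof.
move=> sj sx; rewrite !ev2E rmorph_sum; apply: eq_bigr => i _ /=.
by rewrite rmorphM rmorphXn rmorph_ev1.
Qed.

Lemma rmorph_eq_id (s : {rmorphism L -> L}) : (forall k, s (jota k) = jota k) ->
  s x = x -> s y = y -> s =1 id.
Proof.
move=> sj sx sy u; have [g1 [g2 [_ ->]]] := curve_rat u.
by rewrite fmorph_div !rmorph_ev2 // sy.
Qed.

(** Substitution of [y'] for [y]: it respects the relations, all multiples of [h], and by [ev2_norm]
    it sends no denominator to 0. *)
Lemma curve_conj y' : y' ^+ m = ev1 x f -> exists s : {rmorphism L -> L},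
  [/\ forall k, s (jota k) = jota k, s x = x & s y = y'].
Proof.
move=> y'm; have ker g : ev2 x y g = 0 -> ev2 x y' g = 0.
  move=> /curve_ker[q ->]; rewrite rmorphM /=; rewrite [ev2 x y' h]ev2_kummer y'm subrr.
  by rewrite mulr0.
have nz g : ev2 x y g != 0 -> ev2 x y' g != 0.
  move=> g0; have [g' [R [R0 E]]] := ev2_norm m0 curve_eq g0.
  apply: contraNneq R0 => g'0; have : ev2 x y' (g * g' - R%:P) = 0.
    by apply: ker; rewrite ev2B E ev2C subrr.
  rewrite ev2B ev2C => /eqP; rewrite subr_eq0 rmorphM /= [ev2 x y' g]g'0 mul0r => /eqP <-.
  by [].
have [F1 HF1] := choice curve_rat; have [F2 HF2] := choice HF1.
pose s u := ev2 x y' (F1 u) / ev2 x y' (F2 u).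
have sE p q : ev2 x y q != 0 -> s (ev2 x y p / ev2 x y q) = ev2 x y' p / ev2 x y' q.
  move=> q0; set u := _ / _; have [Fu0 Eu] := HF2 u.
  apply/eqP; rewrite /s eqr_div ?nz //; apply/eqP.
  have := ker (F1 u * q - p * F2 u); rewrite !ev2B => K0.
  apply/eqP; rewrite -subr_eq0 -!rmorphM /=; apply/eqP; apply: K0; rewrite !rmorphM /=.
  have : ev2 x y p / ev2 x y q = ev2 x y (F1 u) / ev2 x y (F2 u) by [].
  by move/eqP; rewrite eqr_div // => /eqP->; rewrite subrr.
have ratE u : exists p q, ev2 x y q != 0 /\ u = ev2 x y p / ev2 x y q by apply: curve_rat.
have sB : zmod_morphism s.
  move=> u v; have [p [q [q0 ->]]] := ratE u; have [p' [q' [q'0 ->]]] := ratE v.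
  have qq0 : ev2 x y (q * q') != 0 by rewrite rmorphM mulf_neq0.
  have -> : ev2 x y p / ev2 x y q - ev2 x y p' / ev2 x y q' =
    ev2 x y (p * q' - p' * q) / ev2 x y (q * q').
    by rewrite -mulNr addf_div // ev2B !rmorphM /= mulNr.
  by rewrite !sE // ev2B !rmorphM /= -[in RHS]mulNr addf_div ?nz // mulNr.
have one : ev2 x y 1 != 0 by rewrite rmorph1 oner_neq0.
have s_ev p : s (ev2 x y p) = ev2 x y' p.
  by have := sE p 1 one; rewrite !rmorph1 !divr1.
have sM : monoid_morphism s.
  split=> [|u v]; first by have := s_ev 1; rewrite !rmorph1.
  have [p [q [q0 ->]]] := ratE u; have [p' [q' [q'0 ->]]] := ratE v.
  have qq0 : ev2 x y (q * q') != 0 by rewrite rmorphM mulf_neq0.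
  rewrite mulf_div -!rmorphM /= !sE //; rewrite ?rmorphM /=.
  by rewrite mulf_div.
pose S : {rmorphism L -> L} := HB.pack s (GRing.isZmodMorphism.Build L L s sB)
  (GRing.isMonoidMorphism.Build L L s sM).
exists S; split=> [k||] /=.
- by have := s_ev k%:P%:P; rewrite !ev2C !ev1C.
- by have := s_ev 'X%:P; rewrite !ev2C !ev1X.
by have := s_ev 'X; rewrite !ev2X.
Qed.

Lemma curve_rotation (z : K) : z ^+ m = 1 -> exists s t : {rmorphism L -> L},
  [/\ cancel s t, cancel t s, forall k, s (jota k) = jota k, s x = x & s y = jota z * y].
Proof.
move=> zm; have z0 : z != 0 by apply: contra_eq_neq zm => ->; rewrite expr0n gtn_eqF // eq_sym oner_neq0.
have rot k : k ^+ m = 1 -> (jota k * y) ^+ m = ev1 x f.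
  by move=> km; rewrite exprMn -rmorphXn km rmorph1 mul1r curve_eq.
have [s [sj sx sy]] := curve_conj (rot z zm).
have [t [tj tx ty]] := curve_conj (rot z^-1 (etrans (exprVn _ _) (etrans (congr1 _ zm) (invr1 _)))).
exists s, t; split=> // u.
  have := @rmorph_eq_id (t \o s) _ _ _ u; apply=> [k||] /=; rewrite ?sj ?tj ?sx ?tx //.
  by rewrite sy rmorphM tj ty /= mulrA -rmorphM divff // rmorph1 mul1r.
have := @rmorph_eq_id (s \o t) _ _ _ u; apply=> [k||] /=; rewrite ?sj ?tj ?sx ?tx //.
by rewrite ty rmorphM sj sy /= mulrA -rmorphM mulVf // rmorph1 mul1r.
Qed.

Section Rotation.
Variables (s t : {rmorphism L -> L}).
Hypotheses (sK : cancel s t) (tK : cancel t s) (sj : forall k, s (jota k) = jota k) (sx : s x = x).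

Lemma place_pullback (s' t' : {rmorphism L -> L}) (P : place jota) : cancel t' s' ->
  (forall k, s' (jota k) = jota k) -> exists Q : place jota, forall u, Q u = P (s' u).
Proof.
move=> t'K s'j.
have QM u v : u != 0 -> v != 0 -> P (s' (u * v)) = P (s' u) + P (s' v).
  by move=> u0 v0; rewrite rmorphM place_mul ?fmorph_eq0.
have QD u v : u != 0 -> v != 0 -> u + v != 0 -> Num.min (P (s' u)) (P (s' v)) <= P (s' (u + v)).
  by move=> u0 v0 uv0; rewrite rmorphD place_add -?rmorphD ?fmorph_eq0.
have Qc k : P (s' (jota k)) = 0 by rewrite s'j place_const.
have Qu : exists2 w, w != 0 & P (s' w) = 1.
  by have [w w0 Pw] := place_unif P; exists (t' w); rewrite ?fmorph_eq0 ?t'K.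
by exists (Place QM QD Qc Qu).
Qed.

(* The degree vanishes because s permutes the places: no degree theorem for
   principal divisors is needed. *)
Lemma conj_divisor (n : nat) u : u != 0 -> (0 < n)%N ->
  (forall P : place jota, exists k, P u = n%:Z * k) ->
  exists2 E : {freeg (place jota) / int}, deg E = 0 & forall P, coeff P (E *+ n) = P (s u / u).
Proof.
move=> u0 n0 /choice[k kE]; have [B HB] := support_finite u0.
have [S uS SE] := places_over_seq B.
have tj i : t (jota i) = jota i by rewrite -[in LHS]sj sK.
have [pl plE] := choice (fun P => place_pullback P tK sj).
have [pl' pl'E] := choice (fun P => place_pullback P sK tj).
have plK : cancel pl pl' by move=> P; apply: placeP => v; rewrite pl'E plE tK.
have pl'K : cancel pl' pl by move=> P; apply: placeP => v; rewrite plE pl'E sK.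
have xE P : pl P x = P x by rewrite plE sx.
have xbE P b : pl P (x - jota b) = P (x - jota b) by rewrite plE rmorphB /= sx sj.
have plS P : (pl P \in S) = (P \in S).
  apply/idP/idP => /SE HP; apply/SE; case: HP => [|[b bB]]; rewrite ?xE ?xbE => HP; try by left.
    by right; exists b.
  by right; exists b; rewrite ?xbE.
have k0 P : P \notin S -> k P = 0.
  move=> PS; have Pu : P u = 0 by apply: contraNeq PS => /HB/SE.
  have := kE P; rewrite Pu => /esym/eqP; rewrite mulf_eq0 => /orP[|/eqP//].
  by rewrite eqz_nat gtn_eqF.
pose e P := k (pl P) - k P.
exists (\sum_(P <- S) << e P *g P >>).
  rewrite raddf_sum (eq_bigr e) => [|P _]; last exact: degU.
  rewrite /e big_split sumrN /= -(big_map pl xpredT) [X in X - _](perm_big S) ?subrr //.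
  apply: uniq_perm; rewrite ?map_inj_uniq //; first exact: can_inj plK.
  move=> P; apply/mapP/idP => [[Q QS ->]|PS]; first by rewrite plS.
  by exists (pl' P); rewrite ?pl'K // -plS pl'K.
move=> P; rewrite coeffMn [X in X *+ n](_ : _ = e P); last first.
  rewrite raddf_sum (eq_bigr (fun Q => e Q * (Q == P)%:R)) => [|Q _]; last exact: coeffU.
  have [PS|PS] := boolP (P \in S).
    rewrite (bigD1_seq P) //= eqxx mulr1 big1 ?addr0 // => Q /negPf->; exact: mulr0.
  rewrite big_seq big1 ?/e => [|Q QS]; first by rewrite !k0 ?plS // subrr.
  by case: eqP => [QP|_]; [rewrite -QP QS in PS | rewrite mulr0].
rewrite place_mul ?invr_eq0 ?fmorph_eq0 // ordV -plE !kE -mulrBr.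
by rewrite -[n%:Z]natz mulr_natl.
Qed.

End Rotation.

(** * Powers of [x] as a p-basis, and fixed differentials *)

Section Characteristic.
Variables (p e : nat) (pK : p \in [pchar K]).
Hypothesis pme : p.-1 = (m * e)%N.

Let pL : p \in [pchar L]. Proof. by rewrite (rmorph_pchar jota). Qed.
Let p_pr : prime p := pcharf_prime pK.
Let p0 : (0 < p)%N := prime_gt0 p_pr.

Definition cartier_poly (j : nat) : {poly K} := zpow j ^+ e.
Local Notation F := cartier_poly.

Lemma cartier_poly_neq0 j : F j != 0.
Proof. by rewrite expf_neq0 // monic_neq0 // branch_poly_monic. Qed.

Lemma zelt_pth j : zelt j ^+ p = zelt j * ev1 x (F j).
Proof. by rewrite -{1}(prednK p0) pme exprS exprM zelt_expm -rmorphXn. Qed.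

Lemma zelt_inv_pth j : (zelt j)^-1 = (zelt j)^-1 ^+ p * ev1 x (F j).
Proof.
apply: (mulfI (expf_neq0 p (zelt_neq0 j))); rewrite exprVn mulVKf ?expf_neq0 ?zelt_neq0 //.
by rewrite zelt_pth mulrAC divff ?mul1r ?zelt_neq0.
Qed.

Let frobD (u v : L) : (u + v) ^+ p = u ^+ p + v ^+ p.
Proof. exact: (rmorphD (pFrobenius_aut pL)). Qed.

Let frob_sum (I : Type) (s : seq I) (A : pred I) (W : I -> L) :
  (\sum_(i <- s | A i) W i) ^+ p = \sum_(i <- s | A i) W i ^+ p.
Proof. exact: (rmorph_sum (pFrobenius_aut pL)). Qed.

Let spanned u := exists w : 'I_p -> L, u = \sum_(i < p) w i ^+ p * x ^+ i.

Let spannedD u v : spanned u -> spanned v -> spanned (u + v).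
Proof.
move=> [w ->] [w' ->]; exists (fun i => w i + w' i); rewrite -big_split; apply: eq_bigr => i _ /=.
by rewrite frobD mulrDl.
Qed.

Let spannedM v u : spanned u -> spanned (v ^+ p * u).
Proof.
move=> [w ->]; exists (fun i => v * w i); rewrite big_distrr; apply: eq_bigr => i _ /=.
by rewrite exprMn mulrA.
Qed.

Let spanned0 : spanned 0.
Proof. by exists (fun=> 0); rewrite big1 // => i _; rewrite expr0n gtn_eqF // mul0r. Qed.

Let spanned_sum (I : Type) (s : seq I) (W : I -> L) :
  (forall i, spanned (W i)) -> spanned (\sum_(i <- s) W i).
Proof.
by move=> sW; elim: s => [|i s IH]; rewrite ?big_nil ?big_cons //; apply: spannedD.
Qed.

Let spanned_xn n : spanned (x ^+ n).
Proof.
exists (fun i => if (i : nat) == (n %% p)%N then x ^+ (n %/ p) else 0).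
rewrite (bigD1 (Ordinal (ltn_pmod n p0))) //= eqxx -exprM -exprD -divn_eq big1 ?addr0 // => i.
by rewrite -val_eqE /= => /negPf->; rewrite expr0n gtn_eqF // mul0r.
Qed.

Let spanned_ev1 g : spanned (ev1 x g).
Proof.
rewrite -[g]coefK poly_def rmorph_sum; apply: spanned_sum => i /=.
have [b bp] := closed_nth_root g`_i p0.
by rewrite -mul_polyC rmorphM /= ev1C rmorphXn /= ev1X -bp rmorphXn; apply: spannedM; apply: spanned_xn.
Qed.

(** Denominators are absorbed into p-th powers, and [z_j = (z_j / F_j)^p F_j^(p-1)] reduces to
    polynomials in [x], whose coefficients are p-th powers. *)
Lemma x_pbasis u : exists w : 'I_p -> L, u = \sum_(i < p) w i ^+ p * x ^+ i.
Proof.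
have [R [G [R0 E]]] := zelt_form u; have R0' : ev1 x R != 0 by rewrite ev1_eq0.
have -> : u = (ev1 x R)^-1 ^+ p * (ev1 x R ^+ p.-1 * \sum_(j < m) ev1 x (G j) * zelt j).
  by rewrite -E mulrA mulrA -mulrA mulrCA -exprSr prednK // exprVn mulVKf // expf_neq0.
apply: spannedM; rewrite big_distrr; apply: spanned_sum => j /=.
have F0 : ev1 x (F j) != 0 by rewrite ev1_eq0 cartier_poly_neq0.
have -> : ev1 x R ^+ p.-1 * (ev1 x (G j) * zelt j) =
    (zelt j / ev1 x (F j)) ^+ p * ev1 x (R ^+ p.-1 * G j * F j ^+ p.-1).
  have evX q : ev1 x (q ^+ p.-1) = ev1 x q ^+ p.-1 by rewrite rmorphXn.
  rewrite expr_div_n zelt_pth -[in (_ ^+ p)^-1](prednK p0) !rmorphM /= !evX exprS.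
  have Fp : ev1 x (F j) ^+ p.-1 != 0 by rewrite expf_neq0.
  move: (ev1 x R ^+ _) (ev1 x (F j)) F0 Fp (zelt j) (ev1 x (G j)) => s t t0.
  by move: (t ^+ p.-1) => tp tp0 v w; field; rewrite ?t0 ?tp0.
by apply: spannedM.
Qed.

Let p_gt_m : (m < p)%N.
Proof.
by rewrite -(prednK p0) ltnS pme leq_pmulr // lt0n; apply: contraTneq p_pr => e0; rewrite -(prednK p0) pme e0 muln0.
Qed.

Lemma p_tame_unit (P : place jota) X : P X = 1 -> p_tame p P X.
Proof. by move=> PX n k; rewrite PX mulr1 => ->; exists k. Qed.

Lemma p_tame_m (P : place jota) X : `|P X|%N = m -> p_tame p P X.
Proof.
move=> PX n k E; have : (p %| `|n| * m)%N.
  by rewrite -PX -abszM E abszM dvdn_mulr.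
rewrite Euclid_dvdM // [(p %| m)%N]gtnNdvd // orbF => pn.
have /dvdzP[k' ->] : (p%:Z %| n)%Z by [].
by exists k'; rewrite mulrC.
Qed.

Lemma x_sub_tame (P : place jota) b : 0 < P (x - jota b) -> p_tame p P (x - jota b).
Proof.
move=> Pb; have [/eqP/root_branch_poly[i bE]|fb] := eqVneq f.[b] 0.
  by rewrite bE in Pb *; apply: p_tame_m; rewrite (ram_place_ord Pb).
exact: p_tame_unit (unram_place_ord fb Pb).
Qed.

Lemma x_tame (P : place jota) : P x < 0 -> p_tame p P x.
Proof. by move=> Px; apply: p_tame_m; rewrite (inf_place_ord Px) abszN. Qed.

Lemma x_pindep (w : 'I_p -> L) : \sum_(i < p) w i ^+ p * x ^+ i = 0 -> forall i, w i = 0.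
Proof.
have [P Pm] := inf_place_ex; have Px : P x < 0 by rewrite Pm oppr_lt0 ltz_nat.
exact: (pth_powers_indep pK (x_tame Px)).
Qed.

(** As [p = 1] mod [m], the order at infinity of a nonzero term is [ztotal j] mod [m], and these
    residues are distinct. *)
Lemma zelt_inv_indep (G : 'I_m -> {poly K}) :
  \sum_(j < m) ev1 x (G j) * (zelt j)^-1 ^+ p = 0 -> forall j, G j = 0.
Proof.
move=> S0 j; apply/eqP; apply: contraTT isT => Gj.
have [P Pm] := inf_place_ex; have Px : P x < 0 by rewrite Pm oppr_lt0 ltz_nat.
have t0 k : (ev1 x (G k) * (zelt k)^-1 ^+ p == 0) = (G k == 0).
  by rewrite mulf_eq0 expf_eq0 invr_eq0 (negPf (zelt_neq0 _)) andbF orbF ev1_eq0.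
have ordt k : G k != 0 -> P (ev1 x (G k) * (zelt k)^-1 ^+ p) =
    (p * ztotal k)%N%:Z - (m * (size (G k)).-1)%N%:Z.
  move=> Gk; rewrite place_mul ?ev1_eq0 ?expf_neq0 ?invr_eq0 ?zelt_neq0 // ordX ordV.
  by rewrite (ord_ev1_pole Px Gk) (ord_zelt_infE _ Px) Pm !PoszM; ring.
have [||] := @ord_sum_distinct _ _ _ P _ (fun j => ev1 x (G j) * (zelt j)^-1 ^+ p) j.
- move=> k l kl; rewrite !t0 => Gk Gl; rewrite !ordt //; apply: contra_neq kl => E.
  apply: (mulmod_inj hasum); rewrite -!ztotal_mod.
  have {E} : (p * ztotal k + m * (size (G l)).-1 = p * ztotal l + m * (size (G k)).-1)%N.
    by move: E; clear; lia.
  rewrite -(prednK p0) pme !mulSn => /(congr1 (modn^~ m)).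
  rewrite -!mulnA -!addnA -!mulnDr ![(m * _)%N]mulnC.
  by rewrite ![(_ + _ * m)%N]addnC !modnMDl.
- by rewrite t0.
by rewrite S0 eqxx.
Qed.

Section CartierSplit.
Variable D : L -> L.
Hypotheses (DD : {morph D : u v / u + v}) (DM : forall u v, D (u * v) = D u * v + u * D v).
Hypotheses (Dpth : forall w, D (w ^+ p) = 0) (Dx : D x = 1).

(** By [zelt_inv_pth] both sides are combinations of the [(zelt j)^-1 ^+ p] over K[x], and
    [zelt_inv_indep] separates the components. *)
Lemma cartier_split (H : 'I_m -> {poly K}) (eta := \sum_(j < m) ev1 x (H j) / zelt j) :
  iter p.-1 D eta = - eta ^+ p <-> forall j, (H j * F j)^`(p.-1) = - H j ^+ p.
Proof.
have dE : iter p.-1 D eta = \sum_(j < m) ev1 x ((H j * F j)^`(p.-1)) * (zelt j)^-1 ^+ p.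
  rewrite /eta (iter_deriv_sum pK DD Dpth); apply: eq_bigr => j _; rewrite [in LHS]zelt_inv_pth mulrCA -rmorphM.
  have hE g : iter p.-1 D (ev1 x g) = ev1 x g^`(p.-1) by exact: (iter_deriv_horner jota pK DD DM Dpth Dx).
  by rewrite (iter_deriv_pth_mul DM Dpth) hE mulrC.
have pE : eta ^+ p = \sum_(j < m) ev1 x (H j ^+ p) * (zelt j)^-1 ^+ p.
  by rewrite /eta frob_sum; apply: eq_bigr => j _; rewrite exprMn rmorphXn.
rewrite dE pE -sumrN; split=> [E j|E]; last first.
  by apply: eq_bigr => j _; rewrite E rmorphN mulNr.
apply/eqP; rewrite -addr_eq0; apply/eqP.
apply: (zelt_inv_indep (G := fun j => (H j * F j)^`(p.-1) + H j ^+ p)).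
rewrite (eq_bigr (fun j => ev1 x ((H j * F j)^`(p.-1)) * (zelt j)^-1 ^+ p
  + ev1 x (H j ^+ p) * (zelt j)^-1 ^+ p)) => [|k _]; last by rewrite rmorphD mulrDl.
by rewrite big_split /= E -big_split big1 //= => k _; rewrite addNr.
Qed.


Let D_sum (I : Type) (s : seq I) (W : I -> L) : D (\sum_(i <- s) W i) = \sum_(i <- s) D (W i).
Proof. exact: (iter_deriv_sum pK DD Dpth s W 1). Qed.

Let D_pth_mul w u : D (w ^+ p * u) = w ^+ p * D u.
Proof. exact: (iter_deriv_pth_mul DM Dpth w u 1). Qed.

Let D_ev1 g : D (ev1 x g) = ev1 x g^`().
Proof. exact: (deriv_horner jota pK DD DM Dpth Dx). Qed.

Let D_x_sub b : D (x - jota b) = 1.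
Proof. by rewrite -ev1_XsubC D_ev1 derivXsubC rmorph1. Qed.

Lemma conj_deriv (s : {rmorphism L -> L}) u : (forall k, s (jota k) = jota k) -> s x = x ->
  s (D u) = D (s u).
Proof.
move=> sj sx; have [w ->] := x_pbasis u.
rewrite D_sum !rmorph_sum D_sum; apply: eq_bigr => i _ /=.
rewrite D_pth_mul !rmorphM !rmorphXn /= sx D_pth_mul; congr (_ * _).
have -> : x ^+ i = ev1 x 'X^i by rewrite rmorphXn /= ev1X.
by rewrite D_ev1 rmorph_ev1.
Qed.

Lemma log_derivative_orders eta u : regular_differential eta -> u != 0 -> D u = eta * u ->
  forall P : place jota, exists k, P u = p%:Z * k.
Proof.
move=> [fin inf] u0 Du P; have [Px|[b Pb]] := place_trichotomy P.
  exact: (ord_log_exponential pK (x_tame Px) DD DM Dpth Dx x_pbasis u0 Du (inf P Px)).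
exact: (ord_log_exponential pK (x_sub_tame Pb) DD DM Dpth (D_x_sub b) (shifted_basis jota pK x_pbasis b) u0 Du (fin P b Pb)).
Qed.

Lemma log_derivative_regular u : u != 0 -> (forall P : place jota, exists k, P u = p%:Z * k) ->
  regular_differential (D u / u).
Proof.
move=> u0 Pu; have aux (P : place jota) X : ord_ge P (P u + 1) (X * D u) -> ord_ge P 1 (X * (D u / u)).
  move=> H; rewrite mulrA -[1]addr0 -(subrr (P u)) addrA [1 + _]addrC ord_geM //.
  by rewrite ord_geE ?invr_eq0 // ordV.
split=> [P b Pb|P Px]; apply: aux; have [k Pk] := Pu P.
  exact: (ord_log_derivative pK (x_sub_tame Pb) DD DM Dpth (D_x_sub b) (shifted_basis jota pK x_pbasis b) u0 Pk).
exact: (ord_log_derivative pK (x_tame Px) DD DM Dpth Dx x_pbasis u0 Pk).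
Qed.

Let D_const_pth k v : D (jota k * v ^+ p) = 0.
Proof. by have [b <-] := closed_nth_root k p0; rewrite rmorphXn -exprMn Dpth. Qed.

Lemma p_rank0_cartier : p_rank0 jota p -> forall j (H : {poly K}), (0 < j < m)%N ->
  (m * size H <= ztotal j)%N -> (H * F j)^`(p.-1) = - H ^+ p -> H = 0.
Proof.
move=> rk0 j H jm szH HF; apply/eqP; apply: contraT => H0.
pose eta := ev1 x H / zelt j; have eta0 : eta != 0 by rewrite mulf_neq0 ?invr_eq0 ?zelt_neq0 ?ev1_eq0.
have reg : regular_differential eta by apply: regular_quotient.
have fixed : iter p.-1 D eta = - eta ^+ p.
  pose oj := Ordinal (proj2 (andP jm)).
  have [_ cs] := cartier_split (fun k => if k == oj then H else 0).
  move: cs; rewrite (bigD1 oj) //= eqxx big1 ?addr0 => [cs|k /negPf->]; last by rewrite rmorph0 mul0r.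
  apply: cs => k; case: eqP => [->//|_].
  by rewrite mul0r expr0n gtn_eqF // oppr0 raddf0.
have [u u0 Du] := log_derivative_exists pK x_pbasis DD DM Dpth Dx curve_x_transc fixed.
have Pu := log_derivative_orders reg u0 Du.
have [z zm z1] := unity_root_neq1; have [s [t [sK tK sj sx sy]]] := curve_rotation zm.
have [E dE EP] := conj_divisor sK tK sj sx u0 p0 Pu.
set w := s u / u in EP; have w0 : w != 0 by rewrite mulf_neq0 ?invr_eq0 ?fmorph_eq0.
have [v v0 vE] : principal E by apply: rk0 => //; exists w.
(* All orders of [w / v^p] are 0, so [w] is a constant times a p-th power and [D w = 0]: [u] and
   [s u] have the same logarithmic derivative. *)
have [k k0 wE] : exists2 k, k != 0 & w / v ^+ p = jota k.
  apply: ord_all0_const; first by rewrite mulf_neq0 ?invr_eq0 ?expf_neq0.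
  move=> P; rewrite place_mul ?invr_eq0 ?expf_neq0 // ordV ordX -EP coeffMn vE.
  by rewrite -[p%:Z]natz mulr_natl subrr.
have Dw : D w = 0 by rewrite -[w](divfK (expf_neq0 p v0)) wE D_const_pth.
have suE : s u = w * u by rewrite divfK.
have : s (D u) = eta * s u by rewrite conj_deriv // suE DM Dw mul0r add0r Du mulrCA.
rewrite Du rmorphM => /mulIf; rewrite fmorph_eq0 => /(_ u0).
(* So [s] fixes [eta], yet it divides it by [z^j], which is not 1 since [m] does not divide [j]. *)
have sz : s (zelt j) = jota (z ^+ j) * zelt j.
  by rewrite /zelt fmorph_div rmorphXn rmorph_ev1 //= sy exprMn rmorphXn mulrA.
rewrite {1}/eta fmorph_div rmorph_ev1 // sz => E1.
have zj0 : jota (z ^+ j) != 0.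
  by apply: contra_eq_neq E1 => z0; rewrite z0 mul0r invr0 mulr0 eq_sym.
have : jota (z ^+ j) = 1.
  apply: (mulIf eta0); rewrite mul1r -[in LHS]E1 /eta.
  have nz := zelt_neq0 j; move: (zelt j) nz (jota _) (ev1 x H) zj0 => zz zz0 q g q0.
  by field; rewrite ?q0 ?zz0.
move/eqP; rewrite fmorph_eq1 => /eqP zj1; have := unity_root_pow zm z1 zj1.
by case/andP: jm => j0 jm; rewrite gtnNdvd.
Qed.

Lemma cartier_p_rank0 : (forall j (H : {poly K}), (0 < j < m)%N ->
  (m * size H <= ztotal j)%N -> (H * F j)^`(p.-1) = - H ^+ p -> H = 0) -> p_rank0 jota p.
Proof.
move=> noH E _ [u u0 uE]; have Pu (P : place jota) : P u = p%:Z * coeff P E.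
  by rewrite -uE coeffMn -[p%:Z]natz mulr_natl.
have [Pi Pix] := inf_place_ex; have Pi0 : Pi x < 0 by rewrite Pix oppr_lt0 ltz_nat.
have [Du|Du] := eqVneq (D u) 0.
  have [v uv] := pth_power_of_deriv0 pK (x_tame Pi0) DD DM Dpth Dx x_pbasis Du.
  have v0 : v != 0 by apply: contraNneq u0 => v0; rewrite uv v0 expr0n gtn_eqF.
  exists v => // P; have := Pu P; rewrite uv ordX => /mulfI ->//.
  by rewrite eqz_nat gtn_eqF.
have reg : regular_differential (D u / u) by apply: log_derivative_regular => // P; exists (coeff P E).
have [H [szH etaE]] := regular_differential_form reg.
have := log_derivative_fixed pK x_pbasis DD DM Dpth Dx curve_x_transc u0.
rewrite etaE cartier_split => HF.
(* For [j = 0] the size bound is [ztotal 0 = 0]. *)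
have H0 j : H j = 0.
  case: (posnP j) => [j0|j0]; last by apply: (noH j); rewrite ?j0 ?ltn_ord.
  apply/eqP; rewrite -size_poly_eq0; have := szH j; rewrite j0 /ztotal big1 => [|i _].
    by rewrite leqn0 muln_eq0 (gtn_eqF m0).
  by rewrite mul0n mod0n.
have eta0 : D u / u != 0 by rewrite mulf_neq0 ?invr_eq0.
by case/eqP: eta0; rewrite etaE big1 // => j _; rewrite H0 rmorph0 mul0r.
Qed.

End CartierSplit.

Theorem p_rank0P : p_rank0 jota p <-> forall j (H : {poly K}), (0 < j < m)%N ->
  (m * size H <= ztotal j)%N -> (H * F j)^`(p.-1) = - H ^+ p -> H = 0.
Proof.
have [D [DD DM Dpth Dx]] := derivation_exists jota pK x_pbasis x_pindep.
by split; [apply: (p_rank0_cartier DD DM Dpth Dx) | apply: (cartier_p_rank0 DD DM Dpth Dx)].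
Qed.

End Characteristic.

End Curve.

(** * Comparison with the sums over monic polynomials *)

Section CartierCoefficients.
Variables (K : fieldType) (p : nat) (pK : p \in [pchar K]).
Let p_pr : prime p := pcharf_prime pK.
Let p0 : (0 < p)%N := prime_gt0 p_pr.

(** The product of [n+1, ..., n+p-1] is [(p-1)! = -1] mod [p] when [p] divides [n], and otherwise
    has a factor divisible by [p]. *)
Lemma coef_derivn_pred (q : {poly K}) n :
  (q^`(p.-1))`_n = if (p %| n)%N then - q`_(n + p.-1) else 0.
Proof.
rewrite coef_derivn addnC -mulr_natr; case: ifP => [/dvdnP[k ->]|pn].
  rewrite ffact_prod natr_prod (eq_bigr (fun i : 'I_p.-1 => (p.-1 - i)%:R)) => [|i _]; last first.
    by rewrite -addnBA ?(ltnW (ltn_ord i)) // natrD natrM (pcharf0 pK) mulr0 add0r.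
  rewrite -natr_prod -ffact_prod ffactnn.
  suff -> : (p.-1)`!%:R = -1 :> K by rewrite mulrN1.
  by apply/eqP; rewrite -addr_eq0 natr1 -(dvdn_pcharf pK) -Wilson ?prime_gt1.
suff /eqP-> : ((n + p.-1) ^_ p.-1)%:R == 0 :> K by rewrite mulr0.
rewrite -(dvdn_pcharf pK); have : (p %| (n + p.-1) ^_ p)%N.
  by rewrite -bin_ffact dvdn_mull // -[X in (X)`!](prednK p0) factS dvdn_mulr // prednK.
by rewrite -[X in _ ^_ X](prednK p0) ffactnSr addnK Euclid_dvdM // pn orbF.
Qed.

Lemma coef_expr_char (q : {poly K}) n :
  (q ^+ p)`_n = if (p %| n)%N then q`_(n %/ p) ^+ p else 0.
Proof.
have pP : p \in [pchar {poly K}] by rewrite pchar_poly.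
have -> : q ^+ p = map_poly (pFrobenius_aut pK) q \Po 'X^p.
  rewrite -[in LHS](coefK q) poly_def -(pFrobenius_autE pP) rmorph_sum.
  rewrite comp_polyE size_map_poly; apply: eq_bigr => i _.
  by rewrite /= !pFrobenius_autE exprZn coef_map /= pFrobenius_autE -!exprM mulnC.
by rewrite coef_comp_poly_Xn // coef_map.
Qed.

Lemma derivn_pred_cartier (h F : {poly K}) : (h * F)^`(p.-1) = - h ^+ p <->
  forall k, (h * F)`_(k * p + (p - 1)) = h`_k ^+ p.
Proof.
split=> [E k|E].
  have := congr1 (fun q : {poly K} => q`_(k * p)) E.
  by rewrite coefN coef_derivn_pred coef_expr_char dvdn_mull // mulnK // subn1 => /oppr_inj.
apply/polyP => n; rewrite coefN coef_derivn_pred coef_expr_char.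
by case: ifP => [/dvdnP[k ->]|_]; rewrite ?oppr0 // mulnK // -subn1 E.
Qed.

End CartierCoefficients.

Lemma floor_nat_div (n m : nat) : (0 < m)%N -> Num.floor (n%:R / m%:R : rat) = (n %/ m)%:Z.
Proof.
move=> m0; have m0' : 0 < m%:R :> rat by rewrite ltr0n.
apply: floor_def; rewrite -[X in (_ <= _ < X)](_ : (n %/ m).+1%:R = _); last by rewrite -natr1 rmorphD.
rewrite -pmulrn ler_pdivlMr // ltr_pdivrMr // -!natrM ler_nat ltr_nat leq_trunc_div /=.
exact: ltn_ceil.
Qed.

Lemma floor_sum_fracpart (d m : nat) (b : 'I_d -> nat) : (0 < m)%N ->
  Num.floor (\sum_(i < d) fracpart ((b i)%:R / m%:R)) = ((\sum_(i < d) (b i %% m)) %/ m)%N%:Z.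
Proof.
move=> m0; rewrite -floor_nat_div // natr_sum mulr_suml; congr Num.floor; apply: eq_bigr => i _.
rewrite /fracpart floor_nat_div // {1}(divn_eq (b i) m) natrD natrM mulrDl mulfK.
  by rewrite -pmulrn addrAC subrr add0r.
by rewrite pnatr_eq0 -lt0n.
Qed.

Lemma eval_div_prod (k : fieldType) (K : closedFieldType) (iota : {rmorphism k -> K})
    (d : nat) (a : 'I_d -> nat) (alpha : seq k) (q : {poly k}) : q \is monic ->
  eval_div iota (curve_poly a alpha) q =
  iota (\prod_(i < d) ((-1) ^+ (size q).-1 * q.[branch_pt alpha i]) ^+ a i).
Proof.
move=> mq; rewrite /eval_div; case: closed_field_poly_normal => rs /= E.
have lq : lead_coef (map_poly iota q) = 1 by rewrite lead_coef_map (monicP mq) rmorph1.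
rewrite lq scale1r in E; have szq : (size q).-1 = size rs.
  by rewrite -(size_map_poly iota) E size_prod_XsubC.
have rootN (z : K) : \prod_(b <- rs) (b - z) = (-1) ^+ size rs * \prod_(b <- rs) (z - b).
  elim: rs {E szq} => [|b rs IH]; first by rewrite !big_nil mulr1.
  by rewrite !big_cons IH exprS; ring.
rewrite [in RHS]rmorph_prod /= szq /curve_poly rmorph_prod.
under eq_bigr => b _ do rewrite horner_prod.
rewrite exchange_big /=; apply: eq_bigr => i _; rewrite [in RHS]rmorphXn /=.
under eq_bigr => b _ do rewrite rmorphXn /= map_polyXsubC horner_exp.
rewrite prodrXl; congr (_ ^+ _); rewrite rmorphM rmorphXn rmorphN1 /= -horner_map E horner_prod.
rewrite (eq_bigr (fun b => b - iota (branch_pt alpha i))) => [|b _]; last by rewrite !hornerE.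
by rewrite rootN; congr (_ * _); apply: eq_bigr => b _; rewrite !hornerE.
Qed.

(** Fermat's little theorem for [w != 0]; for [w = 0], both exponents are positive because [m] does
    not divide [n]. *)
Lemma Fp_expr_mod (p m e n : nat) (w : 'F_p) : prime p -> p.-1 = (m * e)%N -> ~~ (m %| n)%N ->
  w ^+ (n * e) = w ^+ (n %% m * e).
Proof.
move=> p_pr pme mn; have e0 : (0 < e)%N.
  by rewrite lt0n; apply: contraTneq (prime_gt1 p_pr) => e0; rewrite -(prednK (prime_gt0 p_pr)) pme e0 muln0.
have [->|w0] := eqVneq w 0.
  rewrite !expr0n !muln_eq0 !(gtn_eqF e0) !orbF -/(dvdn m n) (negPf mn).
  by case: n mn => //; rewrite dvdn0.
have w1 : w ^+ (m * e) = 1.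
  by apply: (mulfI w0); rewrite -pme -exprS prednK ?prime_gt0 // Fp_expr // mulr1.
by rewrite {1}(divn_eq n m) mulnDl -mulnA exprD mulnC exprM w1 expr1n mul1r.
Qed.

Theorem corollary6p6
  (m : nat) (hm : prime m) (eps : algC) (heps : m.-primitive_root eps)
  (d : nat) (hd : (2 <= d)%N)
  (p : nat) (hp : prime p) (hsplit : splits_completely m eps d p)
  (a : 'I_d -> nat) (ha : forall i, (1 <= a i < m)%N)
  (hasum : ~~ (m %| \sum_(i < d) a i)%N)
  (alpha : (d - 2).-tuple 'F_p) (halpha_uniq : uniq alpha)
  (halpha : forall c, c \in alpha -> c != 0 /\ c != 1)
  (* an algebraic closure Fbar of F_p *)
  (Fbar : closedFieldType) (iota : {rmorphism 'F_p -> Fbar})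
  (hFbar : integralRange iota)
  (* the function field over Fbar of the curve y^m = f(x) *)
  (L : fieldType) (jota : {rmorphism Fbar -> L}) (x y : L)
  (hL : is_function_field jota
          ('X^m - (map_poly iota (curve_poly a alpha))%:P) x y)
  (hfloor : forall t : nat, (1 <= t <= m - 1)%N ->
     Num.floor (\sum_(i < d) fracpart ((t * a i)%:R / m%:R)) != 0) :
  [<-> p_rank0 jota p;
       forall l j : nat, (1 <= l <= d - 2)%N -> (1 <= j <= m - 1)%N ->
         \sum_(q : {poly_l.+1 'F_p} | (size q == l.+1) && ((q : {poly 'F_p}) \is monic))
            eval_div iota (curve_poly a alpha) q ^+ (j * (p - 1) %/ m) = 0;
       forall l j : nat, (1 <= l <= d - 2)%N -> (1 <= j <= m - 1)%N ->
         \sum_(q : {poly_l.+1 'F_p} | (size q == l.+1) && ((q : {poly 'F_p}) \is monic))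
            (\prod_(i < d) (q : {poly 'F_p}).[branch_pt alpha i] ^+ a i)
              ^+ (j * (p - 1) %/ m) = 0 :> 'F_p].
Proof.
have m_gt0 := prime_gt0 hm; have p_gt0 := prime_gt0 hp.
have p_ndvd : ~~ (p %| m)%N by case: hsplit => + _; apply: contra => /dvdn_mulr->.
pose e := (p.-1 %/ m)%N; have pme : p.-1 = (m * e)%N.
  rewrite mulnC divnK // -subn1 -eqn_mod_dvd //; case: hsplit => _ /eqP; rewrite eq_sym.
  by rewrite eq_sym.
have e_gt0 : (0 < e)%N.
  by rewrite lt0n; apply: contraTneq (prime_gt1 hp) => e0; rewrite -(prednK p_gt0) pme e0 muln0.
have pF : p \in [pchar Fbar] by rewrite (fmorph_pchar iota) pchar_Fp.
have mF : m%:R != 0 :> Fbar by rewrite -(dvdn_pcharf pF).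
have sz_pts : size [:: 0, 1 & alpha] = d.
  by rewrite /= size_tuple -addn2 subnK.
have pts_uniq : uniq [:: 0 : 'F_p, 1 & alpha].
  rewrite /= halpha_uniq andbT inE negb_or eq_sym oner_neq0 /=.
  by apply/andP; split; apply/negP => /halpha[]; rewrite eqxx.
have pt_inj : injective (fun i : 'I_d => branch_pt alpha i).
  move=> i j /eqP; rewrite /branch_pt nth_uniq ?sz_pts // => /eqP; exact: val_inj.
pose c (i : 'I_d) := iota (branch_pt alpha i).
have c_inj : injective c by move=> i j /fmorph_inj/pt_inj.
(* Hence every [l] from 1 to [d - 2] is invertible mod [p]. *)
have d_le_p : (d <= p)%N.
  by rewrite -[X in (_ <= X)%N](card_Fp hp) -[X in (X <= _)%N]card_ord; apply: leq_card pt_inj.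
have curveE (b : 'I_d -> nat) : map_poly iota (curve_poly b alpha) = branch_poly c b.
  rewrite rmorph_prod; apply: eq_bigr => i _.
  by rewrite rmorphXn /= map_polyXsubC.
rewrite curveE in hL.
pose E j i := (j * a i %% m * e)%N.
pose F j : {poly 'F_p} := \prod_(i < d) ('X - (branch_pt alpha i)%:P) ^+ E j i.
have FE j : map_poly iota (F j) = cartier_poly m a c e j.
  by rewrite -/(curve_poly (E j) alpha) curveE /cartier_poly /zpow branch_polyX.
pose s j := (ztotal m a j %/ m)%N.
(* The hypothesis at [t = m - j] says that [ztotal (m - j) >= m]. The two totals add up to [m d] and
   [m] does not divide [ztotal j], so [ztotal j < m (d - 1)]. *)
have s_le j : (0 < j < m)%N -> (s j <= d - 2)%N.
  move=> jm; have jm' : (1 <= m - j <= m - 1)%N by case/andP: jm; clear; lia.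
  have := hfloor (m - j)%N jm'; rewrite floor_sum_fracpart // eqz_nat -lt0n divn_gt0 //.
  rewrite -/(ztotal m a (m - j)) => le; have := ztotal_compl hm ha jm.
  have := divn_eq (ztotal m a j) m; rewrite -/(s j).
  have : (0 < ztotal m a j %% m)%N by rewrite lt0n; apply: (ndvd_ztotal hm hasum jm).
  move: (ztotal m a j %% m)%N (ztotal m a (m - j)) (ztotal m a j) le hd m_gt0.
  clear; nia.
(* [F j] has degree [e * ztotal j], where [ztotal j < m (s j + 1)] and [m e = p - 1]. *)
have szF j : (size (F j) <= (s j).+1 * (p - 1))%N.
  rewrite -(size_map_poly iota) FE /cartier_poly /zpow branch_polyX size_branch_poly -big_distrl /=.
  have := ltn_ceil (ztotal m a j) m_gt0; rewrite -/(s j) -/(ztotal m a j) subn1 pme => lt.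
  by rewrite mulnA ltn_pmul2r.
have rank0 : p_rank0 jota p <-> forall j, (1 <= j <= m - 1)%N -> forall l, (1 <= l <= d - 2)%N ->
    monic_sum l (norm_char (fun i : 'I_d => branch_pt alpha i) (E j)) = 0.
  rewrite (p_rank0P hm mF ha hasum c_inj hL pF pme).
  have nil j : (0 < j < m)%N -> (exists r, hasse_witt p (s j) (F j) ^+ r = 0) <->
      forall l, (1 <= l <= d - 2)%N ->
      monic_sum l (norm_char (fun i : 'I_d => branch_pt alpha i) (E j)) = 0.
    move=> jm; apply: (hasse_witt_nilpotentP iota hp (s_le j jm)) (szF j).
    by move: hd d_le_p; clear; lia.
  have jE j : (1 <= j <= m - 1)%N = (0 < j < m)%N by move: m_gt0; clear; lia.
  have szE j (H : {poly Fbar}) : (m * size H <= ztotal m a j)%N = (size H <= s j)%N.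
    by rewrite /s leq_divRL // mulnC.
  have s_lt j : (0 < j < m)%N -> (s j < p)%N.
    by move=> /s_le; move: hd d_le_p; clear; lia.
  split=> [noH j|N0 j H jm].
    rewrite jE => jm; apply/nil => //; apply: contrapT => /(cartier_fixed_exists iota hp (s_lt j jm) (szF j)).
    case=> H [H0 szH fixH]; case/eqP: H0; apply: (noH j) => //; first by rewrite szE.
    by apply/(derivn_pred_cartier pF) => k; rewrite -FE fixH.
  rewrite szE => szH /(derivn_pred_cartier pF) fixH.
  have [r Hr] : exists r, hasse_witt p (s j) (F j) ^+ r = 0 by apply/nil => //; apply: N0; rewrite jE.
  by apply: (cartier_fixed_nilpotent (phi := iota) hp (s_lt j jm) Hr szH) => k; rewrite FE fixH.
have exE j : (j * (p - 1) %/ m = j * e)%N by rewrite subn1 pme mulnCA mulKn.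
have termE j (w : 'I_d -> 'F_p) : (1 <= j <= m - 1)%N ->
    (\prod_(i < d) w i ^+ a i) ^+ (j * e) = \prod_(i < d) w i ^+ E j i.
  move=> /andP[j0 jm]; rewrite -prodrXl; apply: eq_bigr => i _.
  rewrite -exprM mulnA [(a i * j)%N]mulnC (@Fp_expr_mod p m) // Euclid_dvdM //.
  have /andP[a0 am] := ha i; rewrite !gtnNdvd //; move: m_gt0 jm; clear; lia.
have ii l j : (1 <= j <= m - 1)%N ->
    \sum_(q : {poly_l.+1 'F_p} | (size q == l.+1) && ((q : {poly 'F_p}) \is monic))
      eval_div iota (curve_poly a alpha) q ^+ (j * (p - 1) %/ m) =
    iota (monic_sum l (norm_char (fun i : 'I_d => branch_pt alpha i) (E j))).
  move=> jm; rewrite rmorph_sum; apply: eq_bigr => q /andP[_ mq].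
  by rewrite eval_div_prod // -rmorphXn exE termE.
(* The two kinds of sums differ by a sign that depends only on [l] and [j], so it comes out of the
   sum. *)
have iii l j : (1 <= j <= m - 1)%N ->
    (-1) ^+ (l * \sum_(i < d) E j i) *
    \sum_(q : {poly_l.+1 'F_p} | (size q == l.+1) && ((q : {poly 'F_p}) \is monic))
      (\prod_(i < d) (q : {poly 'F_p}).[branch_pt alpha i] ^+ a i) ^+ (j * (p - 1) %/ m) =
    monic_sum l (norm_char (fun i : 'I_d => branch_pt alpha i) (E j)).
  move=> jm; rewrite /monic_sum big_distrr; apply: eq_bigr => q /andP[/eqP szq mq] /=.
  rewrite exE termE // /norm_char exprM -prodrXr -big_split szq; apply: eq_bigr => i _ /=.
  by rewrite exprMn.
tfae.
- by move=> /rank0 N0 l j hl hj; rewrite ii // N0 // rmorph0.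
- move=> S0 l j hl hj; apply: (mulfI (_ : (-1) ^+ (l * \sum_(i < d) E j i) != 0)).
    by rewrite signr_eq0.
  by apply/eqP; rewrite iii // mulr0 -(fmorph_eq0 iota) -ii // S0.
by move=> S0; apply/rank0 => j hj l hl; rewrite -iii // S0 // mulr0.
Qed.
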